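(* Let $(n_k)_{k\in\mathbb N}$ be a lacunary sequence of positive integers, i.e. $\liminf_{k\to\infty} n_{k+1}/n_k \ge q$ for some $q>1$. Let $(c_{k,N})_{k\le N,\,N\in\mathbb N}$ be a triangular array of non-negative reals with $$\sup_{N\in\mathbb N}\sup_{k\le N} c_{k,N}\le 1,\qquad h(N):=\sum_{k\le N}c_{k,N}^2\longrightarrow\infty\quad (N\to\infty).$$ Let $f\in\mathbb L_2(\mathbb T)$ be real-valued with $\int_{\mathbb T} f(x)\,\mathrm dx=0$ and $\int_{\mathbb T} f^2(x)\,\mathrm dx\in(0,\infty)$, with Fourier series $f(x)=\sum_{j=1}^\infty\left[a_j\cos(2\pi jx)+b_j\sin(2\pi jx)\right]$, and suppose there are constants $M>0$ and $\rho>\tfrac12$ such that $|a_j|+|b_j|\le M j^{-\rho}$ for all $j\in\mathbb N$. Assume that for every fixed $D\in\mathbb N$, $$L(N,D):=\sup_{c>0}\ \sum_{k,\ell\le N}\ \sum_{1\le j,j'\le D} c_{k,N}c_{\ell,N}\,\mathbf 1_{[jn_k-j'n_\ell=c]}=o(h(N))\quad (N\to\infty),$$ and that there is an absolute constant $\delta>0$ such that $$\Big\|\sum_{k\le N}c_{k,N}f(n_kx)\Big\|_2\ \ge\ \delta\sqrt{h(N)}.$$ Then $$\frac{\sum_{k\le N}c_{k,N}f(n_kx)}{\left\|\sum_{k\le N}c_{k,N}f(n_kx)\right\|_2}\ \stackrel{w}{\longrightarrow}\ \mathcal N(0,1)\qquad (N\to\infty).$$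
   Context: $\mathbb T=\mathbb R/\mathbb Z$ carries its Borel $\sigma$-algebra and normalized Haar (Lebesgue) measure, regarded as a probability space; functions of $x\in\mathbb T$ are random variables on it. $\|g\|_2=(\int_{\mathbb T}g(x)^2\,\mathrm dx)^{1/2}$. $\stackrel{w}{\longrightarrow}$ denotes convergence in distribution, and $\mathcal N(0,1)$ is the standard normal law. $\mathbf 1_{[P]}$ is $1$ if $P$ holds and $0$ otherwise. *)

(* Defs.v *)
From HB Require Import structures.
From mathcomp Require Import all_boot all_order all_algebra.
From mathcomp Require Import all_classical all_reals all_analysis.

Set Implicit Arguments.
Unset Strict Implicit.
Unset Printing Implicit Defensive.

Import Order.TTheory GRing.Theory Num.Theory.
Import numFieldNormedType.Exports.

Local Open Scope classical_set_scope.
Local Open Scope ring_scope.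

(* Functions on R/Z are 1-periodic functions on R; for these, integration
   against Haar measure is integration over the fundamental domain [0, 1]. *)
Definition haar {R : realType} : probability (measurableTypeR R) R :=
  uniform_prob (@ltr01 R).

Definition norm2 {R : realType} (g : R -> R) : R :=
  Num.sqrt (\int[haar]_x (g x ^+ 2)).

Definition fourier_cos {R : realType} (f : R -> R) (j : nat) : R :=
  2 * \int[haar]_x (f x * cos (2 * pi * j%:R * x)).

Definition fourier_sin {R : realType} (f : R -> R) (j : nat) : R :=
  2 * \int[haar]_x (f x * sin (2 * pi * j%:R * x)).

(* Throughout, indices k, N, j, D start at 1, and [c k N] is the entry
   $c_{k,N}$ of the array.  The liminf is taken in the extended reals, since
   it may be infinite. *)
Definition lacunary {R : realType} (q : R) (n : nat -> nat) : Prop :=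
  (q%:E <= limn_einf (fun k => ((n k.+1)%:R / (n k)%:R)%:E))%E.

Definition sumsq {R : realType} (c : nat -> nat -> R) (N : nat) : R :=
  \sum_(1 <= k < N.+1) c k N ^+ 2.

Definition lacunary_sum {R : realType} (c : nat -> nat -> R) (n : nat -> nat)
    (f : R -> R) (N : nat) (x : R) : R :=
  \sum_(1 <= k < N.+1) c k N * f ((n k)%:R * x).

(* The supremum is over positive integers [m], the only possible positive
   values of $j n_k - j' n_l$; the set is bounded, so the real [sup] is the
   actual least upper bound. *)
Definition dioph_count {R : realType} (c : nat -> nat -> R) (n : nat -> nat)
    (N D : nat) : R :=
  sup [set \sum_(1 <= k < N.+1) \sum_(1 <= l < N.+1)
           \sum_(1 <= j < D.+1) \sum_(1 <= j' < D.+1)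
             c k N * c l N * ((j * n k)%:Z - (j' * n l)%:Z == m)%:R
      | m in [set m : int | 0 < m]].

Definition cvg_in_distribution d (T : measurableType d) (R : realType)
    (P : probability T R) (X : nat -> T -> R)
    (Q : probability (measurableTypeR R) R) : Prop :=
  (forall N, measurable_fun setT (X N)) /\
  forall g : R -> R, continuous g -> bounded_fun g ->
    (\int[P]_x g (X N x)) @[N --> \oo] --> \int[Q]_y g y.

(* Main.v *)
(* Up to an error small in L2, uniformly in [N], the normalized sum is a sum over
   blocks of [p] consecutive indices, separated by gaps of bounded length [tau],
   of the Fourier partial sum of [f] of order [D] at [n_k x]: quasi-orthogonality
   of lacunary dilations bounds the Fourier tail, and a suitable shift of the
   blocks makes the gaps carry at most a share [tau / p] of [h N].  For the block
   sums [Y_b] write [expR (i Y)] as [(1 + i Y) expR (- Y^2 / 2)] up to [|Y|^3].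
   As frequencies of later blocks dominate all combinations of earlier ones,
   [\prod_b (1 + i t Y_b)] has mean exactly 1, so it only remains to see that
   [\sum_b Y_b^2] concentrates around its mean.  Its Fourier coefficients at
   differences [j n_k - j' n_l] are bounded by the Diophantine count, and those
   at sums come from one block only.  This gives the convergence of the
   characteristic functions; weak convergence follows by approximating a bounded
   continuous function [g], on large sets, by the periodic [g (A sin (x / A))]
   and then by trigonometric polynomials. *)

Require Import Defs.
From HB Require Import structures.
From mathcomp Require Import all_boot all_order all_algebra.
From mathcomp Require Import all_classical all_reals all_analysis.
From mathcomp Require Import measurable_realfun ring lra zify.

Set Implicit Arguments.
Unset Strict Implicit.
Unset Printing Implicit Defensive.

Import Order.TTheory GRing.Theory Num.Theory.
Import numFieldNormedType.Exports.
Local Open Scope classical_set_scope.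
Local Open Scope ring_scope.

(** * Square-integrable functions *)

Section square_integrable.
Context d (T : measurableType d) (R : realType) (P : probability T R).
Implicit Types f g : T -> R.

(** The parameters are fixed before N and in a forced order: D makes the Fourier tail small, which
    is possible because rho > 1/2 makes the series of j^(-2 rho) converge; tau then satisfies q^tau
    >= D + 1; p makes tau / p small; only then N grows. The lower bound on the norm turns errors
    measured against h N into errors measured against the variance, and it makes the normalized
    block sums, of order p / sqrt (h N), uniformly small. The blocks are not independent, and the
    exact mean of the product has a price: its modulus is only bounded by exp (Q / 2), where Q
    bounds the sum of the Y_b^2 pointwise. Such a Q independent of N exists for a trigonometric
    polynomial of fixed order, whereas f may be unbounded; this is why f is truncated first. Blocks
    being orthogonal, the mean of the sum of the Y_b^2 is exactly the variance of the sum, so no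
    limit of variances has to be identified. Complex numbers are avoided: the free phase phi in cos
    (t X + phi) carries real and imaginary parts at once. *)

Definition intg f := P.-integrable setT (EFin \o f).

Definition sqintg f := measurable_fun setT f /\ intg (fun x => f x ^+ 2).

Lemma intg_measurable f : intg f -> measurable_fun setT f.
Proof. by move=> /integrableP[/measurable_EFinP]. Qed.

Lemma intg_le f g : measurable_fun setT f -> (forall x, `|f x| <= g x) ->
  intg g -> intg f.
Proof.
move=> mf fg; apply: le_integrable => //; first exact/measurable_EFinP.
move=> x _ /=; rewrite lee_fin (le_trans (fg x))//.
exact: ler_norm.
Qed.

Lemma intgD f g : intg f -> intg g -> intg (fun x => f x + g x).
Proof. by move=> fi gi; exact: (integrableD measurableT fi gi). Qed.

Lemma intgZ (a : R) f : intg f -> intg (fun x => a * f x).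
Proof. by move=> fi; exact: (integrableZl measurableT a fi). Qed.

Lemma intgB f g : intg f -> intg g -> intg (fun x => f x - g x).
Proof. by move=> fi gi; exact: (integrableB measurableT fi gi). Qed.

Lemma intg_cst (a : R) : intg (fun=> a).
Proof. exact: (finite_measure_integrable_cst P). Qed.

Lemma intg_abs f : intg f -> intg (fun x => `|f x|).
Proof. exact: integrable_norm. Qed.

Lemma intg_sum I (s : seq I) (p : pred I) (F : I -> T -> R) :
  (forall i, p i -> intg (F i)) -> intg (fun x => \sum_(i <- s | p i) F i x).
Proof.
move=> Fi; rewrite /intg.
rewrite (_ : _ \o _ = fun x => (\sum_(i <- s | p i) (F i x)%:E)%E).
  exact: integrable_sum.
by apply/funext => x /=; rewrite sumEFin.
Qed.

Lemma intg_bounded f (B : R) : measurable_fun setT f ->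
  (forall x, `|f x| <= B) -> intg f.
Proof. by move=> mf fB; apply: (@intg_le f (cst B)) => //; exact: intg_cst. Qed.

Lemma Rintg_cst (a : R) : \int[P]_x a = a.
Proof.
by rewrite /Rintegral integral_cst// [X in (_ * X)%E]probability_setT mule1.
Qed.

Lemma Rintg_sum I (s : seq I) (p : pred I) (F : I -> T -> R) :
  (forall i, p i -> intg (F i)) ->
  \int[P]_x (\sum_(i <- s | p i) F i x) = \sum_(i <- s | p i) \int[P]_x F i x.
Proof.
move=> Fi; elim: s => [|i s IH].
  by under eq_Rintegral do rewrite big_nil; rewrite big_nil Rintg_cst.
rewrite big_cons; under eq_Rintegral do rewrite big_cons.
case: ifPn => pi //; rewrite -IH.
by rewrite RintegralD//; [exact: Fi|exact: intg_sum].
Qed.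

Lemma Rintg_le f g : intg f -> intg g -> (forall x, f x <= g x) ->
  \int[P]_x f x <= \int[P]_x g x.
Proof. by move=> fi gi fg; exact: le_Rintegral. Qed.

Lemma Rintg_norm f : intg f -> `|\int[P]_x f x| <= \int[P]_x `|f x|.
Proof. by move=> fi; exact: le_normr_Rintegral. Qed.

Lemma Rintg_norm_le f g : intg f -> intg g -> (forall x, `|f x| <= g x) ->
  `|\int[P]_x f x| <= \int[P]_x g x.
Proof.
move=> fi gi fg; apply: le_trans (Rintg_norm fi) _.
by apply: Rintg_le => //; exact: intg_abs.
Qed.

Lemma sqintg_mul f g : sqintg f -> sqintg g -> intg (fun x => f x * g x).
Proof.
move=> [mf fi] [mg gi]; apply: (@intg_le _ (fun x => f x ^+ 2 + g x ^+ 2)).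
- exact: measurable_funM.
- move=> x; rewrite normrM -(real_normK (num_real (f x))).
  rewrite -(real_normK (num_real (g x))).
  have := sqr_ge0 (`|f x| - `|g x|).
  have := normr_ge0 (f x); have := normr_ge0 (g x); nra.
- exact: intgD.
Qed.

Lemma sqintg_cst (a : R) : sqintg (fun=> a).
Proof. by split => //; exact: intg_cst. Qed.

Lemma sqintg_intg f : sqintg f -> intg f.
Proof.
move=> fi; have := sqintg_mul fi (sqintg_cst 1).
by under eq_fun do rewrite mulr1.
Qed.

Lemma sqintgD f g : sqintg f -> sqintg g -> sqintg (fun x => f x + g x).
Proof.
move=> fi gi; have fg := sqintg_mul fi gi; case: fi gi => [mf fi] [mg gi].
split; first exact: measurable_funD.
rewrite (_ : (fun x => _) = fun x => f x ^+ 2 + (2 * (f x * g x) + g x ^+ 2)).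
  by apply: intgD => //; apply: intgD => //; exact: intgZ.
by apply/funext => x; ring.
Qed.

Lemma sqintgZ (a : R) f : sqintg f -> sqintg (fun x => a * f x).
Proof.
move=> [mf fi]; split; first exact: measurable_funM.
by under eq_fun do rewrite exprMn; exact: intgZ.
Qed.

Lemma sqintgB f g : sqintg f -> sqintg g -> sqintg (fun x => f x - g x).
Proof.
move=> fi gi; rewrite (_ : (fun x => _) = fun x => f x + (-1) * g x).
  by apply: sqintgD => //; exact: sqintgZ.
by apply/funext => x; ring.
Qed.

Lemma sqintg_sum I (s : seq I) (p : pred I) (F : I -> T -> R) :
  (forall i, p i -> sqintg (F i)) -> sqintg (fun x => \sum_(i <- s | p i) F i x).
Proof.
move=> Fi; elim: s => [|i s IH].
  by under eq_fun do rewrite big_nil; exact: sqintg_cst.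
have [pi|npi] := boolP (p i); last first.
  by rewrite (_ : (fun x => _) = fun x => \sum_(i <- s | p i) F i x)//;
    apply/funext => x; rewrite big_cons (negbTE npi).
rewrite (_ : (fun x => _) = fun x => F i x + \sum_(i <- s | p i) F i x).
  by apply: sqintgD => //; exact: Fi.
by apply/funext => x; rewrite big_cons pi.
Qed.

Lemma sqintg_bounded f (B : R) : measurable_fun setT f ->
  (forall x, `|f x| <= B) -> sqintg f.
Proof.
move=> mf fB; split => //; apply: (@intg_bounded _ (B ^+ 2)).
  exact: measurable_funX.
by move=> x; rewrite normrX ler_pXn2r ?nnegrE ?(le_trans _ (fB x)).
Qed.

Lemma Rintg_sqr_ge0 f : 0 <= \int[P]_x (f x ^+ 2).
Proof. by apply: Rintegral_ge0 => x _; exact: sqr_ge0. Qed.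

(** Stands in for Cauchy-Schwarz: pointwise |f| <= e + f^2 / e, so a second moment of at most e^2
    gives a first absolute moment of at most 2 e. *)
Lemma Rintg_abs_le f (e : R) : 0 < e -> sqintg f ->
  \int[P]_x `|f x| <= e + e^-1 * \int[P]_x (f x ^+ 2).
Proof.
move=> e0 fi; rewrite -RintegralZl//; last exact: fi.2.
rewrite -{1}(Rintg_cst e) -RintegralD//; last 2 first.
- exact: intg_cst.
- by apply: intgZ; exact: fi.2.
apply: Rintg_le.
- exact/intg_abs/sqintg_intg.
- by apply: intgD; [exact: intg_cst|apply: intgZ; exact: fi.2].
move=> x; rewrite -(real_normK (num_real (f x))).
have := sqr_ge0 (`|f x| - e) => h; have := normr_ge0 (f x) => n0.
rewrite -(ler_pM2l e0) mulrDr mulrA divff ?gt_eqF// mul1r; nra.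
Qed.

Lemma Rintg_sqrD_le f g : sqintg f -> sqintg g ->
  \int[P]_x ((f x + g x) ^+ 2) <=
  2 * \int[P]_x (f x ^+ 2) + 2 * \int[P]_x (g x ^+ 2).
Proof.
move=> fi gi; rewrite -!RintegralZl//; [|exact: gi.2|exact: fi.2].
rewrite -RintegralD//; [|exact/intgZ/fi.2|exact/intgZ/gi.2].
apply: Rintg_le; first exact: (sqintgD fi gi).2.
  by apply: intgD; [exact/intgZ/fi.2|exact/intgZ/gi.2].
by move=> x; have := sqr_ge0 (f x - g x); nra.
Qed.

Lemma Rintg_sqr_sum I (s : seq I) (p : pred I) (F : I -> T -> R) :
  (forall i, p i -> sqintg (F i)) ->
  \int[P]_x ((\sum_(i <- s | p i) F i x) ^+ 2) =
  \sum_(i <- s | p i) \sum_(j <- s | p j) \int[P]_x (F i x * F j x).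
Proof.
move=> Fi.
transitivity (\int[P]_x (\sum_(i <- s | p i) \sum_(j <- s | p j) F i x * F j x)).
  apply: eq_Rintegral => x _; rewrite expr2 mulr_suml.
  by apply: eq_bigr => i _; rewrite mulr_sumr.
rewrite Rintg_sum; last first.
  move=> i pi; apply: intg_sum => j pj.
  by apply: sqintg_mul; exact: Fi.
apply: eq_bigr => i pi; rewrite Rintg_sum// => j pj.
by apply: sqintg_mul; exact: Fi.
Qed.

End square_integrable.

(** * Trigonometric polynomials *)

Section haar_integral.
Context (R : realType).
Notation mu := (@lebesgue_measure R).

Lemma haar_integralE (g : R -> \bar R) : measurable_fun setT g ->
  (\int[haar]_x g x = \int[mu]_(x in `[0%R, 1%R]) g x)%E.
Proof.
move=> mg; rewrite integralE [RHS]integralE; congr (_ - _)%E.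
  rewrite integral_uniform ?subr0 ?invr1 ?mul1e//.
  exact: measurable_funepos.
rewrite integral_uniform ?subr0 ?invr1 ?mul1e//.
exact: measurable_funeneg.
Qed.

Lemma haar_RintegralE (g : R -> R) : measurable_fun setT g ->
  \int[haar]_x g x = \int[mu]_(x in `[0, 1]) g x.
Proof. by move=> mg; rewrite /Rintegral haar_integralE//; exact/measurable_EFinP. Qed.

End haar_integral.

Section trigonometric_polynomials.
Context (R : realType).
Implicit Types (f g : R -> R) (S : nat -> Prop).
Local Notation int f := (Rintegral (@haar R) setT f).

(** The phase covers sines (th = - pi / 2) and, at m = 0, constants, and makes the family closed
    under product-to-sum formulas. *)
Definition wave (m : nat) (th x : R) := cos (2 * pi * m%:R * x + th).

Lemma continuous_wave m th : continuous (wave m th).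
Proof.
move=> x; apply: (@continuous_comp _ _ _ (fun x => 2 * pi * m%:R * x + th) cos).
  by apply: cvgD; [apply: cvgMr; exact: cvg_id|exact: cvg_cst].
exact: continuous_cos.
Qed.

Lemma measurable_wave m th : measurable_fun setT (wave m th).
Proof. exact: (continuous_measurable_fun (@continuous_wave m th)). Qed.

Lemma wave_le1 m th x : `|wave m th x| <= 1.
Proof. exact: cos_max. Qed.

Lemma wave0 th x : wave 0 th x = cos th.
Proof. by rewrite /wave mulr0 mul0r add0r. Qed.

Lemma wave_periodic m th x : wave m th (x + 1) = wave m th x.
Proof.
rewrite /wave -[RHS](periodicn (@cosD2pi R) m) -mulr_natr -mulr_natr.
by congr cos; ring.
Qed.

Lemma wave_dil m th (n : nat) x : wave m th (n%:R * x) = wave (m * n) th x.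
Proof. by rewrite /wave natrM !mulrA. Qed.

(** With truncated subtraction [a - b + (b - a)] is |a - b|. Frequencies are natural numbers, so the
    phase of the difference changes sign when a < b. *)
Lemma waveM a b t u x : wave a t x * wave b u x =
  2^-1 * wave (a + b) (t + u) x
  + 2^-1 * wave (a - b + (b - a)) (if (b <= a)%N then t - u else u - t) x.
Proof.
have -> : wave (a - b + (b - a)) (if (b <= a)%N then t - u else u - t) x =
    cos ((2 * pi * a%:R * x + t) - (2 * pi * b%:R * x + u)).
  rewrite /wave; case: ifPn => [ba|].
    have -> : (b - a = 0)%N by apply/eqP.
    by rewrite addn0 natrB//; congr cos; ring.
  rewrite -ltnNge => ab.
  have -> : (a - b = 0)%N by apply/eqP; rewrite subn_eq0 ltnW.
  by rewrite add0n natrB 1?ltnW// -[RHS]cosN; congr cos; ring.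
have -> : wave (a + b) (t + u) x =
    cos ((2 * pi * a%:R * x + t) + (2 * pi * b%:R * x + u)).
  by rewrite /wave natrD; congr cos; ring.
by rewrite cosB cosD /wave; field.
Qed.

Lemma Rintg_wave m th : int (fun x => wave m th x) = (m == 0%N)%:R * cos th.
Proof.
case: m => [|m].
  under eq_Rintegral do rewrite wave0.
  by rewrite Rintg_cst mul1r.
rewrite mul0r haar_RintegralE; last exact: measurable_wave.
set k : R := 2 * pi * m.+1%:R.
have k0 : k != 0 by rewrite gt_eqF// !mulr_gt0// ?pi_gt0.
pose F x := k^-1 * sin (k * x + th).
have dF (x : R) : is_derive x 1 F (wave m.+1 th x).
  apply: is_derive_eq; rewrite /wave -/k.
  by rewrite /GRing.scale/= addr0 mulr1 mulrC mulfK.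
have cF : continuous F.
  move=> x; apply/differentiable_continuous/derivable1_diffP.
  exact: (@ex_derive _ _ _ _ _ _ _ (dF x)).
rewrite /Rintegral (@continuous_FTC2 _ _ F) ?ltr01//.
- rewrite -EFinB /= /F mulr1 mulr0 add0r.
  suff -> : sin (k + th) = sin th by rewrite subrr.
  rewrite -(periodicn (@sinD2pi R) m.+1 th) addrC -mulr_natr -mulr_natr.
  by congr sin; rewrite /k; ring.
- by apply: continuous_subspaceT => x; exact: continuous_wave.
- split.
  + by move=> x _; exact: (@ex_derive _ _ _ _ _ _ _ (dF x)).
  + by apply: cvg_at_right_filter; exact: cF.
  + by apply: cvg_at_left_filter; exact: cF.
- by move=> x _; rewrite derive1E; exact: derive_val.
Qed.

Lemma intg_wave m th : intg haar (wave m th).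
Proof.
by apply: (@intg_bounded _ _ _ _ _ 1); [exact: measurable_wave|exact: wave_le1].
Qed.

Lemma Rintg_waveM a b t u : (0 < a)%N -> (0 < b)%N ->
  int (fun x => wave a t x * wave b u x) = (a == b)%:R / 2 * cos (t - u).
Proof.
move=> a0 b0; under eq_Rintegral do rewrite waveM.
rewrite RintegralD//; [|exact/intgZ/intg_wave..].
rewrite !RintegralZl//; [|exact: intg_wave..].
rewrite !Rintg_wave !addn_eq0 !subn_eq0 -eqn_leq eqn0Ngt a0/= mul0r mulr0 add0r.
by case: eqVneq => [->|_]; rewrite ?leqnn ?mul0r ?mulr0// !mul1r.
Qed.

(** S is any set containing the frequencies in use. Amplitudes are left free: most arguments only
    need to know that 0 is not a frequency, so that the mean vanishes. *)
Definition trig_in S f := exists s : seq (R * nat * R),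
  (forall a, a \in s -> S a.1.2) /\
  (forall x, f x = \sum_(a <- s) a.1.1 * wave a.1.2 a.2 x).

Lemma trig_wave S w m th : S m -> trig_in S (fun x => w * wave m th x).
Proof.
move=> Sm; exists [:: (w, m, th)]; split; last by move=> x; rewrite big_seq1.
by move=> a; rewrite inE => /eqP ->.
Qed.

Lemma eq_trig S f g : f =1 g -> trig_in S f -> trig_in S g.
Proof. by move=> fg [s [sS sf]]; exists s; split => // x; rewrite -fg. Qed.

Lemma sub_trig S S' f : (forall m, S m -> S' m) -> trig_in S f -> trig_in S' f.
Proof. by move=> SS' [s [sS sf]]; exists s; split => // a /sS; exact: SS'. Qed.

Lemma trig_cst S (a : R) : S 0%N -> trig_in S (fun=> a).
Proof.
move=> S0; apply: eq_trig (trig_wave a 0 S0) => x.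
by rewrite wave0 cos0 mulr1.
Qed.

Lemma trig0 S : trig_in S (fun=> 0).
Proof. by exists [::]; split => // x; rewrite big_nil. Qed.

Lemma trigD S f g : trig_in S f -> trig_in S g -> trig_in S (fun x => f x + g x).
Proof.
move=> [s [sS sf]] [t [tS tg]]; exists (s ++ t); split; last first.
  by move=> x; rewrite big_cat sf tg.
by move=> a; rewrite mem_cat => /orP[/sS|/tS].
Qed.

Lemma trigZ S (c : R) f : trig_in S f -> trig_in S (fun x => c * f x).
Proof.
move=> [s [sS sf]]; exists [seq (c * a.1.1, a.1.2, a.2) | a <- s]; split.
  by move=> a /mapP[b /sS Sb ->].
move=> x; rewrite big_map sf mulr_sumr; apply: eq_bigr => a _ /=.
by rewrite mulrA.
Qed.

Lemma trigB S f g : trig_in S f -> trig_in S g -> trig_in S (fun x => f x - g x).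
Proof.
move=> fS gS; apply: eq_trig (trigD fS (trigZ (-1) gS)) => x /=.
by rewrite mulN1r.
Qed.

Lemma trig_sum S I (s : seq I) (p : pred I) (F : I -> R -> R) :
  (forall i, p i -> trig_in S (F i)) ->
  trig_in S (fun x => \sum_(i <- s | p i) F i x).
Proof.
move=> FS; elim: s => [|i s IH].
  by apply: eq_trig (trig0 S) => x; rewrite big_nil.
have [pi|npi] := boolP (p i).
  apply: eq_trig (trigD (FS i pi) IH) => x.
  by rewrite big_cons pi.
by apply: eq_trig IH => x; rewrite big_cons (negbTE npi).
Qed.

Lemma trigM S1 S2 S f g : trig_in S1 f -> trig_in S2 g ->
  (forall a b, S1 a -> S2 b -> S (a + b)%N /\ S (a - b + (b - a))%N) ->
  trig_in S (fun x => f x * g x).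
Proof.
move=> [s [sS sf]] [t [tS tg]] SS.
(* The redundant filters hand the memberships in s and t to [trig_sum]. *)
have : trig_in S (fun x => \sum_(a <- s | a \in s) \sum_(b <- t | b \in t)
    ((a.1.1 * wave a.1.2 a.2 x) * (b.1.1 * wave b.1.2 b.2 x))).
  apply: trig_sum => a /sS Sa; apply: trig_sum => b /tS Sb.
  have [S1ab S2ab] := SS _ _ Sa Sb.
  apply: (@eq_trig _ (fun x => a.1.1 * b.1.1 * 2^-1 * wave (a.1.2 + b.1.2) (a.2 + b.2) x
    + a.1.1 * b.1.1 * 2^-1 * wave (a.1.2 - b.1.2 + (b.1.2 - a.1.2))
        (if (b.1.2 <= a.1.2)%N then a.2 - b.2 else b.2 - a.2) x)).
    by move=> x; rewrite mulrACA waveM; ring.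
  by apply: trigD; exact: trig_wave.
apply: eq_trig => x; rewrite sf tg mulr_suml [RHS]big_seq; apply: eq_bigr => a _.
by rewrite mulr_sumr [RHS]big_seq.
Qed.

Lemma trig_measurable S f : trig_in S f -> measurable_fun setT f.
Proof.
move=> [s [_ sf]]; rewrite (_ : f = fun x => \sum_(a <- s) a.1.1 * wave a.1.2 a.2 x).
  by apply: measurable_sum => a; apply: measurable_funM => //; exact: measurable_wave.
by apply/funext => x; rewrite sf.
Qed.

Lemma trig_continuous S f : trig_in S f -> continuous f.
Proof.
move=> [s [_ sf]]; rewrite (_ : f = fun x => \sum_(a <- s) a.1.1 * wave a.1.2 a.2 x).
  elim: s {sf} => [|a s IH].
    by rewrite (_ : (fun x => _) = cst 0); [exact: cst_continuous|
       apply/funext => x; rewrite big_nil].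
  rewrite (_ : (fun x => _) = fun x => a.1.1 * wave a.1.2 a.2 x +
      \sum_(a <- s) a.1.1 * wave a.1.2 a.2 x); last first.
    by apply/funext => x; rewrite big_cons.
  move=> x; apply: cvgD; last exact: IH.
  by apply: cvgMr; exact: continuous_wave.
by apply/funext => x; rewrite sf.
Qed.

Lemma trig_bounded S f : trig_in S f -> exists B, forall x, `|f x| <= B.
Proof.
move=> [s [_ sf]]; exists (\sum_(a <- s) `|a.1.1|) => x; rewrite sf.
apply: le_trans (ler_norm_sum _ _ _) _; apply: ler_sum => a _.
by rewrite normrM ler_piMr// wave_le1.
Qed.

Lemma trig_sqintg S f : trig_in S f -> sqintg haar f.
Proof.
move=> fS; have [B fB] := trig_bounded fS.
by apply: (@sqintg_bounded _ _ _ _ _ B) => //; exact: trig_measurable fS.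
Qed.

Lemma trig_intg S f : trig_in S f -> intg haar f.
Proof. by move=> /trig_sqintg/sqintg_intg. Qed.

Lemma trig_mean0 S f : trig_in S f -> (forall m, S m -> (0 < m)%N) -> int (fun x => f x) = 0.
Proof.
move=> [s [sS sf]] S0; under eq_Rintegral do rewrite sf.
rewrite Rintg_sum; last by move=> a _; exact/intgZ/intg_wave.
rewrite big_seq big1// => a /sS/S0 a0.
by rewrite RintegralZl//; [rewrite Rintg_wave eqn0Ngt a0 mul0r mulr0|exact: intg_wave].
Qed.

Lemma trig_periodic S f x : trig_in S f -> f (x + 1) = f x.
Proof.
move=> [s [_ sf]]; rewrite !sf; apply: eq_bigr => a _.
by rewrite wave_periodic.
Qed.

Lemma trig_dil S f (n : nat) : trig_in S f ->
  trig_in (fun m => exists2 j, S j & m = (j * n)%N) (fun x => f (n%:R * x)).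
Proof.
move=> [s [sS sf]]; exists [seq (a.1.1, (a.1.2 * n)%N, a.2) | a <- s]; split.
  by move=> a /mapP[b /sS Sb ->]; exists b.1.2.
by move=> x; rewrite big_map sf; apply: eq_bigr => a _; rewrite wave_dil.
Qed.

End trigonometric_polynomials.

(** * Trigonometric Weierstrass theorem *)

Section haar_unit_interval.
Context (R : realType).
Implicit Types f g : R -> R.
Notation mu := (@lebesgue_measure R).

Lemma haar_integrableP f : measurable_fun setT f ->
  intg haar f <-> mu.-integrable `[0, 1] (EFin \o f).
Proof.
move=> mf; have mf' : measurable_fun setT (EFin \o f) by exact/measurable_EFinP.
have mf1 : measurable_fun (`[0, 1]%classic : set R) (EFin \o f) by exact: measurable_funTS.
split => /integrableP[_ h]; apply/integrableP; split => //; move: h.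
  by rewrite haar_integralE//; exact: measurableT_comp.
by rewrite haar_integralE//; exact: measurableT_comp.
Qed.

Lemma intg_haar_bounded f (B : R) : measurable_fun setT f ->
  (forall x, 0 <= x <= 1 -> `|f x| <= B) -> intg haar f.
Proof.
move=> mf fB; apply/haar_integrableP => //.
apply: (@le_integrable _ _ _ mu _ _ _ (EFin \o cst B)) => //.
- by apply/measurable_EFinP; exact: measurable_funTS.
- move=> x /=; rewrite in_itv/= => /fB x1; rewrite lee_fin (le_trans x1)//.
  exact: ler_norm.
- apply: measurable_bounded_integrable => //.
    by rewrite /= lebesgue_measure_itv/= lte_fin ltr01 -EFinD ltry.
  by exists `|B|; rewrite num_real; split => // M BM x _ /=; exact: ltW.
Qed.

Lemma Rintg_haar_le f g : intg haar f -> intg haar g ->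
  (forall x, 0 <= x <= 1 -> f x <= g x) ->
  \int[haar]_x f x <= \int[haar]_x g x.
Proof.
move=> fi gi fg; have mf := intg_measurable fi; have mg := intg_measurable gi.
rewrite !haar_RintegralE//; apply: le_Rintegral => //.
- exact: (haar_integrableP mf).1.
- exact: (haar_integrableP mg).1.
Qed.

Lemma Rintg_haar_norm_le f g : intg haar f -> intg haar g ->
  (forall x, 0 <= x <= 1 -> `|f x| <= g x) ->
  `|\int[haar]_x f x| <= \int[haar]_x g x.
Proof.
move=> fi gi fg; apply: le_trans (Rintg_norm fi) _.
by apply: Rintg_haar_le => //; exact: intg_abs.
Qed.

End haar_unit_interval.

Section trigonometric_weierstrass.
Context (R : realType).
Implicit Types (f g h : R -> R) (S : nat -> Prop).
Local Notation int f := (Rintegral (@haar R) setT f).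

Lemma uniform_continuity_itv h (a b e : R) : continuous h -> 0 < e ->
  exists2 d : R, 0 < d & forall x y : R, a <= x <= b -> a <= y <= b ->
    `|x - y| < d -> `|h x - h y| < e.
Proof.
move=> ch e0.
have := (@segment_compact R a b); rewrite compact_near_coveringP => cpt.
pose P (d x : R) := forall y, `|x - y| < d -> `|h x - h y| < e.
have : \forall d \near 0^'+, `[a, b]%classic `<=` P d.
  apply: (cpt _ _ P) => x _.
  have e2 : 0 < e / 2 by rewrite divr_gt0.
  have /cvgrPdist_lt/(_ _ e2)/nbhs_ballP[r /= r0 rh] := ch x.
  (* Half of the radius is kept in reserve for moving the centre from x to x'. *)
  exists (ball x (r / 2), [set d | 0 < d < r / 2]) => /=.
    split; first by apply: nbhsx_ballx; rewrite divr_gt0.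
    near=> d => /=; apply/andP; split; near: d; first exact: nbhs_right_gt.
    by apply: nbhs_right_lt; rewrite divr_gt0.
  move=> [x' d] /= [xx' /andP[d0 dr]] y x'y.
  have h1 := rh x' _; have h2 := rh y _; rewrite /ball/= in xx' h1 h2.
  have {}h1 : `|h x - h x'| < e / 2 by apply: h1; lra.
  have {}h2 : `|h x - h y| < e / 2.
    apply: h2; rewrite (_ : x - y = (x - x') + (x' - y)); last by ring.
    by rewrite (le_lt_trans (ler_normD _ _))//; lra.
  rewrite (_ : h x' - h y = (h x - h y) - (h x - h x')); last by ring.
  by rewrite (le_lt_trans (ler_normB _ _))//; lra.
move=> nP; have [d [d0 dP]] : exists d : R, 0 < d /\ `[a, b]%classic `<=` P d.
  near (0 : R)^'+ => d; exists d; split; near: d => //; exact: nbhs_right_gt.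
by exists d => // x y x01 _; apply: dP; rewrite /= in_itv.
Unshelve. all: by end_near. Qed.

(** Korovkin's inequality: the oscillation is controlled by the single test function 1 - cos, which
    vanishes only where x and y coincide on the circle. Away from there it is at least s, and C = 2
    B / s absorbs the trivial bound 2 B. *)
Lemma osc_le_cos h (e : R) : continuous h -> h 0 = h 1 -> 0 < e ->
  exists2 C : R, 0 <= C & forall x y : R, 0 <= x <= 1 -> 0 <= y <= 1 ->
    `|h x - h y| <= e + C * (1 - cos (2 * pi * (x - y))).
Proof.
move=> ch h01 e0; have e2 : 0 < e / 2 by rewrite divr_gt0.
have [d d0 dh] := uniform_continuity_itv 0 1 ch e2.
have [B Bh] : exists B : R, forall x : R, 0 <= x <= 1 -> `|h x| <= B.
  have : {within `[0, 1], continuous (fun x => `|h x|)}.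
    apply: continuous_subspaceT => x; apply: continuous_comp; first exact: ch.
    exact: norm_continuous.
  by move=> /(EVT_max ler01)[c _ cP]; exists (`|h c|) => x x01; apply: cP; rewrite in_itv.
pose d' := Num.min d 2^-1; have d'0 : 0 < d' by rewrite lt_min d0/= invr_gt0.
have d'2 : d' <= 2^-1 by rewrite ge_min lexx orbT.
have d'd : d' <= d by rewrite ge_min lexx.
pose s := 1 - cos (2 * pi * d').
have pi0 := pi_gt0 R.
have rng (u : R) : 0 <= u -> u <= 2^-1 -> 2 * pi * u \in `[0, pi].
  by move=> u0 u2; rewrite in_itv/=; apply/andP; split; nra.
have cos_le (u v : R) : 0 <= u -> u <= v -> v <= 2^-1 ->
    cos (2 * pi * v) <= cos (2 * pi * u).
  move=> u0 uv v2; rewrite leNgt ltr_cos; [|apply: rng; lra..].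
  by rewrite -leNgt ler_pM2l// mulr_gt0.
have s0 : 0 < s.
  rewrite subr_gt0 -[X in _ < X]cos0 ltr_cos; [by rewrite !mulr_gt0| |exact: rng (ltW d'0) _].
  by rewrite in_itv/= lexx pi_ge0.
have B0 : 0 <= B by apply: le_trans (Bh 0 _); rewrite ?lexx ?ler01.
exists (2 * B / s); first by rewrite !mulr_ge0// invr_ge0 ltW.
have half (x y : R) : 0 <= x <= 1 -> 0 <= y <= 1 -> y <= x ->
    `|h x - h y| <= e + 2 * B / s * (1 - cos (2 * pi * (x - y))).
  move=> x01 y01 yx.
  have cos1 : 0 <= 2 * B / s * (1 - cos (2 * pi * (x - y))).
    by rewrite !mulr_ge0// ?subr_ge0 ?cos_le1// invr_ge0 ltW.
  have [xyd|xyd] := ltP (x - y) d'.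
    have : `|h x - h y| < e / 2.
      by apply: dh => //; rewrite ger0_norm ?subr_ge0// (lt_le_trans xyd).
    lra.
  (* For x - y near 1 the two points are close on the circle, through the identified endpoints 0 and
     1. *)
  have [xyd1|xyd1] := ltP (1 - d') (x - y).
    have h1 : `|h x - h 1| < e / 2.
      apply: dh => //; first by rewrite ler01 lexx.
      by rewrite ler0_norm; lra.
    have h2 : `|h 0 - h y| < e / 2.
      apply: dh => //; first by rewrite ler01 lexx.
      by rewrite ler0_norm; lra.
    rewrite (_ : h x - h y = (h x - h 1) + (h 0 - h y)); last by rewrite h01; ring.
    by rewrite (le_trans (ler_normD _ _))//; lra.
  (* In the remaining range x - y has distance at least d' from 0 and 1; beyond 1/2 the cosine is
     reflected back to where it decreases. *)
  have : s <= 1 - cos (2 * pi * (x - y)).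
    rewrite lerD2l lerN2.
    have [xy2|xy2] := leP (x - y) 2^-1; first by apply: cos_le; lra.
    have -> : cos (2 * pi * (x - y)) = cos (2 * pi * (1 - (x - y))).
      rewrite -(cosN (2 * pi * (1 - (x - y)))) -[RHS](cosD2pi).
      by congr cos; rewrite -mulr_natr; ring.
    by apply: cos_le; lra.
  move=> sle; have : 2 * B <= 2 * B / s * (1 - cos (2 * pi * (x - y))).
    by rewrite -mulrA ler_peMr ?mulr_ge0// ler_pdivlMl// mulr1.
  have := Bh _ x01; have := Bh _ y01; have := ler_normB (h x) (h y); lra.
move=> x y x01 y01; have [yx|/ltW xy] := leP y x; first exact: half.
by have := half y x y01 x01 xy; rewrite distrC -cosN -mulrN opprB.
Qed.

(** This is cos (pi u)^(2 m), the de la Vallee Poussin kernel without its normalization: a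
    non-negative trigonometric polynomial concentrating at the integers. *)
Definition bump (m : nat) (u : R) := ((1 + cos (2 * pi * u)) / 2) ^+ m.

Lemma bump_ge0 m u : 0 <= bump m u.
Proof.
by apply: exprn_ge0; rewrite divr_ge0// -lerBlDl sub0r cos_geN1.
Qed.

Lemma trig_bump m : trig_in (fun=> True) (bump m).
Proof.
elim: m => [|m IH].
  by apply: eq_trig (trig_cst 1 I) => x; rewrite /bump expr0.
have H1 : trig_in (fun=> True) (bump 1).
  apply: eq_trig (trigD (trig_cst 2^-1 I) (trig_wave 2^-1 0 (I : (fun=> True) 1%N))) => x.
  by rewrite /bump expr1 /wave mulr1 addr0; field.
apply: eq_trig (trigM (S := fun=> True) H1 IH _) => // x.
by rewrite /bump -exprD.
Qed.

(** Wallis recurrence: [F], the product of sin (2 pi x) and [bump m], takes equal values at 0 and 1,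
    so its derivative, a combination of [bump m.+1] and [bump m], has mean 0. *)
Lemma Rintg_bumpS m : int (fun x => bump m.+1 x) =
  (m.+1%:R - 2^-1) / m.+1%:R * int (fun x => bump m x).
Proof.
set c : R := 2 * pi.
have bump1 u : bump m.+1 u = bump m u * ((1 + cos (c * u)) / 2).
  by rewrite /bump exprSr.
pose F (x : R) := sin (c * x) * bump m x.
pose G (x : R) := c * (2 * m.+1%:R * bump m.+1 x - (2 * m.+1%:R - 1) * bump m x).
have dF (x : R) : is_derive x 1 F (G x).
  have dE : is_derive x 1 (fun u => (1 + cos (c * u)) / 2) (- sin (c * x) * c / 2).
    by apply: is_derive_eq; rewrite /GRing.scale/= mulr1 mulr0 !add0r mul1r; ring.
  have dS : is_derive x 1 (fun u => sin (c * u)) (c * cos (c * x)).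
    by apply: is_derive_eq; rewrite /GRing.scale/= mulr1 mulrC.
  have dB : is_derive x 1 (bump m)
      (m%:R * bump m.-1 x * (- sin (c * x) * c / 2)).
    have := is_deriveX m dE; rewrite (_ : _ ^+ m = bump m)//.
    by apply/funext => u; rewrite /bump; elim: m {bump1 F G} => [|k IH]; rewrite ?expr0// !exprS -IH.
  have dF' : is_derive x 1 F _ := is_deriveM dS dB.
  apply: (is_derive_eq (f' := _) dF').
  rewrite /GRing.scale/= /G bump1.
  have Cs : sin (c * x) ^+ 2 = 1 - cos (c * x) ^+ 2 by exact: sin2cos2.
  case: m {bump1 F G dB dF'} => [|k]; first by rewrite /bump expr0; field.
  rewrite /= (_ : bump k.+1 x = bump k x * ((1 + cos (c * x)) / 2)); last first.
    by rewrite /bump exprSr.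
  transitivity (- (k.+1%:R * bump k x * c / 2) * (sin (c * x) ^+ 2)
    + bump k x * ((1 + cos (c * x)) / 2) * c * cos (c * x)); first by ring.
  by rewrite Cs; field.
have cF : continuous F.
  move=> x; apply/differentiable_continuous/derivable1_diffP.
  exact: (@ex_derive _ _ _ _ _ _ _ (dF x)).
have tG : trig_in (fun=> True) G.
  by apply: trigZ; apply: trigB; apply: trigZ; exact: trig_bump.
have c0 : c != 0 by rewrite gt_eqF// mulr_gt0// pi_gt0.
have : int (fun x => G x) = 0.
  rewrite haar_RintegralE; last exact: trig_measurable tG.
  rewrite /Rintegral (@continuous_FTC2 _ _ F) ?ltr01//.
  - rewrite -EFinB /= /F mulr0 sin0 mul0r subr0 mulr1.
    by rewrite /c mulr_natl sin2pi mul0r.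
  - by apply: continuous_subspaceT => x; exact: trig_continuous tG x.
  - split.
    + by move=> x _; exact: (@ex_derive _ _ _ _ _ _ _ (dF x)).
    + by apply: cvg_at_right_filter; exact: cF.
    + by apply: cvg_at_left_filter; exact: cF.
  - by move=> x _; rewrite derive1E; exact: derive_val.
rewrite RintegralZl//; last first.
  apply: intgB; apply: intgZ; exact: trig_intg (trig_bump _).
rewrite RintegralB//; [|apply: intgZ; exact: trig_intg (trig_bump _)..].
rewrite !RintegralZl//; [|exact: trig_intg (trig_bump _)..].
move/eqP; rewrite mulf_eq0 (negbTE c0)/= => /eqP h.
have m0 : (m.+1%:R : R) != 0 by rewrite pnatr_eq0.
by apply: (mulfI m0); apply/eqP; rewrite -subr_eq0; apply/eqP;
  rewrite -[RHS](mulr0 2^-1) -h; field.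
Qed.

Lemma Rintg_bump_gt0 m : 0 < int (fun x => bump m x).
Proof.
elim: m => [|m IH].
  by under eq_Rintegral do rewrite /bump expr0; rewrite Rintg_cst.
rewrite Rintg_bumpS mulr_gt0// divr_gt0// subr_gt0.
by rewrite (@lt_le_trans _ _ 1) ?ler1n// invf_lt1// ltr1n.
Qed.

Lemma trig_reflect S f x : trig_in S f -> trig_in S (fun y => f (x - y)).
Proof.
move=> [s [sS sf]].
exists [seq (a.1.1, a.1.2, - (2 * pi * a.1.2%:R * x) - a.2) | a <- s]; split.
  by move=> a /mapP[b /sS Sb ->].
move=> y; rewrite big_map sf; apply: eq_bigr => a _ /=.
by rewrite /wave -[in RHS]cosN; congr (_ * cos _); ring.
Qed.

(** Only the frequency 0 contributes to either side, and it does not see the reflection; no change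
    of variables on the circle is required. *)
Lemma Rintg_trig_reflect S f x : trig_in S f ->
  int (fun y => f (x - y)) = int (fun x => f x).
Proof.
move=> [s [sS sf]]; under eq_Rintegral do rewrite sf.
under [RHS]eq_Rintegral do rewrite sf.
have wx (a : R * nat * R) y : wave a.1.2 a.2 (x - y) =
    wave a.1.2 (- (2 * pi * a.1.2%:R * x) - a.2) y.
  by rewrite /wave -[in RHS]cosN; congr cos; ring.
under eq_Rintegral do under eq_bigr do rewrite wx.
rewrite !Rintg_sum; [|by move=> *; exact/intgZ/intg_wave..].
apply: eq_bigr => a _; rewrite !RintegralZl//; [|exact: intg_wave..].
rewrite !Rintg_wave; case: eqP => [->|]; last by rewrite !mul0r.
by rewrite mulr0 mul0r oppr0 add0r cosN.
Qed.

(** The addition formula separates x from y: convolving with h only changes the amplitudes, by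
    cosine and sine coefficients of h. *)
Lemma trig_convolution S f h : trig_in S f -> intg haar h ->
  trig_in S (fun x => int (fun y => h y * f (x - y))).
Proof.
move=> [s [sS sf]] hi.
have hc m th : intg haar (fun y => h y * wave m th y).
  apply: (@intg_le _ _ _ haar _ (fun y => `|h y|)).
  - apply: measurable_funM; first exact: intg_measurable hi.
    exact: measurable_wave.
  - by move=> x; rewrite normrM ler_piMr// wave_le1.
  - exact: intg_abs.
pose A (a : R * nat * R) := a.1.1 * int (fun y => h y * wave a.1.2 0 y).
pose B (a : R * nat * R) := a.1.1 * int (fun y => h y * wave a.1.2 (- (pi / 2)) y).
have tAB : trig_in S (fun x => \sum_(a <- s | a \in s) (A a * wave a.1.2 a.2 x +
    B a * wave a.1.2 (a.2 - pi / 2) x)).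
  by apply: trig_sum => a /sS Sa; apply: trigD; exact: trig_wave.
apply: eq_trig tAB => x.
have E (a : R * nat * R) y : h y * (a.1.1 * wave a.1.2 a.2 (x - y)) =
  (a.1.1 * wave a.1.2 a.2 x) * (h y * wave a.1.2 0 y) +
  (a.1.1 * wave a.1.2 (a.2 - pi / 2) x) * (h y * wave a.1.2 (- (pi / 2)) y).
  rewrite /wave addr0.
  have -> : 2 * pi * a.1.2%:R * (x - y) + a.2 =
    (2 * pi * a.1.2%:R * x + a.2) - 2 * pi * a.1.2%:R * y by ring.
  have sE z : cos (z - pi / 2) = sin z.
    by rewrite cosB cos_pihalf sin_pihalf mulr0 add0r mulr1.
  rewrite cosB addrA !sE; move: (h y) (cos _) (cos _) (sin _) (sin _) => *; ring.
under [RHS]eq_Rintegral do (rewrite sf mulr_sumr; under eq_bigr do rewrite E).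
rewrite Rintg_sum; last by move=> a _; apply: intgD; apply: intgZ.
rewrite -big_seq; apply: eq_bigr => a _.
rewrite RintegralD//; [|exact: intgZ..].
by rewrite !RintegralZl//; [|exact: hc..]; rewrite /A /B; congr (_ + _); rewrite mulrAC.
Qed.

(** The approximant is the average of h against the normalized kernel. By [osc_le_cos] the error is
    at most e / 2 plus C times the kernel mean of 1 - cos, and the Wallis recurrence gives this mean
    the exact value 1 / (m + 1). *)
Lemma trig_weierstrass h (e : R) : continuous h -> h 0 = h 1 -> 0 < e ->
  exists2 g, trig_in (fun=> True) g &
    forall x, 0 <= x <= 1 -> `|h x - g x| <= e.
Proof.
move=> ch h01 e0; have e2 : 0 < e / 2 by rewrite divr_gt0.
have [C C0 hC] := osc_le_cos ch h01 e2.
have mh : measurable_fun setT h by exact: continuous_measurable_fun.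
have hi : intg haar h.
  apply: (@intg_haar_bounded _ _ (`|h 0| + (e / 2 + C * 2))) => // x x01.
  rewrite (_ : h x = h 0 + (h x - h 0)); last by ring.
  rewrite (le_trans (ler_normD _ _))// lerD2l.
  rewrite (le_trans (hC _ _ x01 _)) ?lexx ?ler01// lerD2l ler_wpM2l//.
  by have := cos_geN1 (2 * pi * (x - 0)); lra.
have [m mC] : exists m : nat, C / m.+1%:R <= e / 2.
  exists (Num.truncn (C / (e / 2))).
  rewrite ler_pdivrMr// -ler_pdivrMl// mulrC ltW//.
  by rewrite truncnS_gt.
pose K := bump m; have tK := trig_bump m; set B := int (fun x => K x).
have B0 : 0 < B := Rintg_bump_gt0 m.
exists (fun x => B^-1 * int (fun y => h y * K (x - y))).
  by apply: trigZ; exact: trig_convolution.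
move=> x x01.
have tKx := trig_reflect x tK; have iKx := trig_intg tKx.
have tK1x := trig_reflect x (trig_bump m.+1); have iK1x := trig_intg tK1x.
have BE : B = int (fun y => K (x - y)) by rewrite (Rintg_trig_reflect x tK).
have hK : intg haar (fun y => h y * K (x - y)).
  have [b Kb] := trig_bounded tKx.
  apply: (@intg_le _ _ _ haar _ (fun y => b * `|h y|)).
  - by apply: measurable_funM => //; exact: intg_measurable iKx.
  - by move=> y; rewrite normrM mulrC ler_wpM2r.
  - exact/intgZ/intg_abs.
have -> : h x - B^-1 * int (fun y => h y * K (x - y)) =
    B^-1 * int (fun y => h x * K (x - y) - h y * K (x - y)).
  rewrite RintegralB//; last exact: intgZ.
  by rewrite RintegralZl// -BE mulrBr mulrCA mulVf ?gt_eqF// mulr1.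
rewrite normrM gtr0_norm ?invr_gt0// ler_pdivrMl//.
(* Multiplying [bump m] by 1 - cos gives 2 (bump m - bump m.+1), which puts the integral within
   reach of [Rintg_bumpS]. *)
apply: le_trans (_ : int (fun y => e / 2 * K (x - y) +
    C * 2 * (K (x - y) - bump m.+1 (x - y))) <= _).
  apply: Rintg_haar_norm_le.
  - by apply: intgB => //; exact: intgZ.
  - by apply: intgD; [exact: intgZ|apply: intgZ; exact: intgB].
  - move=> y y01; rewrite -mulrBl normrM (ger0_norm (bump_ge0 _ _)).
    have -> : e / 2 * K (x - y) + C * 2 * (K (x - y) - bump m.+1 (x - y)) =
        (e / 2 + C * (1 - cos (2 * pi * (x - y)))) * K (x - y).
      by rewrite /K /bump exprS; field.
    by rewrite ler_wpM2r ?bump_ge0// hC.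
rewrite RintegralD//; [|exact: intgZ|by apply: intgZ; exact: intgB].
rewrite !RintegralZl//; [|exact: intgB].
rewrite RintegralB// -BE (Rintg_trig_reflect x (trig_bump m.+1)).
rewrite Rintg_bumpS -/K -/B.
have m0 : (m.+1%:R : R) != 0 by rewrite pnatr_eq0.
have -> : C * 2 * (B - (m.+1%:R - 2^-1) / m.+1%:R * B) = C / m.+1%:R * B.
  by field.
by rewrite (mulrC B) [leRHS](_ : _ = e / 2 * B + e / 2 * B) ?lerD2l ?ler_pM2r//; field.
Qed.

End trigonometric_weierstrass.
(** * Characteristic function of the Gaussian law *)

Section gaussian_fourier_transform.
Context (R : realType).
Notation mu := (@lebesgue_measure R).
Local Notation p := (@normal_pdf R 0 1).

Lemma Rintegral_normal_prob (f : R -> R) : intg (normal_prob 0 1) f ->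
  \int[normal_prob 0 1]_x f x = \int[mu]_x (f x * p x).
Proof.
move=> fi; have mf := intg_measurable fi.
rewrite /Rintegral; congr fine.
rewrite -(Radon_Nikodym_change_of_variables (@normal_prob_dominates R 0 1))//.
apply: ae_eq_integral => //.
- apply: emeasurable_funM => //; first exact/measurable_EFinP.
  apply: (measurable_int mu).
  by apply: Radon_Nikodym_integrable; exact: normal_prob_dominates.
- apply/measurable_EFinP/measurable_funM => //; exact: measurable_normal_pdf.
- under [in X in ae_eq _ _ _ X]eq_fun do rewrite EFinM.
  apply: ae_eqe_mul2l => /=.
  rewrite Radon_NikodymE//=; first exact: normal_prob_dominates.
  move=> abmu; case: cid => /= h [h1 h2 h3].
  apply: integral_ae_eq => //=.
  + by apply/measurable_EFinP; exact: measurable_normal_pdf.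
  + by move=> E E01 mE; rewrite -h3.
Qed.

Lemma std_normal_pdfE x : p x = normal_peak 1 * expR (- (x ^+ 2 / 2)).
Proof.
rewrite normal_pdfE ?oner_neq0// /normal_fun subr0 expr1n.
by congr (_ * expR _); rewrite mulNr.
Qed.

Lemma is_derive_std_normal_pdf (x : R) : is_derive x 1 p (- x * p x).
Proof.
rewrite (_ : p = fun x => normal_peak 1 * expR (- (x ^+ 2 / 2))); last first.
  by apply/funext => u; rewrite std_normal_pdfE.
apply: is_derive_eq; rewrite /GRing.scale/= !mulr0 !add0r ?mulr1.
by move: (normal_peak _) (expR _) => a b; field.
Qed.

Lemma integrable_std_normal_absM :
  mu.-integrable setT (EFin \o (fun x => `|x| * p x)).
Proof.
(* The normal density of variance 2 dominates up to a constant, since |x| <= 1 + x^2 / 4 <= exp (x^2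
   / 4). *)
pose s : R := Num.sqrt 2; have s0 : s != 0 by rewrite gt_eqF// sqrtr_gt0.
pose K := normal_peak 1 / normal_peak s.
have ps0 := normal_peak_gt0 s0.
have p10 : 0 < normal_peak 1 :> R := normal_peak_gt0 (oner_neq0 _).
apply: (@le_integrable _ _ _ mu _ _ _ (EFin \o (fun x => K * normal_pdf 0 s x))) => //.
- apply/measurable_EFinP/measurable_funM; last exact: measurable_normal_pdf.
  exact: normr_measurable.
- move=> x _ /=; rewrite lee_fin ger0_norm; last first.
    by rewrite mulr_ge0// normal_pdf_ge0.
  apply: le_trans (ler_norm _).
  rewrite std_normal_pdfE normal_pdfE// /normal_fun subr0 sqr_sqrtr//.
  rewrite /K mulrA divfK ?gt_eqF// mulrCA ler_pM2l//.
  rewrite (_ : - x ^+ 2 / (2 *+ 2) = - (x ^+ 2 / 2) + x ^+ 2 / 4); last by field.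
  rewrite expRD mulrC ler_pM2l ?expR_gt0//.
  apply: le_trans (expR_ge1Dx _).
  by rewrite -(real_normK (num_real x)); have := sqr_ge0 (`|x| / 2 - 1); lra.
- exact: (integrableZl measurableT K (integrable_normal_pdf 0 s)).
Qed.

Let integrable_waveM (g : R -> R) : measurable_fun setT g ->
  (forall x, `|g x| <= 1) -> mu.-integrable setT (EFin \o (fun x => g x * p x)).
Proof.
move=> mg g1; apply: (@le_integrable _ _ _ mu _ _ _ (EFin \o p)) => //.
- by apply/measurable_EFinP/measurable_funM => //; exact: measurable_normal_pdf.
- move=> x _ /=; rewrite lee_fin normrM ler_piMl//.
- exact: integrable_normal_pdf.
Qed.

Let integrable_xM (g : R -> R) : measurable_fun setT g ->
  (forall x, `|g x| <= 1) ->
  mu.-integrable setT (EFin \o (fun x => x * g x * p x)).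
Proof.
move=> mg g1.
apply: (@le_integrable _ _ _ mu _ _ _ (EFin \o (fun x => `|x| * p x))) => //.
- apply/measurable_EFinP; apply: measurable_funM; last exact: measurable_normal_pdf.
  exact: measurable_funM.
- move=> x _ /=; rewrite lee_fin !normrM normr_id ler_wpM2r//.
  by rewrite ler_piMr.
- exact: integrable_std_normal_absM.
Qed.

(** Stein's identity for sin (t x + phi): it expresses that [F], the product of the sine and the
    density, has an integrable derivative [G] and vanishes at infinity. The integral over the line
    is the limit over [- n, n] by dominated convergence. *)
Lemma std_normal_by_parts (t phi : R) :
  \int[mu]_x (x * sin (t * x + phi) * p x) =
  t * \int[mu]_x (cos (t * x + phi) * p x).
Proof.
have ms : measurable_fun setT (fun x : R => sin (t * x + phi)).
  apply: continuous_measurable_fun => x.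
  apply: (@continuous_comp _ _ _ (fun x => t * x + phi) sin).
    by apply: cvgD; [apply: cvgMr; exact: cvg_id|exact: cvg_cst].
  exact: continuous_sin.
have mc : measurable_fun setT (fun x : R => cos (t * x + phi)).
  apply: continuous_measurable_fun => x.
  apply: (@continuous_comp _ _ _ (fun x => t * x + phi) cos).
    by apply: cvgD; [apply: cvgMr; exact: cvg_id|exact: cvg_cst].
  exact: continuous_cos.
have is_ := integrable_xM ms (fun x => sin_max _).
have ic := integrable_waveM mc (fun x => cos_max _).
have itc : mu.-integrable setT (EFin \o (fun x => t * (cos (t * x + phi) * p x))).
  exact: (integrableZl measurableT t ic).
apply/eqP; rewrite eq_sym -subr_eq0 -RintegralZl// -RintegralB//; apply/eqP.
set G := fun x => t * (cos (t * x + phi) * p x) - x * sin (t * x + phi) * p x.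
have iG : mu.-integrable setT (EFin \o G).
  by have := integrableB measurableT itc is_.
pose F x := sin (t * x + phi) * p x.
have dF (x : R) : is_derive x 1 F (G x).
  have dp := is_derive_std_normal_pdf x.
  apply: is_derive_eq; rewrite /GRing.scale/= /G; ring.
have cF : continuous F.
  move=> x; apply/differentiable_continuous/derivable1_diffP.
  exact: (@ex_derive _ _ _ _ _ _ _ (dF x)).
have cp : continuous p by exact: continuous_normal_pdf (oner_neq0 _).
have cG : continuous G.
  have ca : continuous (fun x : R => t * x + phi).
    by move=> y; apply: cvgD; [apply: cvgMr; exact: cvg_id|exact: cvg_cst].
  move=> x; apply: cvgB.
    apply: cvgMr; apply: cvgM; last exact: cp.
    apply: (@continuous_comp _ _ _ (fun x => t * x + phi) cos); first exact: ca.
    exact: continuous_cos.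
  apply: cvgM; last exact: cp.
  apply: cvgM; first exact: cvg_id.
  apply: (@continuous_comp _ _ _ (fun x => t * x + phi) sin); first exact: ca.
  exact: continuous_sin.
have mG : measurable_fun setT G by exact: continuous_measurable_fun.
pose I (n : nat) : set R := `[- n.+1%:R, n.+1%:R]%classic.
have intI n : (\int[mu]_(x in I n) (G x)%:E = (F n.+1%:R - F (- n.+1%:R))%:E)%E.
  rewrite EFinB; apply: continuous_FTC2.
  - by rewrite -subr_gt0 opprK addr_gt0// ltr0n.
  - by apply: continuous_subspaceT => x; exact: cG.
  - split.
    + by move=> x _; exact: (@ex_derive _ _ _ _ _ _ _ (dF x)).
    + by apply: cvg_at_right_filter; exact: cF.
    + by apply: cvg_at_left_filter; exact: cF.
  - by move=> x _; rewrite derive1E; exact: derive_val.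
have [_ _ cvgI] : [/\ mu.-integrable setT (EFin \o G),
  [sequence (\int[mu]_x `| ((G \_ (I n)) x)%:E - (G x)%:E|)%E]_n @ \oo --> 0%E &
  [sequence (\int[mu]_x ((G \_ (I n)) x)%:E)%E]_n @ \oo -->
    (\int[mu]_x (G x)%:E)%E].
  apply: (@dominated_convergence _ _ _ mu setT measurableT
      (fun n x => ((G \_ (I n)) x)%:E) (EFin \o G) (fun x => `|(G x)%:E|%E)) => //.
  - move=> n; apply/measurable_EFinP.
    apply/(measurable_restrictT _ _).1; first exact: measurable_itv.
    exact: (measurable_funS measurableT (@subsetT _ _) mG).
  - exact/measurable_EFinP.
  - apply: aeW => x _; apply: cvg_EFin; first by near=> n.
    apply: (@cvg_trans _ (G x @[n --> \oo])); last exact: cvg_cst.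
    apply: near_eq_cvg; near=> n => /=; rewrite patchE mem_set// /I/= in_itv/=.
    rewrite -ler_norml; apply: ltW; near: n.
    exists (Num.truncn `|x|) => // n /= xn; apply: lt_le_trans (truncnS_gt _) _.
    by rewrite ler_nat ltnS.
  - exact: integrable_abse.
  - apply: aeW => x n _; rewrite lee_fin patchE; case: ifP => // _.
    by rewrite normr0.
have cvg0 : (\int[mu]_(x in I n) (G x)%:E)%E @[n --> \oo] --> 0%E.
  rewrite (_ : (fun n => _) = fun n => (F n.+1%:R - F (- n.+1%:R))%:E); last first.
    by apply/funext => n; exact: intI.
  apply: cvg_EFin; first by near=> n.
  pose k : R := normal_peak 1; have k0 : 0 <= k := normal_peak_ge0 1.
  (* A crude decay rate is enough for the boundary terms: exp (x^2 / 2) >= 1 + x^2 / 2 >= x / 2. *)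
  have pn n : p n.+1%:R <= k * (2 * n.+1%:R^-1).
    rewrite std_normal_pdfE ler_wpM2l// expRN ler_pdivlMr ?ltr0n// mulrC.
    rewrite ler_pdivrMr ?expR_gt0//.
    have := expR_ge1Dx ((n.+1%:R : R) ^+ 2 / 2).
    have : 1 <= n.+1%:R :> R by rewrite ler1n.
    by nra.
  have pN x : p (- x) = p x by rewrite !std_normal_pdfE sqrrN.
  have Fp x : `|F x| <= p x.
    rewrite normrM (ger0_norm (normal_pdf_ge0 _ _ _)).
    by rewrite ler_piMl ?normal_pdf_ge0// sin_max.
  apply: norm_cvg0; apply: (@squeeze_cvgr _ _ _ _ (cst 0)
    (fun n => (4 * k) * harmonic n)).
  - apply: nearW => n /=; rewrite normr_ge0/=.
    rewrite (le_trans (ler_normB _ _))//.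
    have FN := Fp (- n.+1%:R); rewrite pN in FN.
    have -> : 4 * k * harmonic n = k * (2 * n.+1%:R^-1) + k * (2 * n.+1%:R^-1).
      by rewrite /harmonic/=; ring.
    by apply: lerD; apply: le_trans (pn n) => //; exact: Fp.
  - exact: cvg_cst.
  - by rewrite -(mulr0 (4 * k)); apply: cvgMr; exact: cvg_harmonic.
have EI n : (\int[mu]_x ((G \_ (I n)) x)%:E = \int[mu]_(x in I n) (G x)%:E)%E.
  rewrite [RHS]integral_mkcond/=.
  by apply: eq_integral => x _; rewrite restrict_EFin.
have : (\int[mu]_x (G x)%:E = 0)%E.
  by apply: cvg_unique cvgI _ => //=; under eq_fun do rewrite EI.
by rewrite /Rintegral => ->.
Unshelve. all: by end_near. Qed.

(** As a function of the frequency s the integral F solves F' = - s F: differentiate under the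
    integral, with |y| p y as dominating function, then apply [std_normal_by_parts]. *)
Lemma std_normal_charfun (t phi : R) :
  \int[normal_prob 0 1]_x cos (t * x + phi) = expR (- (t ^+ 2 / 2)) * cos phi.
Proof.
have ca (s : R) : continuous (fun x : R => s * x + phi).
  by move=> y; apply: cvgD; [apply: cvgMr; exact: cvg_id|exact: cvg_cst].
have mc (s : R) : measurable_fun setT (fun x : R => cos (s * x + phi)).
  apply: continuous_measurable_fun => x.
  apply: (@continuous_comp _ _ _ (fun x => s * x + phi) cos); first exact: ca.
  exact: continuous_cos.
rewrite Rintegral_normal_prob; last first.
  by apply: (@intg_bounded _ _ _ _ _ 1) => [|x]; [exact: mc|exact: cos_max].
pose f (s x : R) := cos (s * x + phi) * p x.
pose F (s : R) := \int[mu]_x f s x.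
have df (s x : R) : is_derive s 1 (f ^~ x) (- (x * sin (s * x + phi) * p x)).
  by apply: is_derive_eq; rewrite /GRing.scale/=; ring.
have dfE (s x : R) : partial1of2 f s x = - (x * sin (s * x + phi) * p x).
  by rewrite partial1of2E; exact: derive_val.
have F' (s : R) : is_derive s 1 F (- (s * F s)).
  have Is : `]s - 1, s + 1[%classic s by rewrite /= in_itv/= ltrBlDr ltrDl ltr01.
  have H1 : forall x, `]s - 1, s + 1[%classic x -> mu.-integrable setT (EFin \o f x).
    by move=> x _; apply: integrable_waveM => [|y]; [exact: mc|exact: cos_max].
  have H2 : forall x y : R, `]s - 1, s + 1[%classic x -> setT y -> derivable (f ^~ y) x 1.
    by move=> x y _ _; exact: (@ex_derive _ _ _ _ _ _ _ (df x y)).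
  have H3 : forall y : R, 0 <= `|y| * p y.
    by move=> y; rewrite mulr_ge0// normal_pdf_ge0.
  have H4 : forall x y : R, `]s - 1, s + 1[%classic x -> setT y ->
      `|partial1of2 f x y| <= `|y| * p y.
    move=> x y _ _; rewrite dfE normrN !normrM (ger0_norm (normal_pdf_ge0 _ _ _)).
    by rewrite ler_wpM2r ?normal_pdf_ge0// ler_piMr// sin_max.
  have D := derivable_under_integral measurableT Is H1 H2 H3 integrable_std_normal_absM H4.
  apply: DeriveDef => //.
  rewrite -derive1E.
  rewrite (differentiation_under_integral measurableT Is H1 H2 H3 integrable_std_normal_absM H4).
  under eq_Rintegral do rewrite dfE -mulN1r.
  rewrite RintegralZl//; last first.
    apply: integrable_xM => [|x]; last exact: sin_max.
    apply: continuous_measurable_fun => x.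
    apply: (@continuous_comp _ _ _ (fun x => s * x + phi) sin); first exact: ca.
    exact: continuous_sin.
  by rewrite std_normal_by_parts mulN1r.
(* Integrating factor of the equation: H has derivative 0, so it equals its value at s = 0. *)
pose H (s : R) := expR (s ^+ 2 / 2) * F s.
have H' (s : R) : is_derive s 1 H 0.
  have dF := F' s; apply: is_derive_eq; rewrite /GRing.scale/= -/(F s).
  rewrite ?addr0 ?add0r ?mulr0 ?add0r ?mulr1.
  by move: (expR _) (F s) => a b; field.
have -> : \int[mu]_x (cos (t * x + phi) * p x) = expR (- (t ^+ 2 / 2)) * H t.
  by rewrite /H mulrA -expRD addNr expR0 mul1r.
rewrite (is_derive_0_is_cst t 0 H') /H expr0n/= mul0r expR0 mul1r /F /f.
under eq_Rintegral do rewrite mul0r add0r.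
rewrite RintegralZl//; last exact: integrable_normal_pdf.
by rewrite /Rintegral integral_normal_pdf mulr1.
Qed.

End gaussian_fourier_transform.
(** * From characteristic functions to convergence in distribution *)

Section sine_taylor.
Context (R : realType).
Implicit Types x y : R.

Lemma sin_le_id x : 0 <= x -> sin x <= x.
Proof.
move=> x0; pose F (y : R) := y - sin y.
have dF (y : R) : is_derive y 1 F (1 - cos y).
  by apply: is_derive_eq; rewrite /GRing.scale/= ?mulr1.
suff : F 0 <= F x by rewrite /F sin0 subrr subr_ge0.
have cF : {within `[0, x], continuous F}.
  apply: continuous_subspaceT => y; apply/differentiable_continuous.
  apply/derivable1_diffP; exact: (@ex_derive _ _ _ _ _ _ _ (dF y)).
have [c _ FE] := MVT_segment x0 (fun y _ => dF y) cF.
by rewrite -subr_ge0 FE mulr_ge0 ?subr_ge0 ?cos_le1.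
Qed.

Lemma norm_sin_le x : `|sin x| <= `|x|.
Proof.
wlog x0 : x / 0 <= x => [H|].
  have [/H//|/ltW xN] := leP 0 x.
  by rewrite -normrN -sinN -[leRHS]normrN H// oppr_ge0.
rewrite (ger0_norm x0) ler_norml sin_le_id// andbT.
have [x1|x1] := leP 1 x; first by rewrite (le_trans _ (sin_geN1 x))// lerN2.
apply: le_trans (_ : 0 <= _); first by rewrite oppr_le0.
by apply: sin_ge0_pi; rewrite x0 (le_trans (ltW x1))//; have := pi_ge2 R; lra.
Qed.

Lemma cos_ge_quadratic x : 1 - x ^+ 2 / 2 <= cos x.
Proof.
have -> : cos x = 1 - 2 * sin (x / 2) ^+ 2.
  by rewrite [in LHS](_ : x = (x / 2) *+ 2) ?cos_mulr2n ?sin2cos2; [ring|rewrite -mulr_natr; field].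
have : sin (x / 2) ^+ 2 <= (x / 2) ^+ 2.
  rewrite -(real_normK (num_real (sin _))) -(real_normK (num_real (x / 2))).
  by rewrite ler_pXn2r ?nnegrE// norm_sin_le.
lra.
Qed.

Lemma norm_sin_sub_le x : `|sin x - x| <= `|x| ^+ 3 / 6.
Proof.
wlog x0 : x / 0 <= x => [H|].
  have [/H//|/ltW xN] := leP 0 x.
  by rewrite -normrN opprB -[X in X - _]opprK addrC -sinN -[`|x|]normrN H// oppr_ge0.
rewrite (ger0_norm x0) ler0_norm ?subr_le0 ?sin_le_id// opprB.
pose F (y : R) := sin y - y + y ^+ 3 / 6.
have dF (y : R) : is_derive y 1 F (cos y - 1 + y ^+ 2 / 2).
  apply: is_derive_eq; rewrite /GRing.scale/= ?mulr1 ?mulr0 ?add0r.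
  by move: (cos y) => c; field.
suff : F 0 <= F x by rewrite /F sin0 subrr expr0n/= mul0r addr0; lra.
have cF : {within `[0, x], continuous F}.
  apply: continuous_subspaceT => y; apply/differentiable_continuous.
  apply/derivable1_diffP; exact: (@ex_derive _ _ _ _ _ _ _ (dF y)).
have [c _ FE] := MVT_segment x0 (fun y _ => dF y) cF.
rewrite -subr_ge0 FE mulr_ge0// ?subr_ge0//.
by have := cos_ge_quadratic c; lra.
Qed.

End sine_taylor.

Lemma periodic1_itv01 (R : realType) (f : R -> R) : (forall u, f (u + 1) = f u) ->
  forall u, exists2 v, 0 <= v <= 1 & f u = f v.
Proof.
move=> f1; have fn (n : nat) u : f (u + n%:R) = f u.
  elim: n u => [|n IH] u; first by rewrite addr0.
  by rewrite -natr1 addrA f1.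
move=> u; exists (u - (Num.floor u)%:~R).
  have /andP[h1 h2] := Num.Theory.real_floor_itv (num_real u).
  by rewrite subr_ge0 h1/= lerBlDl ltW// (lt_le_trans h2)// intrD.
case: (Num.floor u) => n; first by rewrite -(fn n (u - _)) subrK.
by rewrite NegzE mulrNz opprK fn.
Qed.

Section continuity_theorem.
Context d (T : measurableType d) (R : realType) (P : probability T R).
Variables (X : nat -> T -> R) (Q : probability (measurableTypeR R) R) (B : R).
Hypothesis X_sqintg : forall N, sqintg P (X N).
Hypothesis X_le : forall N, \int[P]_x (X N x ^+ 2) <= B.
Hypothesis cvg_cos : forall t phi : R,
  \int[P]_x cos (t * X N x + phi) @[N --> \oo] --> \int[Q]_y cos (t * y + phi).

Let bnd_comp (g : R -> R) (G : R) N : continuous g -> (forall y, `|g y| <= G) ->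
  intg P (fun x => g (X N x)).
Proof.
move=> cg gG; apply: (@intg_bounded _ _ _ _ _ G) => //.
have [mX _] := X_sqintg N.
by apply: measurableT_comp => //; exact: continuous_measurable_fun.
Qed.

Let bnd_Q (g : R -> R) (G : R) : continuous g -> (forall y, `|g y| <= G) ->
  intg Q g.
Proof.
move=> cg gG; apply: (@intg_bounded _ _ _ _ _ G) => //.
exact: continuous_measurable_fun.
Qed.

Lemma cvg_Rintg_trig (s : R) S w : trig_in S w ->
  \int[P]_x w (s * X N x) @[N --> \oo] --> \int[Q]_y w (s * y).
Proof.
move=> [l [_ wE]].
have cc (a : R * nat * R) : continuous (fun y : R => wave a.1.2 a.2 (s * y)).
  move=> y; apply: (@continuous_comp _ _ _ (fun y => s * y)).
    by apply: cvgMr; exact: cvg_id.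
  exact: continuous_wave.
have -> : (fun N => \int[P]_x w (s * X N x)) = fun N => \sum_(a <- l)
    a.1.1 * \int[P]_x cos (2 * pi * a.1.2%:R * s * X N x + a.2).
  apply/funext => N; under eq_Rintegral do rewrite wE.
  rewrite Rintg_sum; last first.
    move=> a _; apply: intgZ; apply: (@bnd_comp _ 1) (cc a) _ => y.
    exact: wave_le1.
  apply: eq_bigr => a _; rewrite RintegralZl//; last first.
    by apply: (@bnd_comp _ 1) (cc a) _ => y; exact: wave_le1.
  by congr (_ * _); apply: eq_Rintegral => x _; rewrite /wave !mulrA.
have -> : \int[Q]_y w (s * y) = \sum_(a <- l)
    a.1.1 * \int[Q]_y cos (2 * pi * a.1.2%:R * s * y + a.2).
  under eq_Rintegral do rewrite wE.
  rewrite Rintg_sum; last first.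
    move=> a _; apply: intgZ; apply: (@bnd_Q _ 1) (cc a) _ => y.
    exact: wave_le1.
  apply: eq_bigr => a _; rewrite RintegralZl//; last first.
    by apply: (@bnd_Q _ 1) (cc a) _ => y; exact: wave_le1.
  by congr (_ * _); apply: eq_Rintegral => x _; rewrite /wave !mulrA.
elim: l {wE} => [|a l IH].
  by rewrite big_nil; under eq_fun do rewrite big_nil; exact: cvg_cst.
rewrite big_cons; under eq_fun do rewrite big_cons.
by apply: cvgD => //; apply: cvgMr; exact: cvg_cos.
Qed.

(* [g x] is replaced by the periodic function [g (A * sin (x / A))], which is
   close to it for [x] small compared to [A]. *)
Lemma sine_clamp (g : R -> R) (K e : R) : continuous g -> 0 < e ->
  \forall A \near +oo, forall x, `|x| <= K -> `|g x - g (A * sin (x / A))| <= e.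
Proof.
move=> cg e0.
have [r r0 rg] := uniform_continuity_itv (- `|K|) `|K| cg e0.
near=> A => x xK.
have A0 : 0 < A by near: A; exact: nbhs_pinfty_gt.
(* Makes the cubic Taylor error A (|x| / A)^3 / 6 smaller than r. *)
have AK : `|K| ^+ 3 / r < A by near: A; apply: nbhs_pinfty_gt; exact: num_real.
have A1 : 1 < A by near: A; exact: nbhs_pinfty_gt.
have xK' : `|x| <= `|K| by exact: le_trans (ler_norm _).
have sK : `|A * sin (x / A)| <= `|K|.
  rewrite normrM (gtr0_norm A0) (le_trans (ler_wpM2l (ltW A0) (norm_sin_le _)))//.
  by rewrite normrM (gtr0_norm (_ : 0 < A^-1)) ?invr_gt0// mulrCA divff ?gt_eqF// mulr1.
apply/ltW/rg; rewrite -?ler_norml//.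
have -> : x - A * sin (x / A) = - A * (sin (x / A) - x / A).
  by field; rewrite gt_eqF.
rewrite normrM normrN (gtr0_norm A0).
apply: le_lt_trans (ler_wpM2l (ltW A0) (norm_sin_sub_le _)) _.
rewrite normrM (gtr0_norm (_ : 0 < A^-1)) ?invr_gt0// exprMn.
have -> : A * (`|x| ^+ 3 * A^-1 ^+ 3 / 6) = `|x| ^+ 3 / 6 / A ^+ 2.
  by field; rewrite gt_eqF.
have x3 : `|x| ^+ 3 <= `|K| ^+ 3 by rewrite ler_pXn2r ?nnegrE.
rewrite ltr_pdivrMr ?exprn_gt0//.
rewrite ltr_pdivrMr// in AK.
have : 0 <= `|x| ^+ 3 by rewrite exprn_ge0.
have : r * A <= r * A ^+ 2 by rewrite ler_pM2l// ler_eXnr// ltW.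
lra.
Unshelve. all: by end_near. Qed.

(** On the side of X the bounded second moments supply tightness, through Chebyshev. The error e is
    split into six equal parts, two of them spent on passing from g to its clamped version under
    P. *)
Lemma cvg_Rintg_bounded_continuous (g : R -> R) : continuous g -> bounded_fun g ->
  \int[P]_x g (X N x) @[N --> \oo] --> \int[Q]_y g y.
Proof.
move=> cg [G0 [_ bG]]; pose G := `|G0| + 1.
have gG y : `|g y| <= G.
  by apply: bG => //; rewrite /G (le_lt_trans (ler_norm _))// ltrDl.
have Gp : 0 <= G by apply: le_trans (gG 0).
pose gA (A x : R) := g (A * sin (x / A)).
have cs (A : R) : continuous (fun x : R => A * sin (x / A)).
  move=> x; apply: cvgMr; apply: (@continuous_comp _ _ _ (fun x : R => x / A) sin).
    by apply: cvgMl; exact: cvg_id.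
  exact: continuous_sin.
have cgA (A : R) : continuous (gA A).
  move=> x; apply: (@continuous_comp _ _ _ (fun x : R => A * sin (x / A)) g).
    exact: cs.
  exact: cg.
have gAG A y : `|gA A y| <= G by exact: gG.
have natpinf (S : R -> Prop) : (\forall A \near +oo, S A) ->
    \forall n \near \oo, S n.+1%:R.
  move=> [M [_ MS]]; near=> n; apply: MS; near: n.
  exists (Num.truncn `|M|) => // n /= Mn; apply: le_lt_trans (ler_norm _) _.
  by apply: lt_le_trans (truncnS_gt _) _; rewrite ler_nat ltnS.
(* The hypotheses give no moment of Q, so the clamping error under Q is handled by dominated
   convergence instead of Chebyshev. *)
have QA : \int[Q]_y gA n.+1%:R y @[n --> \oo] --> \int[Q]_y g y.
  apply: fine_cvg; rewrite fineK; last first.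
    by apply: integrable_fin_num => //; exact: bnd_Q cg gG.
  have [_ _] : [/\ Q.-integrable setT (EFin \o g),
    [sequence (\int[Q]_y `|(gA n.+1%:R y)%:E - (g y)%:E|)%E]_n @ \oo --> 0%E &
    [sequence (\int[Q]_y (gA n.+1%:R y)%:E)%E]_n @ \oo --> (\int[Q]_y (g y)%:E)%E].
    apply: (@dominated_convergence _ _ _ Q setT measurableT
      (fun n y => (gA n.+1%:R y)%:E) (EFin \o g) (fun=> G%:E)) => //.
    - by move=> n; apply/measurable_EFinP; exact: continuous_measurable_fun.
    - by apply/measurable_EFinP; exact: continuous_measurable_fun.
    - apply: aeW => y _; apply: cvg_EFin; first by near=> n.
      apply/cvgrPdist_le => e e0.
      have /natpinf := sine_clamp `|y| cg e0.
      by apply: filterS => n; apply.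
    - exact: (intg_cst Q G).
    - by apply: aeW => y n _; rewrite lee_fin.
  exact.
apply/cvgrPdist_le => e e0; have e6 : 0 < e / 6 by rewrite divr_gt0.
have B0 : 0 <= B by apply: le_trans (X_le 0); exact: Rintg_sqr_ge0.
(* Chosen so that 2 G B / K^2 <= e / 6; the summand 1 ensures K <= K^2. *)
pose K : R := 1 + 2 * G * B / (e / 6).
have GB : 0 <= 2 * G * B / (e / 6) by rewrite divr_ge0 ?mulr_ge0// ltW.
have [n [nQ nK]] : exists n : nat, `|\int[Q]_y g y - \int[Q]_y gA n.+1%:R y| <= e / 6
    /\ forall x, `|x| <= K -> `|g x - gA n.+1%:R x| <= e / 6.
  have /cvgrPdist_le/(_ _ e6) QAe := QA.
  have /natpinf cl := sine_clamp K cg e6.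
  near \oo => n; exists n; split; near: n => //.
set A : R := n.+1%:R in nQ nK *; have A0 : 0 < A by rewrite ltr0n.
(* The function [gA A] has period 2 pi A; [h] is its rescaling to period 1, and [s] below undoes the
   scaling. *)
pose h (u : R) := g (A * sin (2 * pi * u)).
have [w tw hw] : exists2 w, trig_in (fun=> True) w &
    forall x, 0 <= x <= 1 -> `|h x - w x| <= e / 6.
  apply: trig_weierstrass => //.
    move=> x; apply: (@continuous_comp _ _ _ (fun x : R => A * sin (2 * pi * x)) g); last exact: cg.
    apply: cvgMr; apply: (@continuous_comp _ _ _ (fun x : R => 2 * pi * x) sin).
      by apply: cvgMr; exact: cvg_id.
    exact: continuous_sin.
  by rewrite /h mulr0 sin0 mulr1 mulr_natl sin2pi.
have hwT u : `|h u - w u| <= e / 6.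
  have [|v v01 ->] := @periodic1_itv01 R (fun u => `|h u - w u|) _ u; last exact: hw.
  move=> v; rewrite (trig_periodic _ tw) /h; congr (`|g (A * _) - _|).
  by rewrite mulrDr mulr1 mulr_natl sinD2pi.
pose s := (2 * pi * A)^-1.
have pi0 := pi_gt0 R.
have gw x : `|gA A x - w (s * x)| <= e / 6.
  have -> : gA A x = h (s * x); last exact: hwT.
  rewrite /gA /h; congr (g (A * sin _)).
  by rewrite mulrA /s invfM mulrA divff ?gt_eqF ?mulr_gt0// mul1r mulrC.
have cw : continuous (fun x => w (s * x)).
  move=> x; apply: (@continuous_comp _ _ _ (fun x : R => s * x) w).
    by apply: cvgMr; exact: cvg_id.
  exact: trig_continuous tw _.
have [W wW] := trig_bounded tw.
have /cvgrPdist_le/(_ _ e6) cvgw := cvg_Rintg_trig (s := s) tw.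
near=> N.
have hN : `|\int[Q]_y w (s * y) - \int[P]_x w (s * X N x)| <= e / 6.
  by near: N; exact: cvgw.
have i1 := bnd_comp N cg gG; have i2 := bnd_comp N (cgA A) (gAG A).
have i3 := bnd_comp N cw (fun y => wW (s * y)).
have j1 := bnd_Q cg gG; have j2 := bnd_Q (cgA A) (gAG A).
have j3 := bnd_Q cw (fun y => wW (s * y)).
have K1 : 1 <= K by rewrite lerDl.
have K0 : 0 < K by exact: lt_le_trans K1.
(* Chebyshev in pointwise form: where |X N| > K the trivial bound 2 G is multiplied by (X N / K)^2
   >= 1. *)
have b1 : `|\int[P]_x (g (X N x) - gA A (X N x))| <= e / 6 + e / 6.
  apply: le_trans (_ : \int[P]_x (e / 6 + (2 * G / K ^+ 2) * X N x ^+ 2) <= _).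
    apply: Rintg_norm_le.
    - exact: intgB.
    - by apply: intgD; [exact: intg_cst|apply: intgZ; exact: (X_sqintg N).2].
    - move=> x; have [xK|xK] := leP `|X N x| K.
        rewrite (le_trans (nK _ xK))// lerDl mulr_ge0 ?sqr_ge0//.
        by rewrite divr_ge0 ?mulr_ge0 ?(ltW K0).
      rewrite (le_trans (ler_normB _ _))//.
      have xK2 : 1 <= X N x ^+ 2 / K ^+ 2.
        rewrite ler_pdivlMr ?exprn_gt0// mul1r -(real_normK (num_real (X N x))).
        by rewrite ler_pXn2r ?nnegrE ?(ltW K0) ?(ltW xK).
      have := gG (X N x); have := gAG A (X N x).
      have : 2 * G * 1 <= 2 * G * (X N x ^+ 2 / K ^+ 2).
        by rewrite ler_wpM2l// mulr_ge0.
      by rewrite mulrAC mulrA; lra.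
  rewrite RintegralD//; [|exact: intg_cst|apply: intgZ; exact: (X_sqintg N).2].
  rewrite Rintg_cst lerD2l RintegralZl//; last exact: (X_sqintg N).2.
  apply: le_trans (ler_wpM2l _ (X_le N)) _.
    by rewrite divr_ge0 ?mulr_ge0 ?(ltW K0).
  rewrite mulrAC ler_pdivrMr ?exprn_gt0//.
  have KK : K <= K ^+ 2 by rewrite ler_eXnr.
  apply: le_trans (_ : e / 6 * K <= _); last by rewrite ler_pM2l.
  by rewrite /K [e / 6 * _]mulrDr mulr1 [X in _ + X]mulrC divfK ?gt_eqF// lerDr ltW.
have b2 : `|\int[P]_x (gA A (X N x) - w (s * X N x))| <= e / 6.
  rewrite -[leRHS](Rintg_cst P); apply: Rintg_norm_le => //.
  - exact: intgB.
  - exact: intg_cst.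
have b3 : `|\int[Q]_y (gA A y - w (s * y))| <= e / 6.
  rewrite -[leRHS](Rintg_cst Q); apply: Rintg_norm_le => //.
  - exact: intgB.
  - exact: intg_cst.
rewrite RintegralB// in b1; rewrite RintegralB// in b2; rewrite RintegralB// in b3.
set a1 := \int[Q]_y g y in nQ *; set a2 := \int[Q]_y gA A y in nQ b3 *.
set a3 := \int[Q]_y w (s * y) in b3 hN *; set a4 := \int[P]_x w (s * X N x) in hN b2 *.
set a5 := \int[P]_x gA A (X N x) in b1 b2 *; set a6 := \int[P]_x g (X N x) in b1 *.
move: nQ b1 b2 b3 hN; rewrite !ler_norml => *; lra.
Unshelve. all: by end_near. Qed.

End continuity_theorem.
(** * Dilations and Fourier series in mean square *)

Section dilation.
Context (R : realType).
Notation mu := (@lebesgue_measure R).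

(** The right-hand side is a measure in A that agrees with Lebesgue measure on half-open intervals,
    hence everywhere. *)
Lemma lebesgue_measure_affine (a b : R) (A : set R) : 0 < a -> measurable A ->
  mu A = (a%:E * mu ((fun x => a * x + b)%R @^-1` A))%E.
Proof.
move=> a0 mA; pose phi (x : measurableTypeR R) : measurableTypeR R := a * x + b.
have mphi : measurable_fun setT phi.
  by apply: measurable_funD => //; exact: measurable_funM.
pose a' : {nonneg R} := NngNum (ltW a0).
pose nu : {measure set (measurableTypeR R) -> \bar R} :=
  measure_function_pushforward__canonical__measure_function_Measure mu mphi.
have := @lebesgue_measure_unique R (mscale a' nu).
rewrite /mscale/= /pushforward/=; apply => // X [[x y] _ <-] /=.
rewrite -[RHS]/((a%:E * mu (phi @^-1` `]x, y]%classic))%E).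
rewrite (_ : _ @^-1` _ = `](x - b) / a, (y - b) / a]%classic); last first.
  apply/seteqP; split => z /=; rewrite !in_itv/= /phi ltr_pdivrMr// ler_pdivlMr//.
    by rewrite ltrBlDr lerBrDr (mulrC z).
  by rewrite ltrBlDr lerBrDr (mulrC z).
rewrite !lebesgue_measure_itv/= !lte_fin ltr_pM2r ?invr_gt0// ltrD2r.
case: ifPn => xy; last by rewrite mule0.
by rewrite -!EFinD -EFinM; congr EFin; field; rewrite gt_eqF.
Qed.

Lemma ge0_integral_affine (a b : R) (g : R -> \bar R) : 0 < a ->
  measurable_fun setT g -> (forall x, 0 <= g x)%E ->
  (\int[mu]_x g x = a%:E * \int[mu]_x g (a * x + b)%R)%E.
Proof.
move=> a0 mg g0; pose phi (x : measurableTypeR R) : measurableTypeR R := a * x + b.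
have mphi : measurable_fun setT phi.
  by apply: measurable_funD => //; exact: measurable_funM.
pose a' : {nonneg R} := NngNum (ltW a0).
pose nu : {measure set (measurableTypeR R) -> \bar R} :=
  measure_function_pushforward__canonical__measure_function_Measure mu mphi.
transitivity (\int[mscale a' nu]_x g x)%E.
  apply: eq_measure_integral => A mA _.
  exact: (lebesgue_measure_affine b a0 mA).
rewrite ge0_integral_mscale//=; congr (_ * _)%E.
by rewrite ge0_integral_pushforward//.
Qed.

(** The map x |-> n x winds the circle n times around itself, and each of the n turns contributes a
    share 1 / n. For non-negative g with extended real integrals the identity needs no integrability
    and so also transfers it. *)
Lemma haar_dilation (n : nat) (g : R -> R) : (0 < n)%N ->
  measurable_fun setT g -> (forall x, 0 <= g x) -> periodic g 1 ->
  (\int[haar]_x (g (n%:R * x))%:E = \int[haar]_x (g x)%:E)%E.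
Proof.
move=> n0 mg g0 g1.
have n0' : (0 : R) < n%:R by rewrite ltr0n.
have mgn : measurable_fun setT (fun x : R => g (n%:R * x)).
  by apply: measurableT_comp => //; exact: measurable_funM.
have co (h : R -> R) : measurable_fun setT h -> (forall x, 0 <= h x) ->
    (\int[haar]_x (h x)%:E = \int[mu]_x ((h \_ `[0%R, 1%R[) x)%:E)%E.
  move=> mh h0; rewrite haar_integralE; last exact/measurable_EFinP.
  rewrite -integral_itv_bndo_bndc; last first.
    by apply/measurable_EFinP; exact: measurable_funTS.
  by rewrite integral_mkcond/=; apply: eq_integral => x _; rewrite restrict_EFin.
rewrite !co//.
pose G := g \_ `[0%R, 1%R[.
have mG : measurable_fun setT G.
  apply/(measurable_restrictT _ _).1; first exact: measurable_itv.
  exact: (measurable_funS measurableT (@subsetT _ _) mg).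
have G0 x : 0 <= G x by rewrite /G patchE; case: ifP.
have gnat (k : nat) x : g (x + k%:R) = g x by exact: (periodicn g1 k x).
(* The half-open unit intervals [i, i + 1) tile [0, k) without overlap, so exactly one translate is
   non-zero at each point. *)
have GE x (k : nat) : \sum_(i < k) G (n%:R * x + (- i%:R)) =
    if (0 <= n%:R * x < k%:R) then g (n%:R * x) else 0.
  elim: k => [|k IH]; first by rewrite big_ord0; case: ifPn => //; case/andP => *; lra.
  rewrite big_ord_recr/= IH /G patchE.
  have -> : (n%:R * x - k%:R \in `[0%R, 1%R[%classic) = (k%:R <= n%:R * x < k.+1%:R).
    apply/idP/idP => [/set_mem|h]; last apply/mem_set; rewrite /= in_itv/=;
      by rewrite subr_ge0 ltrBlDr addrC natr1 ?h//.
  rewrite -(gnat k (_ - _)) subrK.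
  have kk : (k%:R : R) < k.+1%:R by rewrite ltr_nat.
  have k0 : (0 : R) <= k%:R by rewrite ler0n.
  have [h1|h1] := ltP (n%:R * x) k%:R.
    by rewrite (lt_trans h1 kk) !andbT/= addr0.
  by rewrite andbF add0r (le_trans k0 h1).
have -> : (\int[mu]_x (((fun x => g (n%:R * x)) \_ `[0%R, 1%R[) x)%:E =
    \int[mu]_x (\sum_(i < n) (G (n%:R * x - i%:R))%:E))%E.
  apply: eq_integral => x _; rewrite sumEFin GE patchE; congr EFin.
  rewrite (_ : (x \in `[0%R, 1%R[%classic) = (0 <= x < 1)).
    by rewrite pmulr_rge0// gtr_pMr.
  by apply/idP/idP => [/set_mem|h]; last apply/mem_set; rewrite /= in_itv.
rewrite ge0_integral_sum//; last 2 first.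
- move=> i; apply/measurable_EFinP; apply: measurableT_comp => //.
  by apply: measurable_funB => //; exact: measurable_funM.
- by move=> i x _; rewrite lee_fin.
under eq_bigr => i _.
  rewrite (_ : (\int[mu]_x _)%E = ((n%:R^-1)%:E * \int[mu]_x (G x)%:E)%E); last first.
    rewrite (@ge0_integral_affine n%:R (- i%:R) (EFin \o G))//; last first.
      exact/measurable_EFinP.
    by rewrite muleA -EFinM mulVf ?gt_eqF// mul1e.
  over.
rewrite -ge0_sume_distrl; last by move=> i _; rewrite lee_fin invr_ge0 ltW.
by rewrite sumEFin sumr_const card_ord -[_ *+ _]mulr_natl divff ?gt_eqF// mul1e.
Qed.

Lemma sqintg_dilation (n : nat) (g : R -> R) : (0 < n)%N -> periodic g 1 ->
  sqintg haar g -> sqintg haar (fun x => g (n%:R * x)).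
Proof.
move=> n0 g1 [mg gi].
have mgn : measurable_fun setT (fun x : R => g (n%:R * x)).
  by apply: measurableT_comp => //; exact: measurable_funM.
split => //; apply/integrableP; split.
  by apply/measurable_EFinP; exact: measurable_funX.
move: gi => /integrableP[_].
under [X in (X < _)%E -> _]eq_integral do rewrite /= ger0_norm ?sqr_ge0//.
under [X in _ -> (X < _)%E]eq_integral do rewrite /= ger0_norm ?sqr_ge0//.
rewrite (@haar_dilation n (fun x => g x ^+ 2))//.
- exact: measurable_funX.
- by move=> x; exact: sqr_ge0.
- by move=> x; rewrite g1.
Qed.

Lemma Rintg_sqr_dilation (n : nat) (g : R -> R) : (0 < n)%N -> periodic g 1 ->
  measurable_fun setT g ->
  \int[haar]_x (g (n%:R * x) ^+ 2) = \int[haar]_x (g x ^+ 2).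
Proof.
move=> n0 g1 mg; rewrite /Rintegral (@haar_dilation n (fun x => g x ^+ 2))//.
- exact: measurable_funX.
- by move=> x; exact: sqr_ge0.
- by move=> x; rewrite g1.
Qed.

End dilation.

(** * Density of trigonometric polynomials and mean-square convergence of Fourier sums *)

Section trigonometric_density.
Context (R : realType).
Notation mu := (@lebesgue_measure R).
Local Notation int f := (Rintegral (@haar R) setT f).
Implicit Types f g w : R -> R.

Definition clamp (B x : R) := Num.max (- B) (Num.min B x).

Lemma norm_clamp_le (B x : R) : 0 <= B -> `|clamp B x| <= B.
Proof.
move=> B0; rewrite ler_norml /clamp le_max lexx/= ge_max ge_min lexx andbT.
by rewrite (le_trans _ B0)// oppr_le0.
Qed.

Lemma clamp_id (B x : R) : `|x| <= B -> clamp B x = x.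
Proof. by rewrite ler_norml /clamp => /andP[xB Bx]; rewrite min_r// max_r. Qed.

Lemma clamp_contract (B x y : R) : 0 <= B ->
  `|clamp B x - clamp B y| <= `|x - y|.
Proof.
move=> B0; wlog yx : x y / y <= x => [H|].
  have [/H//|/ltW/H] := leP y x.
  by rewrite distrC (distrC y).
rewrite (ger0_norm (_ : 0 <= x - y)) ?subr_ge0// ler_norml /clamp.
by case: (leP B x) => ?; case: (leP B y) => ?; do ![case: (leP (- B) _) => ?]; lra.
Qed.

Lemma norm_sub_clamp_le (B x : R) : 0 <= B -> `|x - clamp B x| <= `|x|.
Proof.
move=> B0; have [xB|xB] := leP `|x| B; first by rewrite clamp_id// subrr normr0.
rewrite ler_norml /clamp.
have xx := ler_norm x; have := ler_norm (- x); rewrite normrN => xN.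
by case: (leP B x) => ?; case: (leP (- B) _) => ?; lra.
Qed.

Lemma measurable_clamp (B : R) f : measurable_fun setT f ->
  measurable_fun setT (fun x => clamp B (f x)).
Proof.
by move=> mf; apply: measurable_maxr => //; exact: measurable_minr.
Qed.

Lemma continuous_clamp (B : R) f : continuous f -> continuous (fun x => clamp B (f x)).
Proof.
move=> cf x.
apply: (@continuous_max _ _ (cst (- B)) (fun y => Num.min B (f y))).
  exact: cst_continuous.
apply: (@continuous_min _ _ (cst B) f); [exact: cst_continuous|exact: cf].
Qed.

Lemma clamp_approx f (e : R) : sqintg haar f -> 0 < e ->
  exists2 B : R, 0 < B & int (fun x => (f x - clamp B (f x)) ^+ 2) <= e.
Proof.
move=> [mf fi] e0.
have mc (n : nat) : measurable_fun setT (fun x => (f x - clamp n.+1%:R (f x)) ^+ 2).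
  by apply: measurable_funX; apply: measurable_funB => //; exact: measurable_clamp.
pose z : R -> \bar R := fun=> 0%:E.
have [_ _] : [/\ haar.-integrable setT z,
  [sequence (\int[haar]_x `|((f x - clamp n.+1%:R (f x)) ^+ 2)%:E - z x|)%E]_n @ \oo --> 0%E &
  [sequence (\int[haar]_x ((f x - clamp n.+1%:R (f x)) ^+ 2)%:E)%E]_n @ \oo -->
    (\int[haar]_x z x)%E].
  apply: (@dominated_convergence _ _ _ haar setT measurableT
    (fun n x => ((f x - clamp n.+1%:R (f x)) ^+ 2)%:E) z
    (fun x => (f x ^+ 2)%:E)) => //.
  - by move=> n; apply/measurable_EFinP; exact: mc.
  - exact: measurable_cst.
  - apply: aeW => x _; apply: cvg_EFin; first by near=> n.
    apply: (@cvg_trans _ (0 @[n --> \oo])); last exact: cvg_cst.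
    apply: near_eq_cvg; near=> n => /=; rewrite clamp_id ?subrr ?expr0n//.
    apply: ltW; near: n.
    exists (Num.truncn `|f x|) => // n /= xn; apply: lt_le_trans (truncnS_gt _) _.
    by rewrite ler_nat ltnS.
  - apply: aeW => x n _; rewrite lee_fin ger0_norm ?sqr_ge0//.
    rewrite -[leRHS](real_normK (num_real _)) -[leLHS](real_normK (num_real _)).
    rewrite ler_pXn2r ?nnegrE//.
    exact: norm_sub_clamp_le.
rewrite integral0 => /fine_cvgP[_] /cvgrPdist_le/(_ _ e0) cvg0.
near \oo => n; exists n.+1%:R; first by rewrite ltr0n.
have : `|0 - int (fun x => (f x - clamp n.+1%:R (f x)) ^+ 2)| <= e.
  by near: n.
by rewrite sub0r normrN; apply: le_trans; exact: ler_norm.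
Unshelve. all: by end_near. Qed.

(** Wallis bound: the left side does not increase with m, because (2 m + 1) (2 m + 3) <= (2 m +
    2)^2. *)
Lemma sqr_Rintg_bump_le m : m.*2.+1%:R * int (fun x => bump m x) ^+ 2 <= 1.
Proof.
elim: m => [|m IH].
  under eq_Rintegral do rewrite /bump expr0.
  by rewrite Rintg_cst expr1n mulr1.
rewrite Rintg_bumpS; set B := int _ in IH *.
apply: le_trans IH; rewrite exprMn mulrA ler_wpM2r ?sqr_ge0//.
have m0 : (0 : R) <= m%:R by rewrite ler0n.
have -> : m.+1.*2.+1%:R = 2 * m%:R + 3 :> R.
  by rewrite doubleS -addnn -!natr1 natrD; ring.
have -> : m.*2.+1%:R = 2 * m%:R + 1 :> R by rewrite -addnn -natr1 natrD; ring.
rewrite -natr1 expr_div_n mulrA ler_pdivrMr ?exprn_gt0 ?ltr_wpDl//.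
rewrite -subr_ge0 (_ : _ - _ = (2 * m%:R + 1) / 4); last by field.
by rewrite divr_ge0// addr_ge0// mulr_ge0.
Qed.

Lemma bump_le1 m u : bump m u <= 1 :> R.
Proof.
have := cos_geN1 (2 * pi * u); have := cos_le1 (2 * pi * u) => ? ?.
by apply: exprn_ile1; lra.
Qed.

(** The kernel equals 1 at the integers and is small in mean square, so multiplication by 1 - bump
    forces equal values at 0 and 1 at little cost. *)
Lemma Rintg_sqr_bump_small (e : R) : 0 < e ->
  exists m, int (fun x => bump m x ^+ 2) <= e.
Proof.
move=> e0; exists (Num.truncn (e ^- 2)).
set m := Num.truncn _.
have me : e ^- 2 < m.*2.+1%:R.
  apply: lt_le_trans (truncnS_gt _) _.
  by rewrite ler_nat ltnS -addnn leq_addr.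
apply: le_trans (_ : int (fun x => bump m x) <= _).
  apply: Rintg_le.
  - by apply: (trig_sqintg (trig_bump _ m)).2.
  - exact: trig_intg (trig_bump _ m).
  - by move=> x; rewrite expr2 ler_piMl ?bump_ge0 ?bump_le1.
rewrite -(ler_pXn2r (n := 2)) ?nnegrE ?(ltW e0) ?(ltW (Rintg_bump_gt0 _ m))//.
have M0 : (0 : R) < m.*2.+1%:R by rewrite ltr0n.
rewrite -(ler_pM2l M0); apply: le_trans (sqr_Rintg_bump_le m) _.
by rewrite -ler_pdivrMr ?exprn_gt0// mul1r ltW.
Qed.

(** The chain is f, its truncation [fB], a truncated continuous function [gB], the function [h] with
    matching endpoints, and [w]. Each of the four errors is e / 16, and two rounds of (a + b)^2 <= 2
    a^2 + 2 b^2 multiply each by 4. *)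
Lemma trig_dense f (e : R) : sqintg haar f -> 0 < e ->
  exists2 w, trig_in (fun=> True) w & int (fun x => (f x - w x) ^+ 2) <= e.
Proof.
move=> fi e0; have e8 : 0 < e / 16 by rewrite divr_gt0.
have [B B0 hB] := clamp_approx fi e8; have B0' := ltW B0.
have mfB := measurable_clamp B fi.1.
pose fB x := clamp B (f x).
have fBi : sqintg haar fB.
  by apply: (@sqintg_bounded _ _ _ _ _ B) => // x; exact: norm_clamp_le.
have [g [cg gi gfB]] : exists g : R -> R, [/\ continuous g,
    intg haar (fun x => `|fB x - g x|) &
    int (fun x => `|fB x - g x|) <= e / 16 / (2 * B)].
  have := (haar_integrableP mfB).1 (sqintg_intg fBi).
  move=> /approximation_continuous_integrable[//| |g_ [cg gi gcvg]].
    by rewrite /= lebesgue_measure_itv/= lte_fin ltr01 -EFinD ltry.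
  have eB : 0 < e / 16 / (2 * B) by rewrite divr_gt0// mulr_gt0.
  move: gcvg => /fine_cvgP[_] /cvgrPdist_le/(_ _ eB)[n _ /(_ n (leqnn n))].
  move=> /= h; exists (g_ n); split; first exact: cg.
    apply: intg_abs; apply: intgB; first exact: sqintg_intg.
    by apply/haar_integrableP => //; exact: continuous_measurable_fun (cg n).
  rewrite haar_RintegralE; last first.
    apply: measurableT_comp => //; apply: measurable_funB => //.
    exact: continuous_measurable_fun (cg n).
  by move: h; rewrite sub0r normrN; apply: le_trans; exact: ler_norm.
pose gB x := clamp B (g x).
have cgB : continuous gB by exact: continuous_clamp.
have gBB x : `|gB x| <= B by exact: norm_clamp_le.
have gBi : sqintg haar gB.
  apply: (@sqintg_bounded _ _ _ _ _ B) => //.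
  exact: continuous_measurable_fun.
(* Truncating g as well turns the L1 approximation into an L2 one: both functions are bounded by B,
   so the square is at most 2 B times the distance. *)
have hg : int (fun x => (fB x - gB x) ^+ 2) <= e / 16.
  have B2 : 0 < 2 * B by rewrite mulr_gt0.
  rewrite ler_pdivlMr// mulrC in gfB.
  rewrite -RintegralZl// in gfB; apply: le_trans gfB.
  apply: Rintg_le; [exact: (sqintgB fBi gBi).2|exact: intgZ|].
  move=> x; rewrite -(real_normK (num_real _)) expr2 ler_pM//.
    rewrite (le_trans (ler_normB _ _))//.
    have := gBB x; have : `|fB x| <= B by exact: norm_clamp_le.
    lra.
  by have := clamp_contract (fB x) (g x) B0'; rewrite (clamp_id (norm_clamp_le _ B0')).
have e8B : 0 < e / 16 / B ^+ 2 by rewrite divr_gt0// exprn_gt0.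
have [m hm] := Rintg_sqr_bump_small e8B.
(* Vanishes at 0 and at 1, as [trig_weierstrass] asks for equal values there. *)
pose h x := gB x * (1 - bump m x).
have tb := trig_bump R m.
have ch : continuous h.
  move=> x; apply: cvgM; first exact: cgB.
  by apply: cvgB; [exact: cvg_cst|exact: trig_continuous tb x].
have bi : sqintg haar (fun x => gB x * bump m x).
  apply: (@sqintg_bounded _ _ _ _ _ B).
    apply: measurable_funM; first exact: gBi.1.
    exact: trig_measurable tb.
  by move=> x; rewrite normrM -[B]mulr1 ler_pM// ger0_norm ?bump_ge0// bump_le1.
have hh : int (fun x => (gB x * bump m x) ^+ 2) <= e / 16.
  have b2i : intg haar (fun x => bump m x ^+ 2) := (trig_sqintg tb).2.
  apply: le_trans (_ : int (fun x => B ^+ 2 * bump m x ^+ 2) <= _).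
    apply: Rintg_le; [exact: bi.2|exact: intgZ|move=> x].
    rewrite exprMn ler_wpM2r ?sqr_ge0//.
    by rewrite -(real_normK (num_real _)) ler_pXn2r ?nnegrE.
  by rewrite RintegralZl// mulrC -ler_pdivlMr ?exprn_gt0.
have hi : sqintg haar h.
  rewrite (_ : h = fun x => gB x - gB x * bump m x); first exact: sqintgB.
  by apply/funext => x; rewrite /h; ring.
(* The bound r <= 1 gives r^2 <= r <= e / 16. *)
pose r : R := Num.min 1 (e / 16).
have r0 : 0 < r by rewrite lt_min ltr01.
have [|w tw hw] := trig_weierstrass ch _ r0.
  rewrite /h /bump mulr0 mulr1 cos0 mulr_natl cos2pi.
  by rewrite (_ : (1 + 1) / 2 = 1 :> R) ?expr1n ?subrr ?mulr0//; field.
have wi := trig_sqintg tw.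
have hw2 : int (fun x => (h x - w x) ^+ 2) <= e / 16.
  rewrite -[leRHS](Rintg_cst haar); apply: Rintg_haar_le.
  - exact: (sqintgB hi wi).2.
  - exact: intg_cst.
  - move=> x /hw hwx; rewrite -(real_normK (num_real _)).
    apply: le_trans (_ : r <= _); last by rewrite ge_min lexx orbT.
    apply: le_trans (_ : r * 1 <= _); last by rewrite mulr1.
    rewrite expr2 ler_pM// (le_trans hwx)// ge_min lexx//.
exists w => //.
have d1 : sqintg haar (fun x => f x - fB x) by exact: sqintgB.
have d2 : sqintg haar (fun x => fB x - gB x) by exact: sqintgB.
have d3 : sqintg haar (fun x => h x - w x) by exact: sqintgB.
have -> : int (fun x => (f x - w x) ^+ 2) =
    int (fun x => (((f x - fB x) + (fB x - gB x)) +
      (gB x * bump m x + (h x - w x))) ^+ 2).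
  by apply: eq_Rintegral => x _; congr (_ ^+ 2); rewrite /h; ring.
apply: le_trans (Rintg_sqrD_le (sqintgD d1 d2) (sqintgD bi d3)) _.
have := Rintg_sqrD_le d1 d2; have := Rintg_sqrD_le bi d3.
have {}hB : int (fun x => (f x - fB x) ^+ 2) <= e / 16 := hB.
lra.
Qed.

Lemma trig_bounded_degree w : trig_in (fun=> True) w ->
  exists E, trig_in (fun m => (m <= E)%N) w.
Proof.
move=> [s [_ sw]]; exists (\max_(a <- s) a.1.2)%N; exists s; split => // a sa.
exact: (@leq_bigmax_seq _ s xpredT (fun a : R * nat * R => a.1.2) a sa).
Qed.

(** The segment of orders D < j <= E: a partial sum for D = 0, a piece of the tail otherwise. The
    phase - pi / 2 produces the sine. *)
Definition fourier_sum (a b : nat -> R) (D E : nat) (x : R) :=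
  \sum_(D.+1 <= j < E.+1) (a j * wave j 0 x + b j * wave j (- (pi / 2)) x).

Lemma trig_fourier_sum a b D E :
  trig_in (fun m => (0 < m <= E)%N) (fourier_sum a b D E).
Proof.
have : trig_in (fun m => (0 < m <= E)%N) (fun x => \sum_(D.+1 <= j < E.+1 | (0 < j <= E)%N)
    (a j * wave j 0 x + b j * wave j (- (pi / 2)) x)).
  by apply: trig_sum => j jE; apply: trigD; exact: trig_wave.
apply: eq_trig => x; rewrite /fourier_sum big_nat_cond [RHS]big_nat_cond.
apply: eq_bigl => j; rewrite ltnS; apply/andP/andP => -[] // /andP[Dj jE] _.
by rewrite Dj jE (leq_ltn_trans _ Dj).
Qed.

Lemma Rintg_mul_wave f m th : sqintg haar f -> (0 < m)%N ->
  int (fun x => f x * wave m th x) =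
  (fourier_cos f m * cos th - fourier_sin f m * sin th) / 2.
Proof.
move=> fi m0.
have wi (u : R) : sqintg haar (wave m u).
  by apply: (@sqintg_bounded _ _ _ _ _ 1); [exact: measurable_wave|exact: wave_le1].
have ci : intg haar (fun x => f x * cos (2 * pi * m%:R * x)).
  by have := sqintg_mul fi (wi 0); rewrite /wave; under eq_fun do rewrite addr0.
have si : intg haar (fun x => f x * sin (2 * pi * m%:R * x)).
  have := sqintg_mul fi (wi (- (pi / 2))).
  by rewrite /wave; under eq_fun do rewrite cosBpihalf.
transitivity (int (fun x => cos th * (f x * cos (2 * pi * m%:R * x)) -
    sin th * (f x * sin (2 * pi * m%:R * x)))).
  by apply: eq_Rintegral => x _; rewrite /wave cosD; ring.
rewrite RintegralB//; [|exact: intgZ..].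
by rewrite !RintegralZl// /fourier_cos /fourier_sin; field.
Qed.

Lemma Rintg_fourier_sum_mul_wave a b E m th : (0 < m <= E)%N ->
  int (fun x => fourier_sum a b 0 E x * wave m th x) =
  (a m * cos th - b m * sin th) / 2.
Proof.
move=> /andP[m0 mE].
have wi k (u v : R) : intg haar (fun x => wave k u x * wave m v x).
  apply: (@intg_bounded _ _ _ _ _ 1).
    by apply: measurable_funM; exact: measurable_wave.
  by move=> x; rewrite normrM -[leRHS]mulr1 ler_pM// wave_le1.
transitivity (int (fun x => \sum_(1 <= j < E.+1)
    (a j * (wave j 0 x * wave m th x) + b j * (wave j (- (pi / 2)) x * wave m th x)))).
  apply: eq_Rintegral => x _; rewrite mulr_suml; apply: eq_bigr => j _.
  by ring.
rewrite Rintg_sum; last by move=> j _; apply: intgD; exact: intgZ.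
rewrite (bigD1_seq m) ?iota_uniq ?mem_index_iota ?m0//= [X in _ + X]big1_seq; last first.
  move=> j /andP[jm]; rewrite mem_index_iota => /andP[j0 _].
  rewrite RintegralD//; [|exact: intgZ..].
  rewrite !RintegralZl//; [|exact: wi..].
  by rewrite !Rintg_waveM// (negbTE jm) !mul0r !mulr0 addr0.
rewrite RintegralD//; [|exact: intgZ..].
rewrite !RintegralZl//; [|exact: wi..].
rewrite !Rintg_waveM// eqxx sub0r cosN.
have -> : cos (- (pi / 2) - th) = - sin th.
  by rewrite -opprD cosN addrC cosDpihalf.
by rewrite addr0 /=; move: (cos th) (sin th) => u v; field.
Qed.

(** Pythagoras: f - S is orthogonal to every trigonometric polynomial of degree at most E, constants
    included because f has mean 0. *)
Lemma fourier_sum_best f E w : sqintg haar f -> int (fun x => f x) = 0 ->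
  trig_in (fun m => (m <= E)%N) w ->
  int (fun x => (f x - fourier_sum (fourier_cos f) (fourier_sin f) 0 E x) ^+ 2) <=
  int (fun x => (f x - w x) ^+ 2).
Proof.
move=> fi f0 tw; set S := fourier_sum _ _ _ _.
have tS : trig_in (fun m => (0 < m <= E)%N) S by exact: trig_fourier_sum.
have Si := trig_sqintg tS; have wi := trig_sqintg tw.
have ri : sqintg haar (fun x => f x - S x) by exact: sqintgB.
have tu : trig_in (fun m => (m <= E)%N) (fun x => S x - w x).
  by apply: trigB => //; apply: sub_trig tS => m /andP[].
have ui := trig_sqintg tu.
have orth : int (fun x => (f x - S x) * (S x - w x)) = 0.
  move: tu => [s [sE su]].
  have wvi k (v : R) : sqintg haar (wave k v).
    by apply: (@sqintg_bounded _ _ _ _ _ 1); [exact: measurable_wave|exact: wave_le1].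
  transitivity (int (fun x => \sum_(c <- s) c.1.1 * ((f x - S x) * wave c.1.2 c.2 x))).
    by apply: eq_Rintegral => x _; rewrite su mulr_sumr; apply: eq_bigr => c _; ring.
  rewrite Rintg_sum; last by move=> c _; apply: intgZ; exact: sqintg_mul.
  rewrite big_seq big1// => -[[c m] v] /sE /= mE.
  rewrite RintegralZl//; last exact: sqintg_mul.
  suff -> : int (fun x => (f x - S x) * wave m v x) = 0 by rewrite mulr0.
  transitivity (int (fun x => f x * wave m v x - S x * wave m v x)).
    by apply: eq_Rintegral => x _; rewrite mulrBl.
  rewrite RintegralB//; [|exact: sqintg_mul..].
  case: (posnP m) => [->|m0].
    transitivity (int (fun x => cos v * f x) - int (fun x => cos v * S x)).
      by congr (_ - _); apply: eq_Rintegral => x _; rewrite wave0 mulrC.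
    rewrite !RintegralZl//; [|exact: sqintg_intg..].
    by rewrite f0 (trig_mean0 tS) ?mulr0 ?subr0// => k /andP[].
  by rewrite Rintg_mul_wave// Rintg_fourier_sum_mul_wave ?m0// subrr.
have -> : int (fun x => (f x - w x) ^+ 2) = int (fun x => (f x - S x) ^+ 2 +
    (2 * ((f x - S x) * (S x - w x)) + (S x - w x) ^+ 2)).
  by apply: eq_Rintegral => x _; ring.
have ci := sqintg_mul ri ui.
rewrite RintegralD//; [|exact: ri.2|by apply: intgD; [exact: intgZ|exact: ui.2]].
rewrite RintegralD//; [|exact: intgZ|exact: ui.2].
by rewrite RintegralZl// orth mulr0 add0r lerDl Rintg_sqr_ge0.
Qed.

Lemma fourier_sum_cvg f (e : R) : sqintg haar f -> int (fun x => f x) = 0 -> 0 < e ->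
  exists E0, forall E, (E0 <= E)%N ->
    int (fun x => (f x - fourier_sum (fourier_cos f) (fourier_sin f) 0 E x) ^+ 2) <= e.
Proof.
move=> fi f0 e0; have [w tw we] := trig_dense fi e0.
have [E0 tE0] := trig_bounded_degree tw; exists E0 => E EE.
apply: le_trans we; apply: fourier_sum_best => //.
by apply: sub_trig tE0 => m /leq_trans; exact.
Qed.

End trigonometric_density.

(** * Product approximation of characteristic functions *)

Section complex_product.
Context (R : realType).
Implicit Types (y : nat -> R) (phi : R) (k : nat).

Lemma expRN_le (u : R) : 0 <= u -> expR (- u) <= 1 - u + u ^+ 2.
Proof.
move=> u0; have u1 : 0 < 1 + u by rewrite ltr_pwDl.
rewrite -(ler_pM2r u1); apply: le_trans (_ : expR (- u) * expR u <= _).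
  by rewrite ler_wpM2l ?expR_ge0// expR_ge1Dx.
rewrite -expRD addNr expR0.
rewrite [leRHS](_ : _ = 1 + u ^+ 3); last by ring.
by rewrite lerDl exprn_ge0.
Qed.

(** Real and imaginary parts of exp (i y) - (1 + i y) exp (- y^2 / 2), whose Taylor expansion starts
    at order 3. The four partial errors add up to 23/24 of |y|^3. *)
Lemma cos_sub_gauss (y : R) : `|y| <= 1 ->
  `|cos y - expR (- (y ^+ 2 / 2))| + `|sin y - y * expR (- (y ^+ 2 / 2))| <= `|y| ^+ 3.
Proof.
move=> y1; set u := y ^+ 2 / 2; set a : R := `|y|; have a0 : 0 <= a := normr_ge0 y.
have a1 : a <= 1 := y1.
have y2 : y ^+ 2 = a ^+ 2 by rewrite real_normK// num_real.
have u0 : 0 <= u by rewrite divr_ge0// sqr_ge0.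
have e1 := expR_ge1Dx (- u); have e2 := expRN_le u0.
have eu : `|1 - u - expR (- u)| <= a ^+ 3 / 4.
  rewrite ler0_norm; last lra.
  have : u ^+ 2 = a ^+ 4 / 4 by rewrite /u y2; field.
  have : a ^+ 4 <= a ^+ 3 by rewrite exprS ler_piMl// exprn_ge0.
  lra.
have h1 : `|cos y - (1 - u)| <= a ^+ 3 / 24.
  (* Half-angle formula, factored as a difference of squares so that the cubic bound for the sine
     applies. *)
  have -> : cos y - (1 - u) = 2 * ((y / 2 - sin (y / 2)) * (y / 2 + sin (y / 2))).
    rewrite [in LHS](_ : y = (y / 2) *+ 2); last by rewrite -mulr_natr; field.
    by rewrite cos_mulr2n cos2sin2 /u -mulr_natr; field.
  rewrite normrM normrM ger0_norm//.
  have s3 := norm_sin_sub_le (y / 2); rewrite distrC in s3.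
  have a2 : `|y / 2| = a / 2 by rewrite normrM [`|2^-1|]ger0_norm.
  have sa : `|y / 2 + sin (y / 2)| <= a.
    by rewrite (le_trans (ler_normD _ _))//; have := norm_sin_le (y / 2); lra.
  have ya : `|y / 2| ^+ 3 / 6 = a ^+ 3 / 48 by rewrite a2; field.
  rewrite ya in s3.
  apply: le_trans (_ : 2 * (a ^+ 3 / 48 * 1) <= _); last lra.
  rewrite ler_pM2l//; apply: ler_pM => //; lra.
have h2 : `|cos y - expR (- u)| <= a ^+ 3 / 24 + a ^+ 3 / 4.
  rewrite (_ : cos y - _ = (cos y - (1 - u)) + (1 - u - expR (- u))); last by ring.
  by rewrite (le_trans (ler_normD _ _))// lerD.
have h3 : `|sin y - y * expR (- u)| <= a ^+ 3 / 6 + a ^+ 3 / 2.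
  rewrite (_ : sin y - _ = (sin y - y) + y * (1 - expR (- u))); last by ring.
  rewrite (le_trans (ler_normD _ _))// lerD ?norm_sin_sub_le// normrM -/a.
  have -> : a ^+ 3 / 2 = a * u by rewrite /u y2; field.
  rewrite ler_wpM2l// ger0_norm; first lra.
  by rewrite subr_ge0 -expR0 ler_expR oppr_le0.
have : 0 <= a ^+ 3 by rewrite exprn_ge0.
lra.
Qed.

(* Real and imaginary parts of [\prod_(b < k) (1 + 'i * y b)]. *)
Fixpoint cprod y k : R * R :=
  if k is k'.+1 then
    ((cprod y k').1 - y k' * (cprod y k').2, (cprod y k').2 + y k' * (cprod y k').1)
  else (1, 0).

(** Each factor contributes |1 + i y|^2 = 1 + y^2 <= exp (y^2). *)
Lemma cprod_norm_le y k :
  (cprod y k).1 ^+ 2 + (cprod y k).2 ^+ 2 <= expR (\sum_(b < k) y b ^+ 2).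
Proof.
elim: k => [|k IH]; first by rewrite big_ord0 expR0 /= expr0n expr1n addr0.
rewrite big_ord_recr /= expRD.
rewrite [leLHS](_ : _ = ((cprod y k).1 ^+ 2 + (cprod y k).2 ^+ 2) * (1 + y k ^+ 2)); last by ring.
apply: ler_pM => //; last exact: expR_ge1Dx.
  by rewrite addr_ge0 ?sqr_ge0.
by rewrite addr_ge0 ?sqr_ge0.
Qed.

(** Multiplying A + i B by exp (i phi) preserves the modulus; the two expressions are the real part
    and minus the imaginary part of the product. *)
Lemma norm_rotation_le (A B phi q : R) : A ^+ 2 + B ^+ 2 <= expR q ->
  `|cos phi * A - sin phi * B| <= expR (q / 2) /\
  `|- sin phi * A - cos phi * B| <= expR (q / 2).
Proof.
move=> AB; have E : expR q = expR (q / 2) ^+ 2.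
  by rewrite -expRM_natl; congr expR; field.
have cs := cos2Dsin2 phi.
have sum : (cos phi * A - sin phi * B) ^+ 2 + (- sin phi * A - cos phi * B) ^+ 2 =
    A ^+ 2 + B ^+ 2.
  rewrite -[RHS]mul1r -cs; ring.
have p0 := expR_gt0 (q / 2).
by split; rewrite -(ler_pXn2r (n := 2)) ?nnegrE ?(ltW p0)// real_normK ?num_real// -E;
  apply: le_trans AB; rewrite -sum ?lerDl ?lerDr sqr_ge0.
Qed.

(* Replaces [expR (i y)] by [(1 + i y) expR (- y^2 / 2)] one factor at a time;
   the partial products have modulus at most 1 by [cprod_norm_le], so the errors
   simply add up. *)
Lemma cos_sum_cprod y k phi : (forall b, (b < k)%N -> `|y b| <= 1) ->
  `|cos (phi + \sum_(b < k) y b) - expR (- ((\sum_(b < k) y b ^+ 2) / 2)) *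
     (cos phi * (cprod y k).1 - sin phi * (cprod y k).2)| <= \sum_(b < k) `|y b| ^+ 3.
Proof.
elim: k phi => [|k IH] phi y1.
  rewrite !big_ord0 addr0 mul0r oppr0 expR0 /= mulr0 subr0 mulr1 mul1r subrr.
  by rewrite normr0.
rewrite !big_ord_recr /=; set s := \sum_(b < k) y b; set q := \sum_(b < k) y b ^+ 2.
set A := (cprod y k).1; set B := (cprod y k).2.
(* The last summand moves into the phase, which is why the induction ranges over all phi; what
   remains is to exchange the single factor exp (i y k). *)
have {}IH := IH (phi + y k) (fun b bk => y1 b (ltnW bk)).
rewrite -/s -/q -/A -/B in IH.
have [h1 h2] := norm_rotation_le phi (cprod_norm_le y k).
rewrite -/A -/B -/q in h1 h2.
set e := expR (- (y k ^+ 2 / 2)).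
have -> : expR (- ((q + y k ^+ 2) / 2)) = expR (- (q / 2)) * e.
  by rewrite -expRD; congr expR; field.
have -> : cos (phi + (s + y k)) - expR (- (q / 2)) * e *
    (cos phi * (A - y k * B) - sin phi * (B + y k * A)) =
  (cos (phi + y k + s) - expR (- (q / 2)) *
    (cos (phi + y k) * A - sin (phi + y k) * B)) +
  expR (- (q / 2)) * ((cos (y k) - e) * (cos phi * A - sin phi * B) +
    (sin (y k) - y k * e) * (- sin phi * A - cos phi * B)).
  rewrite [phi + (s + y k)](_ : _ = phi + y k + s); last by ring.
  by rewrite (cosD phi) (sinD phi); ring.
apply: le_trans (ler_normD _ _) _; apply: lerD => //.
rewrite normrM ger0_norm ?expR_ge0//.
apply: le_trans (_ : expR (- (q / 2)) * (`|y k| ^+ 3 * expR (q / 2)) <= _); last first.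
  by rewrite mulrCA -expRD addNr expR0 mulr1.
rewrite ler_wpM2l ?expR_ge0// (le_trans (ler_normD _ _))// !normrM.
apply: le_trans (_ : (`|cos (y k) - e| + `|sin (y k) - y k * e|) * expR (q / 2) <= _).
  by rewrite mulrDl lerD// ler_wpM2l.
by rewrite ler_wpM2r ?expR_ge0// cos_sub_gauss// y1.
Qed.

Lemma expRN_lipschitz (a b : R) : 0 <= a -> 0 <= b ->
  `|expR (- a) - expR (- b)| <= `|a - b|.
Proof.
wlog ab : a b / a <= b => [H a0 b0|a0 _].
  have [/H|/ltW/H] := leP a b; first exact.
  by rewrite distrC (distrC a); exact.
rewrite ger0_norm ?subr_ge0 ?ler_expR ?lerN2// ler0_norm ?subr_le0// opprB.
have -> : expR (- b) = expR (- a) * expR (- (b - a)).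
  by rewrite -expRD; congr expR; ring.
have := expR_ge1Dx (- (b - a)).
have : expR (- a) <= 1 by rewrite -expR0 ler_expR oppr_le0.
have := expR_gt0 (- a); nra.
Qed.

End complex_product.

Section multiplicative_orthogonality.
Context (R : realType) d (T : measurableType d) (P : probability T R).

(** Two errors: the Taylor errors |Y_b|^3 add up to at most y Q, and replacing the random exponent V
    / 2 by the constant v / 2 costs |V - v| times the bound exp (Q / 2) on the product. With v
    constant, the means 1 and 0 of the product leave cos phi. *)
Lemma Rintg_cos_sum (Y : nat -> T -> R) (K : nat) (phi y Q v : R) :
  (forall b, (b < K)%N -> measurable_fun setT (Y b)) ->
  (forall b x, (b < K)%N -> `|Y b x| <= y) -> 0 <= y <= 1 ->
  (forall x, \sum_(b < K) Y b x ^+ 2 <= Q) -> 0 <= v ->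
  intg P (fun x => (cprod (Y ^~ x) K).1) ->
  intg P (fun x => (cprod (Y ^~ x) K).2) ->
  \int[P]_x (cprod (Y ^~ x) K).1 = 1 ->
  \int[P]_x (cprod (Y ^~ x) K).2 = 0 ->
  `|\int[P]_x cos (phi + \sum_(b < K) Y b x) - expR (- (v / 2)) * cos phi| <=
  y * Q + expR (Q / 2) * \int[P]_x `|\sum_(b < K) Y b x ^+ 2 - v|.
Proof.
move=> mY Yy /andP[y0 y1] YQ v0 iA iB EA EB.
have mV : measurable_fun setT (fun x => \sum_(b < K) Y b x ^+ 2).
  by apply: measurable_sum => b; apply: measurable_funX; exact: mY.
have mS : measurable_fun setT (fun x => \sum_(b < K) Y b x).
  by apply: measurable_sum => b; exact: mY.
have iV : intg P (fun x => `|\sum_(b < K) Y b x ^+ 2 - v|).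
  apply: intg_abs; apply: intgB; last exact: intg_cst.
  apply: (@intg_bounded _ _ _ _ _ Q) => // x.
  by rewrite ger0_norm// sumr_ge0// => b _; exact: sqr_ge0.
have ic : intg P (fun x => cos (phi + \sum_(b < K) Y b x)).
  apply: (@intg_bounded _ _ _ _ _ 1) => [|x]; last exact: cos_max.
  apply: (measurableT_comp (f := cos)).
    exact: continuous_measurable_fun (@continuous_cos R).
  exact: measurable_funD.
set g := fun x => cos phi * (cprod (Y ^~ x) K).1 - sin phi * (cprod (Y ^~ x) K).2.
have ig : intg P g by apply: intgB; exact: intgZ.
have Eg : \int[P]_x g x = cos phi.
  rewrite RintegralB//; [|exact: intgZ..].
  by rewrite !RintegralZl// EA EB mulr1 mulr0 subr0.
rewrite -Eg -RintegralZl// -RintegralB//; last exact: intgZ.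
rewrite -RintegralZl// -{1}(Rintg_cst P (y * Q)) -RintegralD//; last 2 first.
- exact: intg_cst.
- exact: intgZ.
apply: Rintg_norm_le.
- by apply: intgB => //; exact: intgZ.
- by apply: intgD; [exact: intg_cst|exact: intgZ].
move=> x; set V := \sum_(b < K) Y b x ^+ 2.
have V0 : 0 <= V by rewrite sumr_ge0// => b _; exact: sqr_ge0.
rewrite (_ : _ - _ = (cos (phi + \sum_(b < K) Y b x) - expR (- (V / 2)) * g x) +
    (expR (- (V / 2)) - expR (- (v / 2))) * g x); last by ring.
apply: le_trans (ler_normD _ _) _; apply: lerD.
  apply: le_trans (cos_sum_cprod _ _) _.
    by move=> b bK; rewrite (le_trans (Yy _ _ bK)).
  apply: le_trans (_ : y * V <= _); last by rewrite ler_wpM2l ?YQ.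
  rewrite /V mulr_sumr; apply: ler_sum => b _.
  by rewrite exprS real_normK ?num_real// ler_wpM2r ?sqr_ge0// Yy.
rewrite normrM mulrC; apply: ler_pM => //.
  apply: le_trans (norm_rotation_le phi (cprod_norm_le (Y ^~ x) K)).1 _.
  by rewrite ler_expR ler_pM2r ?YQ// invr_gt0.
apply: le_trans (expRN_lipschitz _ _) _; rewrite ?divr_ge0//.
rewrite -mulrBl normrM [`|2^-1|]ger0_norm// ler_piMr// invf_le1//; lra.
Qed.

End multiplicative_orthogonality.

(** * Sums over separated blocks of frequencies *)

Section block_sums.
Context (R : realType) (I : Type) (r : seq I) (P : pred I).
Variables w th : I -> R.
Local Notation int f := (Rintegral (@haar R) setT f).

(** Only pairs of equal frequency survive integration, so i meets a total weight of at most L. *)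
Lemma wave_variance_le (m : I -> nat) (L : R) :
  (forall i, P i -> (0 < m i)%N) ->
  (forall k, (0 < k)%N -> \sum_(i <- r | P i && (m i == k)) `|w i| <= L) ->
  int (fun x => (\sum_(i <- r | P i) w i * wave (m i) (th i) x) ^+ 2) <=
  (\sum_(i <- r | P i) `|w i|) * L.
Proof.
move=> m0 mL.
have wi k (u : R) : sqintg haar (wave k u).
  by apply: (@sqintg_bounded _ _ _ _ _ 1); [exact: measurable_wave|exact: wave_le1].
rewrite Rintg_sqr_sum; last by move=> i _; exact: sqintgZ.
rewrite mulr_suml; apply: ler_sum => i Pi.
apply: le_trans (ler_wpM2l (normr_ge0 (w i)) (mL _ (m0 _ Pi))).
rewrite mulr_sumr big_mkcondr/=; apply: ler_sum => j Pj.
rewrite [X in X <= _](_ : _ = w i * w j *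
    int (fun x => wave (m i) (th i) x * wave (m j) (th j) x)); last first.
  rewrite -RintegralZl//; last exact: sqintg_mul.
  by apply: eq_Rintegral => x _; ring.
rewrite Rintg_waveM ?m0// eq_sym; case: eqVneq => _; last by rewrite !mul0r mulr0.
apply: le_trans (ler_norm _) _; rewrite normrM [`|w i * w j|]normrM.
rewrite ler_piMr ?mulr_ge0//= mul1r normrM ger0_norm ?invr_ge0//.
by have := cos_max (th i - th j); lra.
Qed.

End block_sums.

Section multiplicative_blocks.
Context (R : realType) (I : Type) (r : seq I) (P : pred I).
(** An index i abstracts a harmonic j of a dilation n_k: [nu i] plays the part of n_k, [mu i] that
    of the frequency j n_k, and [beta i] is the number of the block containing k. *)
Variables (w th : I -> R) (mu nu beta : I -> nat) (D K : nat).
Local Notation int f := (Rintegral (@haar R) setT f).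
Hypothesis nu_gt0 : forall i, P i -> (0 < nu i)%N.
Hypothesis nu_mu : forall i, P i -> (nu i <= mu i <= D * nu i)%N.
Hypothesis beta_lt : forall i, P i -> (beta i < K)%N.
Hypothesis nu_sep : forall i j, P i -> P j -> (beta i < beta j)%N ->
  (D.+1 * nu i <= nu j)%N.

Let term i (x : R) := w i * wave (mu i) (th i) x.
Let Y b x := \sum_(i <- r | P i && (beta i == b)) term i x.
Let W b := \sum_(i <- r | P i && (beta i == b)) `|w i|.
Let dist i j := (mu i - mu j + (mu j - mu i))%N.
Let mu_gt0 i : P i -> (0 < mu i)%N.
Proof. by move=> Pi; have /andP[+ _] := nu_mu Pi; exact/leq_trans/nu_gt0. Qed.

Let sum_blocks (G : nat -> I -> R) :
  \sum_(b < K) \sum_(i <- r | P i && (beta i == b)) G b i =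
  \sum_(i <- r | P i) G (beta i) i.
Proof.
under eq_bigr do rewrite big_mkcondr.
rewrite exchange_big/=; apply: eq_bigr => i Pi.
rewrite (bigD1 (Ordinal (beta_lt Pi)))//= eqxx big1 ?addr0// => b bi.
case: eqP => // bE; case/eqP: bi; exact/val_inj/esym.
Qed.

Let sum_block_sqr (G : I -> R) :
  \sum_(b < K) (\sum_(i <- r | P i && (beta i == b)) G i) ^+ 2 =
  \sum_(i <- r | P i) \sum_(j <- r | P j && (beta j == beta i)) G i * G j.
Proof.
rewrite -(sum_blocks (fun b i => \sum_(j <- r | P j && (beta j == b)) G i * G j)).
apply: eq_bigr => b _; rewrite expr2 mulr_suml; apply: eq_bigr => i _.
by rewrite mulr_sumr.
Qed.

Let trig_Y b : trig_in (fun m => exists i, [/\ P i, beta i = b & m = mu i]) (Y b).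
Proof.
by apply: trig_sum => i /andP[Pi /eqP bi]; apply: trig_wave; exists i.
Qed.

(* The frequencies of [cprod] over the first [k] blocks are positive and below
   all the [nu i] of later blocks, so multiplying by the next block never
   creates the frequency 0, and the mean of [cprod] remains 1. *)
Let spec k (m : nat) := (0 < m)%N /\ forall i, P i -> (k <= beta i)%N -> (m < nu i)%N.

Let spec_mu i k : P i -> (beta i < k)%N -> spec k (mu i).
Proof.
move=> Pi ik; split=> [|j Pj kj]; first exact: mu_gt0.
have /andP[_ h] := nu_mu Pi; apply: leq_ltn_trans h _.
apply: leq_trans (nu_sep Pi Pj (leq_trans ik kj)).
by rewrite ltn_pmul2r ?nu_gt0.
Qed.

(** The constant 1 is split off because [spec] excludes the frequency 0; what is left has mean 0. *)
Let trig_cprod k :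
  trig_in (spec k) (fun x => (cprod (Y ^~ x) k).1 - 1) /\
  trig_in (spec k) (fun x => (cprod (Y ^~ x) k).2).
Proof.
elim: k => [|k [IH1 IH2]].
  split; last exact: trig0.
  by apply: eq_trig (trig0 _ _) => x /=; rewrite subrr.
have specS m : spec k m -> spec k.+1 m.
  by move=> [m0 mk]; split => // i Pi ki; apply: mk => //; exact: ltnW.
have YS : trig_in (spec k.+1) (Y k).
  by apply: sub_trig (trig_Y k) => m [i [Pi bi ->]]; apply: spec_mu; rewrite ?bi.
have YM g : trig_in (spec k) g -> trig_in (spec k.+1) (fun x => Y k x * g x).
  move=> tg; apply: trigM (trig_Y k) tg _ => _ b [i [Pi bi ->]] [b0 bk].
  have bi' : (b < mu i)%N.
    have /andP[h _] := nu_mu Pi; apply: leq_trans h; apply: bk => //.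
    by rewrite bi.
  (* Here [mu i] is at most D times [nu i], and b is below [nu i]; hence the factor D + 1 in the
     separation of blocks. *)
  have mub j : P j -> (k < beta j)%N -> (mu i + b < nu j)%N.
    move=> Pj kj; have bj : (b < nu i)%N by apply: bk; rewrite ?bi.
    have /andP[_ h] := nu_mu Pi.
    have := nu_sep Pi Pj; rewrite bi => /(_ kj); rewrite mulSn; lia.
  split; split; [lia| |lia|].
    by move=> j Pj kj; exact: mub.
  by move=> j Pj kj; have := mub j Pj kj; lia.
split.
  have : trig_in (spec k.+1) (fun x => ((cprod (Y ^~ x) k).1 - 1) -
      Y k x * (cprod (Y ^~ x) k).2).
    by apply: trigB; [exact: sub_trig IH1|exact: YM].
  by apply: eq_trig => x /=; ring.
have : trig_in (spec k.+1) (fun x => (cprod (Y ^~ x) k).2 +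
    (Y k x + Y k x * ((cprod (Y ^~ x) k).1 - 1))).
  by apply: trigD; [exact: sub_trig IH2|apply: trigD; [|exact: YM]].
by apply: eq_trig => x /=; ring.
Qed.

Let V x := \sum_(b < K) Y b x ^+ 2.
Let S x := \sum_(i <- r | P i) term i x.

Let S_blocks x : S x = \sum_(b < K) Y b x.
Proof. by rewrite /Y (sum_blocks (fun _ i => term i x)). Qed.

Let Y_sqintg b : sqintg haar (Y b).
Proof. exact: trig_sqintg (trig_Y b). Qed.

(** Different blocks have disjoint frequencies and are orthogonal. The constant around which V
    concentrates is thus the exact variance of S. *)
Let variance_blocks : int (fun x => S x ^+ 2) = int V.
Proof.
transitivity (int (fun x => (\sum_(b < K) Y b x) ^+ 2)).
  by apply: eq_Rintegral => x _; rewrite S_blocks.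
rewrite Rintg_sqr_sum// /V Rintg_sum; last by move=> b _; exact: (Y_sqintg b).2.
apply: eq_bigr => b _; rewrite (bigD1 b)//= big1 ?addr0// => b' bb'.
have ort (c c' : nat) : (c < c')%N -> int (fun x => Y c x * Y c' x) = 0.
  move=> cc'; have : trig_in (fun m => (0 < m)%N) (fun x => Y c x * Y c' x).
    apply: trigM (trig_Y c) (trig_Y c') _ => _ _ [i [Pi bi ->]] [j [Pj bj ->]].
    have [_ /(_ j Pj)] : spec c.+1 (mu i) by apply: spec_mu; rewrite ?bi.
    rewrite bj => /(_ cc') h; have := mu_gt0 Pi; have /andP[hj _] := nu_mu Pj.
    by lia.
  by move=> /trig_mean0; apply.
have [cc'|cc'|E] := ltngtP b b'; first exact: ort.
  by rewrite -[RHS](ort _ _ cc'); apply: eq_Rintegral => x _; rewrite mulrC.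
by case/eqP: bb'; exact/val_inj.
Qed.

Variables (y Q L : R).
Hypothesis y01 : 0 <= y <= 1.
Hypothesis W_le : forall b, W b <= y.
Hypothesis Q_le : \sum_(b < K) W b ^+ 2 <= Q.
Hypothesis L_le : forall k, (0 < k)%N ->
  \sum_(i <- r | P i) \sum_(j <- r | P j && (beta j == beta i) && (dist i j == k))
     `|w i| * `|w j| <= L.

Let Y_le b x : `|Y b x| <= W b.
Proof.
apply: le_trans (ler_norm_sum _ _ _) _; apply: ler_sum => i _.
by rewrite normrM ler_piMr// wave_le1.
Qed.

Let W_ge0 b : 0 <= W b. Proof. by apply: sumr_ge0. Qed.

Let V_le x : V x <= Q.
Proof.
apply: le_trans Q_le; apply: ler_sum => b _.
by rewrite -(real_normK (num_real _)) ler_pXn2r ?nnegrE.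
Qed.

(** V is a sum of squares of block sums, so its expansion runs over pairs of indices from a common
    block; the factor 1/2 in [w2] below comes from [waveM]. *)
Let r2 := [seq (i, j) | i <- r, j <- r].
Let P2 (p : I * I) := [&& P p.1, P p.2 & beta p.2 == beta p.1].

Let sum_pairs (X : pred (I * I)) (F : I * I -> R) :
  \sum_(p <- r2 | P2 p && X p) F p =
  \sum_(i <- r | P i) \sum_(j <- r | P j && (beta j == beta i) && X (i, j)) F (i, j).
Proof.
rewrite big_mkcond big_allpairs_dep [RHS]big_mkcond; apply: eq_bigr => i _.
rewrite /P2/=; case: (P i) => /=; last by rewrite big1.
by rewrite [RHS]big_mkcond.
Qed.

Let w2 (p : I * I) := 2^-1 * (w p.1 * w p.2).

Let sum_w2 : \sum_(p <- r2 | P2 p) `|w2 p| <= Q / 2.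
Proof.
have -> : \sum_(p <- r2 | P2 p) `|w2 p| = \sum_(p <- r2 | P2 p && true) `|w2 p|.
  by apply: eq_bigl => p; rewrite andbT.
rewrite sum_pairs.
apply: le_trans (_ : 2^-1 * \sum_(b < K) W b ^+ 2 <= _); last first.
  by rewrite mulrC ler_pM2r.
rewrite /W sum_block_sqr mulr_sumr; apply: ler_sum => i _.
rewrite mulr_sumr; under eq_bigl do rewrite andbT.
by apply: ler_sum => j _; rewrite /w2 !normrM ger0_norm.
Qed.

(* By separation, [k] determines the block from which [mu p.1 + mu p.2 = k]
   comes, so no Diophantine condition is needed for sums of frequencies. *)
Let plus_le k : (0 < k)%N ->
  \sum_(p <- r2 | P2 p && (mu p.1 + mu p.2 == k)%N) `|w2 p| <= y ^+ 2 / 2.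
Proof.
move=> k0.
have y2 : 0 <= y ^+ 2 / 2 by rewrite divr_ge0 ?sqr_ge0.
have [[p0 /andP[Pp0 /eqP p0k]]|nop] :=
    pselect (exists p, P2 p && (mu p.1 + mu p.2 == k)%N); last first.
  rewrite big_pred0// => p; apply/negP => h; apply: nop; by exists p.
have nolt p q : P2 p -> P2 q -> (beta p.1 < beta q.1)%N ->
    (mu p.1 + mu p.2 < mu q.1 + mu q.2)%N.
  move=> /and3P[p1 p2 /eqP p12] /and3P[q1 q2 /eqP q12] pq.
  have := nu_sep p1 q1 pq; have := nu_sep p2 q2; rewrite p12 q12 => /(_ pq).
  have /andP[_ h1] := nu_mu p1; have /andP[_ h2] := nu_mu p2.
  have /andP[h3 _] := nu_mu q1; have /andP[h4 _] := nu_mu q2.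
  have n1 := nu_gt0 p1; rewrite !mulSn; lia.
set b0 := beta p0.1.
apply: le_trans (_ : \sum_(p <- r2 | P2 p && (beta p.1 == b0)) `|w2 p| <= _).
  rewrite big_mkcondr [leRHS]big_mkcondr/=; apply: ler_sum => p Pp.
  case: eqP => [pk|_]; last by case: ifP.
  have [] := ltngtP (beta p.1) b0 => //.
    by move=> /(nolt _ _ Pp Pp0); rewrite pk p0k ltnn.
  by move=> /(nolt _ _ Pp0 Pp); rewrite pk p0k ltnn.
rewrite (sum_pairs (fun p => beta p.1 == b0))/=.
apply: le_trans (_ : 2^-1 * (W b0 ^+ 2) <= _); last first.
  by rewrite mulrC ler_pM2r// ler_pXn2r ?nnegrE//; have /andP[] := y01.
rewrite expr2 {1}/W mulr_suml mulr_sumr [leRHS]big_mkcondr/=.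
apply: ler_sum => i Pi; case: eqP => [bi|bi]; last first.
  by rewrite big_pred0// => j; rewrite andbF.
rewrite /W !mulr_sumr; rewrite bi; under eq_bigl do rewrite andbT.
by apply: ler_sum => j _; rewrite /w2 !normrM ger0_norm.
Qed.

Let U1 x := \sum_(p <- r2 | P2 p)
  w2 p * wave (mu p.1 + mu p.2) (th p.1 + th p.2) x.
Let phase (p : I * I) :=
  if (mu p.2 <= mu p.1)%N then th p.1 - th p.2 else th p.2 - th p.1.
Let U2 x := \sum_(p <- r2 | P2 p && (dist p.1 p.2 != 0)%N)
  w2 p * wave (dist p.1 p.2) (phase p) x.

(** Pairs of equal frequency produce the constant, which is then the mean of V, since [U1] (sums of
    frequencies) and [U2] (non-zero differences) have mean 0. *)
Let V_decomp : exists c0 : R, forall x, V x = c0 + (U1 x + U2 x).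
Proof.
exists (\sum_(p <- r2 | P2 p && (dist p.1 p.2 == 0)%N) w2 p * cos (phase p)) => x.
rewrite /V /Y sum_block_sqr.
have := sum_pairs xpredT (fun p => term p.1 x * term p.2 x).
under eq_bigl do rewrite andbT.
have -> : \sum_(i <- r | P i) \sum_(j <- r | P j && (beta j == beta i) && xpredT (i, j))
    term (i, j).1 x * term (i, j).2 x =
  \sum_(i <- r | P i) \sum_(j <- r | P j && (beta j == beta i)) term i x * term j x.
  by apply: eq_bigr => i _; apply: eq_bigl => j; rewrite andbT.
move=> <-.
rewrite /U1 /U2 [X in X + _]big_mkcondr [X in _ + (_ + X)]big_mkcondr/=.
rewrite -!big_split/=; apply: eq_bigr => p _.
rewrite /term mulrACA waveM -/(dist p.1 p.2) -/(phase p) /w2.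
case: eqP => [->|_]; last by rewrite /=; ring.
by rewrite /= wave0; ring.
Qed.

Let tU1 : trig_in (fun m => (0 < m)%N) U1.
Proof.
apply: trig_sum => p /and3P[p1 _ _]; apply: trig_wave.
by rewrite addn_gt0 mu_gt0.
Qed.

Let tU2 : trig_in (fun m => (0 < m)%N) U2.
Proof. by apply: trig_sum => p /andP[_ p0]; apply: trig_wave; rewrite lt0n. Qed.

Let variance_V :
  int (fun x => (V x - int V) ^+ 2) <= Q * (y ^+ 2 + L).
Proof.
have [c0 VE] := V_decomp.
have i1 := trig_sqintg tU1; have i2 := trig_sqintg tU2.
have -> : int V = c0.
  transitivity (int (fun x => c0 + (U1 x + U2 x))).
    by apply: eq_Rintegral => x _; exact: VE.
  have j1 := sqintg_intg i1; have j2 := sqintg_intg i2.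
  rewrite RintegralD//; [|exact: intg_cst|exact: intgD].
  rewrite RintegralD// Rintg_cst (trig_mean0 tU1)// (trig_mean0 tU2)//.
  by rewrite !addr0.
rewrite (_ : int _ = int (fun x => (U1 x + U2 x) ^+ 2)); last first.
  by apply: eq_Rintegral => x _; rewrite (VE x) addrC addKr.
apply: le_trans (Rintg_sqrD_le i1 i2) _.
have Q0 : 0 <= Q by apply: le_trans Q_le; apply: sumr_ge0 => b _; exact: sqr_ge0.
have L0 : 0 <= L.
  apply: le_trans (@L_le 1 isT); apply: sumr_ge0 => i _; apply: sumr_ge0 => j _.
  exact: mulr_ge0.
have h1 : int (fun x => U1 x ^+ 2) <= Q / 2 * (y ^+ 2 / 2).
  apply: le_trans (@wave_variance_le R _ r2 P2 w2 (fun p => th p.1 + th p.2)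
    (fun p => mu p.1 + mu p.2)%N (y ^+ 2 / 2) _ _) _.
  - by move=> p /and3P[p1 _ _]; rewrite addn_gt0 mu_gt0.
  - exact: plus_le.
  - by rewrite ler_wpM2r ?divr_ge0 ?sqr_ge0.
have h2 : int (fun x => U2 x ^+ 2) <= Q / 2 * (L / 2).
  apply: le_trans (@wave_variance_le R _ r2 (fun p => P2 p && (dist p.1 p.2 != 0)%N)
    w2 phase (fun p => dist p.1 p.2) (L / 2) _ _) _.
  - by move=> p /andP[_ p0]; rewrite lt0n.
  - move=> k k0; apply: le_trans (_ : 2^-1 * L <= _); last by rewrite mulrC.
    apply: le_trans (ler_wpM2l _ (L_le k0)); last by rewrite invr_ge0.
    have E p : P2 p && (dist p.1 p.2 != 0)%N && (dist p.1 p.2 == k) =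
        P2 p && (dist p.1 p.2 == k).
      case: (P2 p) => //=; case: (dist p.1 p.2 =P k) => [->|]; rewrite ?andbF//.
      by rewrite andbT -lt0n.
    rewrite (eq_bigl _ _ E) (sum_pairs (fun p => dist p.1 p.2 == k)) mulr_sumr.
    apply: ler_sum => i _; rewrite mulr_sumr; apply: ler_sum => j _.
    by rewrite /w2 !normrM ger0_norm.
  - rewrite ler_wpM2r ?divr_ge0//; apply: le_trans sum_w2.
    rewrite big_mkcondr/=; apply: ler_sum => p _; by case: ifP.
move: h1 h2; have : 0 <= Q * y ^+ 2 by rewrite mulr_ge0 ?sqr_ge0.
have : 0 <= Q * L by rewrite mulr_ge0.
lra.
Qed.

(** The parameter eta is that of [Rintg_abs_le], which turns the variance bound for V into a bound
    for its mean absolute deviation. *)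
Lemma blocks_charfun (phi eta : R) : 0 < eta ->
  `|int (fun x => cos (phi + S x)) - expR (- (int (fun x => S x ^+ 2) / 2)) * cos phi| <=
  y * Q + expR (Q / 2) * (eta + eta^-1 * (Q * (y ^+ 2 + L))).
Proof.
move=> eta0; have [t1 t2] := trig_cprod K.
have V0 x : 0 <= V x by apply: sumr_ge0 => b _; exact: sqr_ge0.
have mY b : measurable_fun setT (Y b) := (Y_sqintg b).1.
have mV : measurable_fun setT V.
  by apply: measurable_sum => b; exact: measurable_funX.
have Vi : sqintg haar (fun x => V x - int V).
  apply: sqintgB; last exact: sqintg_cst.
  by apply: (@sqintg_bounded _ _ _ _ _ Q) => // x; rewrite ger0_norm.
have i1 : intg haar (fun x => (cprod (Y ^~ x) K).1).
  have := intgD (trig_intg t1) (intg_cst _ 1).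
  by under eq_fun do rewrite subrK.
have i2 := trig_intg t2.
have e1 : int (fun x => (cprod (Y ^~ x) K).1) = 1.
  transitivity (int (fun x => ((cprod (Y ^~ x) K).1 - 1) + 1)).
    by apply: eq_Rintegral => x _; rewrite subrK.
  rewrite RintegralD//; [|exact: trig_intg t1|exact: intg_cst].
  by rewrite (trig_mean0 t1) ?Rintg_cst ?add0r// => m [].
have e2 : int (fun x => (cprod (Y ^~ x) K).2) = 0.
  by rewrite (trig_mean0 t2)// => m [].
rewrite variance_blocks.
rewrite (_ : int (fun x => cos (phi + S x)) =
    int (fun x => cos (phi + \sum_(b < K) Y b x))); last first.
  by apply: eq_Rintegral => x _; rewrite S_blocks.
have intV0 : 0 <= int V by apply: Rintegral_ge0 => x _; exact: V0.
have H := @Rintg_cos_sum _ _ _ haar Y K phi y Q (int V) (fun b _ => mY b)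
  (fun b x _ => le_trans (Y_le b x) (W_le b)) y01 V_le intV0 i1 i2 e1 e2.
apply: le_trans H _.
rewrite lerD2l ler_wpM2l ?expR_ge0//.
apply: le_trans (Rintg_abs_le eta0 Vi) _; rewrite lerD2l ler_wpM2l ?invr_ge0 ?(ltW eta0)//.
Qed.

End multiplicative_blocks.
(** * Variance of lacunary sums *)

Section finite_sums.
Context (R : realType).

Lemma sumr1_size (I : Type) (s : seq I) : \sum_(i <- s) 1 = (size s)%:R :> R.
Proof. by elim: s => [|i s IH]; rewrite ?big_nil// big_cons IH /= -[RHS]natr1 addrC. Qed.

Lemma powRN_itv01 (q t : R) : 1 < q -> 0 < t -> 0 < q `^ (- t) < 1.
Proof.
move=> q1 t0; have q0 : 0 < q by exact: lt_trans q1.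
rewrite powR_gt0//= /powR gt_eqF// mulNr -expR0 ltr_expR oppr_lt0.
by rewrite mulr_gt0// ln_gt0.
Qed.

Lemma sqr_sum_le (I : Type) (r : seq I) (P : pred I) (F : I -> R) :
  (\sum_(i <- r | P i) F i) ^+ 2 <=
  (\sum_(i <- r | P i) 1) * \sum_(i <- r | P i) F i ^+ 2.
Proof.
rewrite expr2 [X in X <= _]mulr_suml.
apply: le_trans (_ : \sum_(i <- r | P i) \sum_(j <- r | P j)
    (2^-1 * F i ^+ 2 + 2^-1 * F j ^+ 2) <= _).
  apply: ler_sum => i _; rewrite mulr_sumr; apply: ler_sum => j _.
  by have := sqr_ge0 (F i - F j); lra.
under [leLHS]eq_bigr do rewrite big_split/=.
rewrite big_split/=.
set n := \sum_(i <- r | P i) 1; set s := \sum_(i <- r | P i) F i ^+ 2.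
have -> : \sum_(i <- r | P i) \sum_(j <- r | P j) 2^-1 * F i ^+ 2 = 2^-1 * (n * s).
  rewrite mulrA [2^-1 * n]mulrC -mulrA /s mulr_sumr mulr_sumr; apply: eq_bigr => i _.
  by rewrite [RHS]mulr_suml; apply: eq_bigr => j _; rewrite mul1r.
have -> : \sum_(i <- r | P i) \sum_(j <- r | P j) 2^-1 * F j ^+ 2 = 2^-1 * (n * s).
  rewrite mulrCA [RHS]mulr_suml; apply: eq_bigr => i _.
  by rewrite mul1r mulr_sumr.
by rewrite le_eqVlt; apply/orP; left; apply/eqP; field.
Qed.

Lemma geometric_dist_sum (z : R) (k N : nat) : 0 < z < 1 ->
  \sum_(1 <= l < N.+1) z ^+ (k - l + (l - k)) <= 2 / (1 - z).
Proof.
move=> /andP[z0 z1]; have z1' : 0 < 1 - z by rewrite subr_gt0.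
(* Bounds that telescope: the exponent falls while l < k and rises afterwards, hence two forms. *)
have inv (M : nat) : (1 - z) * \sum_(0 <= l < M) z ^+ (k - l + (l - k)) <=
    if (M <= k)%N then z ^+ (k.+1 - M) else 2 - z ^+ (M - k.+1).
  elim: M => [|M IH].
    by rewrite big_geq// mulr0 exprn_ge0// ltW.
  rewrite big_nat_recr//= mulrDr.
  have [Mk|Mk] := leqP M.+1 k.
    rewrite (leq_trans (leqnSn M) Mk) in IH.
    rewrite (_ : (k.+1 - M = (k - M).+1)%N) in IH; last lia.
    rewrite (_ : (k - M + (M - k) = k - M)%N); last lia.
    rewrite (_ : (k.+1 - M.+1 = k - M)%N); last lia.
    by rewrite exprS in IH; nra.
  have [kM|Mk'] := leqP M k.
    have EM : M = k by lia.
    move: IH; rewrite EM leqnn subSnn expr1 !subnn addn0 expr0 => IH; lra.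
  rewrite leqNgt Mk' /= in IH.
  rewrite (_ : (k - M + (M - k) = M - k)%N); last lia.
  rewrite (_ : (M.+1 - k.+1 = M - k)%N); last lia.
  rewrite (_ : (M - k = (M - k.+1).+1)%N); last lia.
  have : z ^+ (M - k.+1).+1 <= z ^+ (M - k.+1) by rewrite exprS ler_piMl ?exprn_ge0 ?ltW.
  by rewrite exprS; nra.
rewrite ler_pdivlMr// mulrC.
apply: le_trans (_ : (1 - z) * \sum_(0 <= l < N.+1) z ^+ (k - l + (l - k)) <= _).
  by rewrite ler_pM2l// [leRHS]big_ltn//= lerDr exprn_ge0// ltW.
apply: le_trans (inv _) _; case: ifP => _.
  by rewrite (@le_trans _ _ 1)// ?exprn_ile1 ?ltW//; lra.
by rewrite lerBlDr lerDl exprn_ge0// ltW.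
Qed.

(** Comparison of the series with an integral, made discrete: with u = j / (j + 1), u^(- t) = exp (-
    t ln u) >= 1 - t ln u >= 1 + t (1 - u). *)
Lemma powR_telescope (t : R) (j : nat) : 0 < t -> (0 < j)%N ->
  t * j.+1%:R `^ (- (1 + t)) <= j%:R `^ (- t) - j.+1%:R `^ (- t).
Proof.
move=> t0 j0.
have jp : (0 : R) < j%:R by rewrite ltr0n.
have Jp : (0 : R) < j.+1%:R by rewrite ltr0n.
set u : R := j%:R / j.+1%:R; have u0 : 0 < u by rewrite divr_gt0.
have -> : j%:R `^ (- t) = j.+1%:R `^ (- t) * u `^ (- t).
  by rewrite -powRM ?ltW// mulrC divfK ?gt_eqF.
have -> : j.+1%:R `^ (- (1 + t)) = j.+1%:R `^ (- t) * j.+1%:R^-1.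
  rewrite opprD addrC powRD; last by apply/implyP => _; rewrite gt_eqF.
  by rewrite (powR_inv1 (ltW Jp)).
rewrite mulrCA -[X in _ <= _ - X]mulr1 -mulrBr ler_wpM2l ?powR_ge0//.
rewrite /powR gt_eqF// lerBrDr addrC.
apply: le_trans (expR_ge1Dx _); rewrite lerD2l mulNr -mulrN ler_pM2l//.
rewrite lerNr.
apply: le_trans (_ : u - 1 <= _).
  have -> : u = 1 + (u - 1) by ring.
  by rewrite [leRHS]addrAC subrr add0r; apply: le_ln1Dx; lra.
rewrite /u -natr1; have : (j%:R + 1 : R) != 0 by rewrite natr1 gt_eqF.
by move=> h; rewrite le_eqVlt; apply/orP; left; apply/eqP; field.
Qed.

Lemma p_series_tail (s : R) (e : R) : 1 < s -> 0 < e ->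
  exists2 D0 : nat, (0 < D0)%N & forall D E, (D0 <= D)%N ->
    \sum_(D.+1 <= j < E.+1) j%:R `^ (- s) <= e.
Proof.
move=> s1 e0; set t := s - 1; have t0 : 0 < t by rewrite subr_gt0.
have st : s = 1 + t by rewrite /t; ring.
have tel D E : (0 < D)%N ->
    t * \sum_(D.+1 <= j < E.+1) j%:R `^ (- s) <= D%:R `^ (- t).
  move=> D0; have [DE|DE] := leqP D E; last first.
    by rewrite big_geq ?mulr0 ?powR_ge0// ltnW.
  apply: le_trans (_ : D%:R `^ (- t) - E%:R `^ (- t) <= _); last first.
    by rewrite gerBl powR_ge0.
  rewrite -(subnKC DE); elim: (E - D)%N => [|m IH].
    by rewrite addn0 big_geq// mulr0 subrr.
  rewrite addnS big_nat_recr/=; last by rewrite ltnS leq_addr.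
  rewrite mulrDr st.
  have := @powR_telescope t (D + m) t0; rewrite addn_gt0 D0 => /(_ isT).
  by move: IH; rewrite st; lra.
have te : 0 < t * e by rewrite mulr_gt0.
(* From D0 on, D^(- t) <= t e, and by telescoping D^(- t) bounds t times the tail. *)
pose D0 := (Num.truncn ((t * e) `^ (- t^-1))).+1.
exists D0 => // D E DD; rewrite -(ler_pM2l t0).
apply: le_trans (tel D E _) _; first exact: leq_trans DD.
have D0D : (t * e) `^ (- t^-1) <= D%:R.
  by apply: ltW; apply: lt_le_trans (truncnS_gt _) _; rewrite ler_nat.
rewrite powRN.
have tep : 0 < (t * e) `^ (- t^-1) by rewrite powR_gt0.
have h : (t * e)^-1 <= D%:R `^ t.
  apply: le_trans (_ : ((t * e) `^ (- t^-1)) `^ t <= _).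
    by rewrite -powRrM mulNr mulVf ?gt_eqF// powR_inv1 ?(ltW te).
  by rewrite ge0_ler_powR ?nnegrE ?(ltW t0) ?(ltW tep).
by rewrite -[leRHS]invrK lef_pV2// ?posrE ?invr_gt0// (lt_le_trans _ h)// invr_gt0.
Qed.

End finite_sums.

(** * Quasi-orthogonality of lacunary dilations *)

Section quasi_orthogonality.
Context (R : realType).
Variables (n : nat -> nat) (q : R) (k0 : nat) (a b : nat -> R) (M rho : R).
Local Notation int f := (Rintegral (@haar R) setT f).
Hypothesis q_gt1 : 1 < q.
Hypothesis n_gt0 : forall k, (k0 <= k)%N -> (0 < n k)%N.
Hypothesis n_lac : forall k, (k0 <= k)%N -> q * (n k)%:R <= (n k.+1)%:R.
Hypothesis rho_gt0 : 0 < rho.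
Hypothesis M_gt0 : 0 < M.
Hypothesis coef_le : forall j, (0 < j)%N -> `|a j| + `|b j| <= M * j%:R `^ (- rho).

Lemma lacunary_growth k m : (k0 <= k)%N -> q ^+ m * (n k)%:R <= (n (k + m))%:R.
Proof.
move=> kk; elim: m => [|m IH]; first by rewrite expr0 mul1r addn0.
rewrite exprS -mulrA addnS.
apply: le_trans (n_lac (leq_trans kk (leq_addr m k))).
by rewrite ler_pM2l// (lt_trans ltr01).
Qed.

Let q0 : 0 < q. Proof. exact: lt_trans ltr01 q_gt1. Qed.
Let z := q `^ (- rho).
Let z01 : 0 < z < 1.
Proof.
exact: powRN_itv01.
Qed.

Definition fourier_term (j : nat) (x : R) :=
  a j * wave j 0 x + b j * wave j (- (pi / 2)) x.

Lemma Rintg_fourier_termM j j' n1 n2 : (0 < j)%N -> (0 < j')%N ->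
  (0 < n1)%N -> (0 < n2)%N ->
  int (fun x => fourier_term j (n1%:R * x) * fourier_term j' (n2%:R * x)) =
  (j * n1 == j' * n2)%N%:R / 2 * (a j * a j' + b j * b j').
Proof.
move=> j0 j0' n10 n20.
have wi k l (u v : R) : intg haar (fun x => wave k u x * wave l v x).
  apply: (@intg_bounded _ _ _ _ _ 1).
    by apply: measurable_funM; exact: measurable_wave.
  by move=> x; rewrite normrM -[leRHS]mulr1 ler_pM// wave_le1.
set J := (j * n1)%N; set J' := (j' * n2)%N.
have J0 : (0 < J)%N by rewrite muln_gt0 j0.
have J0' : (0 < J')%N by rewrite muln_gt0 j0'.
transitivity (int (fun x =>
   (a j * a j' * (wave J 0 x * wave J' 0 x) +
    a j * b j' * (wave J 0 x * wave J' (- (pi / 2)) x)) +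
   (b j * a j' * (wave J (- (pi / 2)) x * wave J' 0 x) +
    b j * b j' * (wave J (- (pi / 2)) x * wave J' (- (pi / 2)) x)))).
  by apply: eq_Rintegral => x _; rewrite /fourier_term !wave_dil; ring.
have i1 (c : R) k l (u v : R) : intg haar (fun x => c * (wave k u x * wave l v x)).
  exact: intgZ.
rewrite RintegralD//; [|apply: intgD; exact: i1..].
rewrite !RintegralD//; [|exact: i1..].
rewrite !RintegralZl//; [|exact: wi..].
rewrite !Rintg_waveM// !subrr !subr0 sub0r opprK cosN cos0 cos_pihalf.
by move: (_%:R / 2) => c; ring.
Qed.

(** A non-zero integral forces j n_k = j' n_l, hence j >= q^(l - k) j': the coefficient of order j
    is smaller by the factor z^(l - k). Coefficient decay and lacunarity together make correlations
    decay geometrically. *)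
Lemma norm_Rintg_fourier_termM k l j j' : (k0 <= k)%N -> (k <= l)%N ->
  (0 < j)%N -> (0 < j')%N ->
  `|int (fun x => fourier_term j ((n k)%:R * x) * fourier_term j' ((n l)%:R * x))| <=
  (j * n k == j' * n l)%N%:R * (z ^+ (l - k) * (M ^+ 2 * j'%:R `^ (- (2 * rho)))).
Proof.
move=> kk kl j0 j0'.
rewrite Rintg_fourier_termM ?n_gt0// ?(leq_trans kk)//.
case: eqP => [E|_]; last by rewrite mul0r !mul0r normr0.
rewrite /= mul1r mul1r normrM ger0_norm ?invr_ge0//.
have jp : (0 : R) < j%:R by rewrite ltr0n.
have jp' : (0 : R) < j'%:R by rewrite ltr0n.
have c1 := coef_le j0; have c2 := coef_le j0'.
have jj : q ^+ (l - k) * j'%:R <= j%:R.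
  have nk : (0 : R) < (n k)%:R by rewrite ltr0n n_gt0.
  rewrite -(ler_pM2r nk) -natrM E natrM mulrAC mulrC ler_pM2l//.
  by have := lacunary_growth (l - k) kk; rewrite subnKC.
have zj : j%:R `^ (- rho) <= z ^+ (l - k) * j'%:R `^ (- rho).
  have -> : z ^+ (l - k) = (q ^+ (l - k)) `^ (- rho).
    by rewrite /z -!powR_mulrn ?(ltW q0) ?powR_ge0// -!powRrM mulrC.
  rewrite -powRM ?exprn_ge0 ?(ltW q0)//.
  have p1 : 0 < q ^+ (l - k) * j'%:R by rewrite mulr_gt0 ?exprn_gt0.
  rewrite !powRN lef_pV2 ?posrE ?powR_gt0//.
  by rewrite ge0_ler_powR ?nnegrE ?(ltW rho_gt0) ?(ltW p1).
have -> : j'%:R `^ (- (2 * rho)) = j'%:R `^ (- rho) * j'%:R `^ (- rho).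
  by rewrite -powRD ?(gt_eqF jp') ?implybT//; congr (_ `^ _); ring.
apply: le_trans (_ : (`|a j| + `|b j|) * (`|a j'| + `|b j'|) <= _).
  apply: le_trans (_ : 1 * `|a j * a j' + b j * b j'| <= _).
    by rewrite ler_wpM2r// invf_le1//; lra.
  rewrite mul1r (le_trans (ler_normD _ _))// !normrM.
  have := normr_ge0 (a j); have := normr_ge0 (b j).
  have := normr_ge0 (a j'); have := normr_ge0 (b j'); nra.
apply: le_trans (_ : (M * j%:R `^ (- rho)) * (M * j'%:R `^ (- rho)) <= _).
  by apply: ler_pM => //; exact: addr_ge0.
rewrite [leRHS](_ : _ =
  M * (z ^+ (l - k) * j'%:R `^ (- rho)) * (M * j'%:R `^ (- rho))); last by ring.
by rewrite ler_pM2r ?mulr_gt0 ?powR_gt0// ler_pM2l.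
Qed.

(** Majorant of the sum of squared coefficients of orders between D and E; for rho > 1/2 it is
    bounded in E and small for large D. *)
Definition tail_coef (D E : nat) := M ^+ 2 * \sum_(D.+1 <= j < E.+1) j%:R `^ (- (2 * rho)).

Let fourier_term_sqintg j n1 : sqintg haar (fun x => fourier_term j (n1%:R * x)).
Proof.
have t : trig_in (fun=> True) (fourier_term j) by apply: trigD; exact: trig_wave.
exact: trig_sqintg (trig_dil n1 t).
Qed.

Lemma norm_Rintg_fourier_sumM D E k l : (k0 <= k)%N -> (k <= l)%N ->
  `|int (fun x => fourier_sum a b D E ((n k)%:R * x) *
      fourier_sum a b D E ((n l)%:R * x))| <= z ^+ (l - k) * tail_coef D E.
Proof.
move=> kk kl.
have -> : int (fun x => fourier_sum a b D E ((n k)%:R * x) *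
      fourier_sum a b D E ((n l)%:R * x)) =
    \sum_(D.+1 <= j' < E.+1) \sum_(D.+1 <= j < E.+1)
      int (fun x => fourier_term j ((n k)%:R * x) * fourier_term j' ((n l)%:R * x)).
  transitivity (int (fun x => \sum_(D.+1 <= j' < E.+1) \sum_(D.+1 <= j < E.+1)
      (fourier_term j ((n k)%:R * x) * fourier_term j' ((n l)%:R * x)))).
    apply: eq_Rintegral => x _; rewrite mulr_sumr; apply: eq_bigr => j' _.
    by rewrite mulr_suml.
  rewrite Rintg_sum; last by move=> j' _; apply: intg_sum => j _; exact: sqintg_mul.
  by apply: eq_bigr => j' _; rewrite Rintg_sum// => j _; exact: sqintg_mul.
apply: le_trans (ler_norm_sum _ _ _) _.
rewrite /tail_coef !mulr_sumr big_nat_cond [leRHS]big_nat_cond.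
apply: ler_sum => j'; rewrite andbT => /andP[Dj' _].
have j0' : (0 < j')%N by exact: leq_ltn_trans Dj'.
apply: le_trans (ler_norm_sum _ _ _) _.
apply: le_trans (_ : \sum_(D.+1 <= j < E.+1) (j * n k == j' * n l)%N%:R *
    (z ^+ (l - k) * (M ^+ 2 * j'%:R `^ (- (2 * rho)))) <= _).
  rewrite big_nat_cond [leRHS]big_nat_cond.
  apply: ler_sum => j; rewrite andbT => /andP[Dj _].
  by apply: norm_Rintg_fourier_termM => //; exact: leq_ltn_trans Dj.
have X0 : 0 <= z ^+ (l - k) * (M ^+ 2 * j'%:R `^ (- (2 * rho))).
  by rewrite mulr_ge0 ?exprn_ge0 ?powR_ge0// mulr_ge0 ?sqr_ge0 ?powR_ge0.
rewrite -mulr_suml -[leRHS]mul1r ler_wpM2r//.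
(* For given j' at most one j resonates, so the double sum over orders collapses to a single one. *)
have [[j1 /eqP j1E]|no] := pselect (exists j, (j * n k == j' * n l)%N); last first.
  rewrite big1// => j _; case: eqP => // /eqP h; exfalso; apply: no; by exists j.
have E1 j : (j * n k == j' * n l)%N = (j == j1).
  by rewrite -j1E eqn_pmul2r ?n_gt0.
under eq_bigr do rewrite E1.
have [j1D|j1D] := boolP (j1 \in index_iota D.+1 E.+1).
  rewrite (bigD1_seq j1) ?iota_uniq//= eqxx big1 ?addr0// => j jj.
  by rewrite (negbTE jj).
rewrite big1_seq// => j /andP[_ jD]; case: eqP => // jj.
by move: j1D; rewrite -jj jD.
Qed.

(** Schur test: u_k u_l is split into half squares, and every row of the matrix z^|k - l| sums to at
    most 2 / (1 - z). *)
Lemma lacunary_sum_variance_le (D E N : nat) (G : pred nat) (u : nat -> R) :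
  (forall k, G k -> (k0 <= k)%N) ->
  int (fun x => (\sum_(1 <= k < N.+1 | G k) u k * fourier_sum a b D E ((n k)%:R * x)) ^+ 2)
  <= 2 / (1 - z) * tail_coef D E * \sum_(1 <= k < N.+1 | G k) u k ^+ 2.
Proof.
move=> Gk; have tS := trig_fourier_sum a b D E.
have Si k : sqintg haar (fun x => fourier_sum a b D E ((n k)%:R * x)).
  exact: trig_sqintg (trig_dil (n k) tS).
have T0 : 0 <= tail_coef D E.
  by rewrite mulr_ge0 ?sqr_ge0// sumr_ge0// => j _; exact: powR_ge0.
have /andP[z0 z1] := z01.
rewrite Rintg_sqr_sum; last by move=> k _; exact: sqintgZ.
set dist := fun k l => (k - l + (l - k))%N.
apply: le_trans (_ : \sum_(1 <= k < N.+1 | G k) \sum_(1 <= l < N.+1 | G l)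
   (2^-1 * (u k ^+ 2 * (z ^+ dist k l * tail_coef D E)) +
    2^-1 * (u l ^+ 2 * (z ^+ dist k l * tail_coef D E))) <= _).
  apply: ler_sum => k /Gk kk; apply: ler_sum => l /Gk ll.
  have -> : int (fun x => u k * fourier_sum a b D E ((n k)%:R * x) *
      (u l * fourier_sum a b D E ((n l)%:R * x))) =
    u k * u l * int (fun x => fourier_sum a b D E ((n k)%:R * x) *
      fourier_sum a b D E ((n l)%:R * x)).
    rewrite -RintegralZl//; last exact: sqintg_mul.
    by apply: eq_Rintegral => x _; ring.
  set J := int _.
  have JT : `|J| <= z ^+ dist k l * tail_coef D E.
    have [kl|/ltnW lk] := leqP k l.
      rewrite /dist (_ : (k - l + (l - k) = l - k)%N); last lia.
      exact: norm_Rintg_fourier_sumM.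
    rewrite /dist (_ : (k - l + (l - k) = k - l)%N); last lia.
    have -> : J = int (fun x => fourier_sum a b D E ((n l)%:R * x) *
      fourier_sum a b D E ((n k)%:R * x)).
      by apply: eq_Rintegral => x _; rewrite mulrC.
    exact: norm_Rintg_fourier_sumM.
  set X := z ^+ _ * _ in JT *.
  apply: le_trans (ler_norm _) _; rewrite normrM.
  apply: le_trans (ler_wpM2l (normr_ge0 _) JT) _.
  have X0 : 0 <= X by exact: le_trans JT.
  rewrite -!mulrDr -!mulrDl mulrA ler_wpM2r// normrM.
  rewrite -(real_normK (num_real (u k))) -(real_normK (num_real (u l))).
  by have := sqr_ge0 (`|u k| - `|u l|); lra.
have geo k : \sum_(1 <= l < N.+1 | G l) z ^+ dist k l <= 2 / (1 - z).
  apply: le_trans (geometric_dist_sum k N z01).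
  by rewrite big_mkcond/=; apply: ler_sum => l _; case: ifP => // _; exact: exprn_ge0 (ltW z0).
under [leLHS]eq_bigr do rewrite big_split/=.
rewrite big_split/= [X in _ + X]exchange_big/= -big_split/= mulr_sumr.
apply: ler_sum => k _.
have -> : \sum_(1 <= j < N.+1 | G j) 2^-1 * (u k ^+ 2 * (z ^+ dist j k * tail_coef D E)) =
    \sum_(1 <= j < N.+1 | G j) 2^-1 * (u k ^+ 2 * (z ^+ dist k j * tail_coef D E)).
  by apply: eq_bigr => j _; rewrite /dist addnC.
have -> : \sum_(1 <= j < N.+1 | G j) 2^-1 * (u k ^+ 2 * (z ^+ dist k j * tail_coef D E)) =
    2^-1 * (u k ^+ 2 * tail_coef D E * \sum_(1 <= j < N.+1 | G j) z ^+ dist k j).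
  by rewrite !mulr_sumr; apply: eq_bigr => j _; ring.
have := geo k; set s := \sum_(_ <= _ < _ | _) _ => sg.
have : u k ^+ 2 * tail_coef D E * s <= u k ^+ 2 * tail_coef D E * (2 / (1 - z)).
  by rewrite ler_wpM2l// mulr_ge0// sqr_ge0.
lra.
Qed.

End quasi_orthogonality.
Section dilated_sums.
Context (R : realType).
Local Notation int f := (Rintegral (@haar R) setT f).

(** Cauchy-Schwarz loses the number of terms but asks nothing of the frequencies or coefficients. It
    serves where this loss is harmless: for boundedly many indices, or for a function made small
    depending on N. *)
Lemma dilated_sum_variance_le (n : nat -> nat) (u : nat -> R) (f : R -> R)
    (r : seq nat) (G : pred nat) :
  (forall k, G k -> (0 < n k)%N) -> periodic f 1 -> sqintg haar f ->
  int (fun x => (\sum_(k <- r | G k) u k * f ((n k)%:R * x)) ^+ 2) <=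
  (\sum_(k <- r | G k) 1) * (\sum_(k <- r | G k) u k ^+ 2) * int (fun x => f x ^+ 2).
Proof.
move=> nG f1 fi.
have fn k : G k -> sqintg haar (fun x => f ((n k)%:R * x)).
  by move=> Gk; apply: sqintg_dilation => //; exact: nG.
have un k : G k -> sqintg haar (fun x => u k * f ((n k)%:R * x)).
  by move=> Gk; apply: sqintgZ; exact: fn.
apply: le_trans (_ : int (fun x => (\sum_(k <- r | G k) 1) *
    \sum_(k <- r | G k) (u k * f ((n k)%:R * x)) ^+ 2) <= _).
  apply: Rintg_le.
  - exact: (sqintg_sum r un).2.
  - by apply: intgZ; apply: intg_sum => k Gk; exact: (un k Gk).2.
  - by move=> x; exact: sqr_sum_le.
rewrite RintegralZl//; last by apply: intg_sum => k Gk; exact: (un k Gk).2.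
rewrite -mulrA ler_wpM2l ?sumr_ge0// Rintg_sum; last first.
  by move=> k Gk; exact: (un k Gk).2.
rewrite mulr_suml; apply: ler_sum => k Gk.
rewrite -(Rintg_sqr_dilation (nG k Gk) f1 fi.1) -RintegralZl//; last first.
  exact: (fn k Gk).2.
by rewrite le_eqVlt; apply/orP; left; apply/eqP; apply: eq_Rintegral => x _;
  rewrite exprMn.
Qed.

Lemma periodic_fourier_sum (a b : nat -> R) D E : periodic (fourier_sum a b D E) 1.
Proof. by move=> x; exact: trig_periodic (trig_fourier_sum a b D E). Qed.

Lemma fourier_sum_cat (a b : nat -> R) D E x : (D <= E)%N ->
  fourier_sum a b 0 E x = fourier_sum a b 0 D x + fourier_sum a b D E x.
Proof. by move=> DE; rewrite /fourier_sum -big_cat_nat. Qed.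

Section remainder.
Variables (n : nat -> nat) (q : R) (k0 : nat) (f : R -> R) (M rho : R).
Hypothesis q_gt1 : 1 < q.
Hypothesis n_gt0 : forall k, (k0 <= k)%N -> (0 < n k)%N.
Hypothesis n_lac : forall k, (k0 <= k)%N -> q * (n k)%:R <= (n k.+1)%:R.
Hypothesis rho_gt0 : 0 < rho.
Hypothesis M_gt0 : 0 < M.
Let a := fourier_cos f.
Let b := fourier_sin f.
Hypothesis coef_le : forall j, (0 < j)%N -> `|a j| + `|b j| <= M * j%:R `^ (- rho).
Hypothesis f_per : periodic f 1.
Hypothesis f_L2 : sqintg haar f.
Hypothesis f_mean0 : int (fun x => f x) = 0.

(** Quasi-orthogonality is available for finite Fourier sums only. The tail is cut again at an order
    E depending on N and u; beyond E the crude bound gives at most e, and e is arbitrary. *)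
Lemma remainder_variance_le (D N : nat) (G : pred nat) (u : nat -> R) (T : R) :
  (forall k, G k -> (k0 <= k)%N) -> (forall E, tail_coef M rho D E <= T) ->
  int (fun x => (\sum_(1 <= k < N.+1 | G k)
    u k * (f ((n k)%:R * x) - fourier_sum a b 0 D ((n k)%:R * x))) ^+ 2)
  <= 2 * (2 / (1 - q `^ (- rho)) * T * \sum_(1 <= k < N.+1 | G k) u k ^+ 2).
Proof.
move=> Gk TE; apply/ler_addgt0Pr => e e0.
set U := \sum_(1 <= k < N.+1 | G k) u k ^+ 2.
have U0 : 0 <= U by apply: sumr_ge0 => k _; exact: sqr_ge0.
pose c : R := \sum_(1 <= k < N.+1 | G k) 1.
have c0 : 0 <= c by exact: sumr_ge0.
(* Anticipates the loss 2 c U of the crude bound, c being the number of terms. *)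
have e1 : 0 < e / (2 * (c * U) + 1).
  by rewrite divr_gt0// ltr_wpDl// mulr_ge0// mulr_ge0.
have [E0 hE] := fourier_sum_cvg f_L2 f_mean0 e1.
pose E := maxn D E0.
have DE : (D <= E)%N by rewrite leq_maxl.
have {}hE := hE E (leq_maxr _ _).
rewrite -/a -/b in hE.
pose g x := f x - fourier_sum a b 0 E x.
have gi : sqintg haar g.
  by apply: sqintgB => //; exact: trig_sqintg (trig_fourier_sum _ _ _ _).
have g1 : periodic g 1 by move=> x; rewrite /g f_per periodic_fourier_sum.
have nG k : G k -> (0 < n k)%N by move=> /Gk; exact: n_gt0.
have tS : trig_in _ (fourier_sum a b D E) := trig_fourier_sum a b D E.
have s1 : sqintg haar (fun x => \sum_(1 <= k < N.+1 | G k)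
    u k * fourier_sum a b D E ((n k)%:R * x)).
  by apply: sqintg_sum => k _; apply: sqintgZ; exact: trig_sqintg (trig_dil _ tS).
have s2 : sqintg haar (fun x => \sum_(1 <= k < N.+1 | G k) u k * g ((n k)%:R * x)).
  apply: sqintg_sum => k kG; apply: sqintgZ; apply: sqintg_dilation => //.
  exact: nG.
rewrite (_ : int _ = int (fun x =>
  (\sum_(1 <= k < N.+1 | G k) u k * fourier_sum a b D E ((n k)%:R * x) +
   \sum_(1 <= k < N.+1 | G k) u k * g ((n k)%:R * x)) ^+ 2)); last first.
  apply: eq_Rintegral => x _; congr (_ ^+ 2); rewrite -big_split/=.
  by apply: eq_bigr => k _; rewrite /g (fourier_sum_cat _ _ _ DE); ring.
apply: le_trans (Rintg_sqrD_le s1 s2) _; apply: lerD.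
  rewrite ler_pM2l//; apply: le_trans (lacunary_sum_variance_le q_gt1 n_gt0 n_lac
    rho_gt0 M_gt0 coef_le D E N u Gk) _.
  rewrite ler_wpM2r// ler_wpM2l//.
  rewrite divr_ge0// subr_ge0 powRN invf_le1 ?powR_gt0 ?(lt_trans ltr01 q_gt1)//.
  rewrite /powR gt_eqF ?(lt_trans ltr01 q_gt1)// -expR0 ler_expR mulr_ge0 ?(ltW rho_gt0)//.
  by rewrite ln_ge0// ltW.
apply: le_trans (ler_wpM2l _ (@dilated_sum_variance_le n u g _ G nG g1 gi)) _ => //.
rewrite -/U -/c; apply: le_trans (_ : 2 * (c * U * (e / (2 * (c * U) + 1))) <= _).
  by rewrite ler_pM2l// ler_wpM2l// mulr_ge0.
have p : 0 < 2 * (c * U) + 1 by rewrite ltr_wpDl// mulr_ge0// mulr_ge0.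
rewrite !mulrA ler_pdivrMr// -mulrA; nra.
Qed.

End remainder.

End dilated_sums.
(** * Blocks separated by gaps *)

Lemma card_block_le (p s b N : nat) (R : realType) : (0 < p)%N ->
  \sum_(1 <= k < N.+1 | ((k + s) %/ p == b)%N) 1 <= p%:R :> R.
Proof.
move=> p0; rewrite -big_filter sumr1_size ler_nat -(size_map (fun k => (k + s) %% p)%N).
rewrite -[leqRHS](size_iota 0 p); apply: uniq_leq_size => [|x].
  rewrite map_inj_in_uniq ?filter_uniq ?iota_uniq// => k l.
  rewrite !mem_filter => /andP[/eqP kb _] /andP[/eqP lb _] kl.
  by have := divn_eq (k + s) p; have := divn_eq (l + s) p; rewrite kb lb kl; lia.
by move=> /mapP[k _ ->]; rewrite mem_iota add0n ltn_pmod.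
Qed.

Section gapped_blocks.
Context (R : realType).
Variables (n : nat -> nat) (k0 D p tau s N : nat) (a b u : nat -> R).
Local Notation int f := (Rintegral (@haar R) setT f).
Hypothesis n_gt0 : forall k, (k0 <= k)%N -> (0 < n k)%N.
Hypothesis n_sep : forall k l, (k0 <= k)%N -> (k + tau <= l)%N -> (D.+1 * n k <= n l)%N.
Hypothesis p_gt0 : (0 < p)%N.

(** Blocks are the ranges on which [(k + s) %/ p] is constant, and the first tau places of each form
    the gap. Indices below k0, where the growth may fail, are discarded. *)
Definition in_block (k : nat) := (k0 <= k)%N && (tau <= (k + s) %% p)%N.

Definition coef_sum := \sum_(1 <= j < D.+1) (`|a j| + `|b j|).

(** An index, a harmonic, and a flag selecting the sine (true) or the cosine (false). *)
Let I : Type := nat * (nat * bool).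
Let amp (i : I) := if i.2.2 then b i.2.1 else a i.2.1.
Let th (i : I) : R := if i.2.2 then - (pi / 2) else 0.
Let w (i : I) := u i.1 * amp i.
Let mu (i : I) := (i.2.1 * n i.1)%N.
Let nu (i : I) := n i.1.
Let beta (i : I) := ((i.1 + s) %/ p)%N.
Let P (i : I) := [&& (0 < i.1 <= N)%N, in_block i.1 & (0 < i.2.1 <= D)%N].
Let r : seq I := [seq (k, i) | k <- index_iota 1 N.+1,
  i <- [seq (j, t) | j <- index_iota 1 D.+1, t <- [:: false; true]]].
Let A := coef_sum.

Let A_ge0 : 0 <= A.
Proof. by apply: sumr_ge0 => j _; exact: addr_ge0. Qed.

Let sum_terms (X : pred nat) (F : I -> R) :
  \sum_(i <- r | P i && X i.1) F i =
  \sum_(1 <= k < N.+1 | in_block k && X k) \sum_(1 <= j < D.+1)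
    (F (k, (j, false)) + F (k, (j, true))).
Proof.
rewrite big_mkcond big_allpairs_dep [RHS]big_mkcond big_nat_cond [RHS]big_nat_cond.
apply: eq_bigr => k; rewrite andbT ltnS => kN.
rewrite big_allpairs_dep; case: ifPn => [kX|kX]; last first.
  rewrite big1// => j _; rewrite big1// => t _; case: ifP => //.
  by rewrite /P/= => /andP[/and3P[_ gk _] xk]; move: kX; rewrite gk xk.
rewrite big_nat_cond [RHS]big_nat_cond; apply: eq_bigr => j; rewrite andbT ltnS => jD.
by case/andP: kX => gk xk; rewrite big_cons big_seq1 /P/= kN jD gk xk.
Qed.

Let sum_terms_all (F : I -> R) :
  \sum_(i <- r | P i) F i =
  \sum_(1 <= k < N.+1 | in_block k) \sum_(1 <= j < D.+1)
    (F (k, (j, false)) + F (k, (j, true))).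
Proof.
transitivity (\sum_(i <- r | P i && xpredT i.1) F i).
  by apply: eq_bigl => i; rewrite andbT.
by rewrite (sum_terms xpredT); apply: eq_bigl => k; rewrite andbT.
Qed.

Let main x := \sum_(1 <= k < N.+1 | in_block k) u k * fourier_sum a b 0 D ((n k)%:R * x).

Let mainE x : main x = \sum_(i <- r | P i) w i * wave (mu i) (th i) x.
Proof.
rewrite sum_terms_all; apply: eq_bigr => k _.
rewrite /fourier_sum mulr_sumr; apply: eq_bigr => j _.
by rewrite /w /amp /mu /th/= !wave_dil; ring.
Qed.

Variables (um L : R).
Hypothesis um_ge0 : 0 <= um.
Hypothesis u_le : forall k, (0 < k <= N)%N -> `|u k| <= um.
Hypothesis L_le : forall m : nat, (0 < m)%N ->
  \sum_(1 <= k < N.+1) \sum_(1 <= l < N.+1) \sum_(1 <= j < D.+1) \sum_(1 <= j' < D.+1)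
    `|u k| * `|u l| * ((j * n k)%:Z - (j' * n l)%:Z == m%:Z)%:R <= L.
Hypothesis small : p%:R * um * A <= 1.

Let W b := \sum_(i <- r | P i && (beta i == b)) `|w i|.

Let WE c : W c = (\sum_(1 <= k < N.+1 | in_block k && ((k + s) %/ p == c)%N) `|u k|) * A.
Proof.
rewrite /W (sum_terms (fun k => (k + s) %/ p == c)%N) mulr_suml.
apply: eq_bigr => k _; rewrite /A /coef_sum mulr_sumr; apply: eq_bigr => j _.
by rewrite /w /amp/= !normrM; ring.
Qed.

Let W_le c : W c <= p%:R * um * A.
Proof.
rewrite WE ler_wpM2r//; apply: le_trans (_ :
  \sum_(1 <= k < N.+1 | ((k + s) %/ p == c)%N) 1 * um <= _); last first.
  by rewrite -mulr_suml ler_wpM2r// card_block_le.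
rewrite big_mkcond [leRHS]big_mkcond big_nat_cond [leRHS]big_nat_cond.
apply: ler_sum => k; rewrite andbT ltnS => kN.
by case: (in_block k); case: (_ == c); rewrite /= ?mul1r ?u_le.
Qed.

Let W2_le (K : nat) : \sum_(c < K) W c ^+ 2 <=
  p%:R * A ^+ 2 * \sum_(1 <= k < N.+1) u k ^+ 2.
Proof.
apply: le_trans (_ : \sum_(c < K) A ^+ 2 * (p%:R *
    \sum_(1 <= k < N.+1 | ((k + s) %/ p == c)%N) u k ^+ 2) <= _).
  apply: ler_sum => c _; rewrite WE exprMn mulrC ler_wpM2l ?sqr_ge0//.
  apply: le_trans (sqr_sum_le _ _ _) _; apply: ler_pM => //.
  - exact: sumr_ge0.
  - by apply: sumr_ge0 => k _; exact: sqr_ge0.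
  - apply: le_trans (card_block_le s c N R p_gt0).
    by rewrite big_mkcond [leRHS]big_mkcond; apply: ler_sum => k _;
      case: (in_block k); case: (_ == _ :> nat).
  - rewrite big_mkcond [leRHS]big_mkcond; apply: ler_sum => k _.
    rewrite real_normK ?num_real//.
    by case: (in_block k); case: (_ == _ :> nat); rewrite /= ?sqr_ge0.
rewrite -mulr_sumr -mulr_sumr mulrA [A ^+ 2 * _]mulrC ler_wpM2l ?mulr_ge0 ?sqr_ge0//.
under eq_bigr do rewrite big_mkcond.
rewrite exchange_big/=; apply: ler_sum => k _.
have [kK|kK] := ltnP ((k + s) %/ p) K.
  rewrite (bigD1 (Ordinal kK))//= eqxx big1 ?addr0// => c ck.
  by case: eqP => // E; case/eqP: ck; exact/val_inj/esym.
rewrite big1 ?sqr_ge0// => c _; case: eqP => // E.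
by move: (ltn_ord c); rewrite -E ltnNge kK.
Qed.

(** An absolute difference equal to m means one of two signed equations, and each is counted by L
    after exchanging the roles of the pairs: hence the factor 2. The amplitudes contribute at most A
    each. *)
Let L2_le m : (0 < m)%N ->
  \sum_(i <- r | P i) \sum_(j <- r | P j && (beta j == beta i) &&
     (mu i - mu j + (mu j - mu i) == m)%N) `|w i| * `|w j| <= 2 * A ^+ 2 * L.
Proof.
move=> m0; pose ind (x y : nat) : R := (x - y + (y - x) == m)%N%:R.
apply: le_trans (_ : \sum_(i <- r | P i) \sum_(j <- r | P j)
    ind (mu i) (mu j) * (`|w i| * `|w j|) <= _).
  apply: ler_sum => i _; rewrite big_mkcond [leRHS]big_mkcond.
  apply: ler_sum => j _; rewrite /ind; case: (P j) => //=.
  by case: (beta j == beta i); case: (_ == m); rewrite /= ?mul1r ?mul0r ?mulr_ge0.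
rewrite sum_terms_all.
pose T k l j j' := ind (j * n k)%N (j' * n l)%N * (`|u k| * `|u l|).
have T0 k l j j' : 0 <= T k l j j' by rewrite mulr_ge0 ?mulr_ge0 ?ler0n.
have aj j : (0 < j < D.+1)%N -> `|a j| + `|b j| <= A.
  move=> jD; rewrite /A /coef_sum (bigD1_seq j) ?iota_uniq ?mem_index_iota//=.
  by rewrite lerDl; apply: sumr_ge0 => i _; exact: addr_ge0.
apply: le_trans (_ : \sum_(1 <= k < N.+1) \sum_(1 <= j < D.+1) \sum_(1 <= l < N.+1)
    \sum_(1 <= j' < D.+1) A ^+ 2 * T k l j j' <= _).
  rewrite big_mkcond; apply: ler_sum => k _.
  case: ifP => _; last first.
    by do 3 (apply: sumr_ge0 => ? _); rewrite mulr_ge0 ?sqr_ge0.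
  rewrite big_nat_cond [leRHS]big_nat_cond; apply: ler_sum => j; rewrite andbT => jD.
  rewrite !sum_terms_all -big_split/= big_mkcond; apply: ler_sum => l _.
  case: ifP => _; last first.
    by do 1 (apply: sumr_ge0 => ? _); rewrite mulr_ge0 ?sqr_ge0.
  rewrite -big_split/= big_nat_cond [leRHS]big_nat_cond.
  apply: ler_sum => j'; rewrite andbT => jD'.
  rewrite /mu /w /amp/= -!mulrDr.
  rewrite [leLHS](_ : _ = T k l j j' * ((`|a j| + `|b j|) * (`|a j'| + `|b j'|))); last first.
    by rewrite /T !normrM; ring.
  by rewrite mulrC ler_wpM2r// expr2 ler_pM ?addr_ge0 ?aj.
have -> : 2 * A ^+ 2 * L = A ^+ 2 * (L + L) by ring.
pose U k l j j' (d : ssrint.int) : R := `|u k| * `|u l| * ((j * n k)%:Z - (j' * n l)%:Z == d)%:R.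
apply: le_trans (_ : A ^+ 2 * (
   \sum_(1 <= k < N.+1) \sum_(1 <= l < N.+1) \sum_(1 <= j < D.+1) \sum_(1 <= j' < D.+1)
     U k l j j' m%:Z +
   \sum_(1 <= k < N.+1) \sum_(1 <= l < N.+1) \sum_(1 <= j < D.+1) \sum_(1 <= j' < D.+1)
     U l k j' j m%:Z) <= _); last first.
  rewrite ler_wpM2l ?sqr_ge0//; apply: lerD; first exact: L_le.
  apply: le_trans (L_le m0); rewrite exchange_big/=.
  apply: ler_sum => l _; apply: ler_sum => k _; rewrite exchange_big/=.
  by apply: ler_sum => j' _; apply: ler_sum => j _.
rewrite -big_split/= mulr_sumr; apply: ler_sum => k _.
rewrite exchange_big/= -big_split/= mulr_sumr; apply: ler_sum => l _.
rewrite -big_split/= mulr_sumr; apply: ler_sum => j _.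
rewrite -big_split/= mulr_sumr; apply: ler_sum => j' _.
rewrite ler_wpM2l ?sqr_ge0// /T /U (mulrC `|u l|) -mulrDr mulrC ler_wpM2l ?mulr_ge0//.
rewrite /ind; case: eqP => [E|_]; last by rewrite addr_ge0.
have [|/ltnW] := leqP (j' * n l) (j * n k) => h.
  have -> : ((j * n k)%:Z - (j' * n l)%:Z == m%:Z) = true by apply/eqP; lia.
  by rewrite lerDl.
have -> : ((j' * n l)%:Z - (j * n k)%:Z == m%:Z) = true by apply/eqP; lia.
by rewrite lerDr.
Qed.

Lemma gapped_charfun (phi eta y Q : R) : 0 < eta ->
  y = p%:R * um * coef_sum ->
  Q = p%:R * coef_sum ^+ 2 * \sum_(1 <= k < N.+1) u k ^+ 2 ->
  `|int (fun x => cos (phi + main x)) -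
    expR (- (int (fun x => main x ^+ 2) / 2)) * cos phi| <=
  y * Q + expR (Q / 2) * (eta + eta^-1 * (Q * (y ^+ 2 + 2 * coef_sum ^+ 2 * L))).
Proof.
move=> eta0 yE QE.
have y01 : 0 <= y <= 1 by rewrite yE small andbT !mulr_ge0.
have h1 i : P i -> (0 < nu i)%N.
  by case/and3P => _ /andP[kk _] _; exact: n_gt0.
have h2 i : P i -> (nu i <= mu i <= D * nu i)%N.
  case/and3P => _ _ /andP[j0 jD]; rewrite /nu /mu leq_pmull//=.
  by rewrite leq_mul2r jD orbT.
have h3 i : P i -> (beta i < (N + s).+1)%N.
  case/and3P => /andP[_ kN] _ _; rewrite ltnS /beta.
  by apply: leq_trans (leq_div _ _) _; rewrite leq_add2r.
have h4 i j : P i -> P j -> (beta i < beta j)%N -> (D.+1 * nu i <= nu j)%N.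
  case/and3P => _ /andP[ki _] _; case/and3P => _ /andP[_ gj] _ bij.
  apply: n_sep => //; move: bij gj; rewrite /beta => bij gj.
  (* A member of a later block lies past the start of that block by at least tau, so the two indices
     differ by more than tau. *)
  have := divn_eq (i.1 + s) p; have := divn_eq (j.1 + s) p.
  have := ltn_pmod (i.1 + s) p_gt0.
  have : (((i.1 + s) %/ p).+1 * p <= (j.1 + s) %/ p * p)%N by rewrite leq_mul2r bij orbT.
  rewrite mulSn; lia.
have := @blocks_charfun R I r P w th mu nu beta D (N + s).+1 h1 h2 h3 h4
  _ _ (2 * A ^+ 2 * L) _ W_le (W2_le _) L2_le phi eta eta0.
rewrite -/A -yE -QE => /(_ y01).
rewrite (_ : (fun x => cos (phi + \sum_(i <- r | P i) w i * wave (mu i) (th i) x)) =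
  (fun x => cos (phi + main x))); last by apply/funext => x; rewrite mainE.
by rewrite (_ : (fun x => (\sum_(i <- r | P i) w i * wave (mu i) (th i) x) ^+ 2) =
  (fun x => main x ^+ 2)); last by apply/funext => x; rewrite mainE.
Qed.

End gapped_blocks.

(** * Choice of the shift and passage to a sum close in mean square *)

Section approximation.
Context (R : realType).

(** Averaging: each k falls into a gap for at most tau of the p shifts, so some shift does no worse
    than the mean. *)
Lemma gap_shift (p tau N : nat) (v : nat -> R) : (0 < p)%N ->
  (forall k, 0 <= v k) ->
  exists s, \sum_(1 <= k < N.+1 | ((k + s) %% p < tau)%N) v k <=
    tau%:R / p%:R * \sum_(1 <= k < N.+1) v k.
Proof.
move=> p0 v0; have p0' : (0 : R) < p%:R by rewrite ltr0n.
set h := \sum_(1 <= k < N.+1) v k.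
have [//|no] := pselect (exists s, \sum_(1 <= k < N.+1 | ((k + s) %% p < tau)%N) v k <=
    tau%:R / p%:R * h).
have : \sum_(s < p) \sum_(1 <= k < N.+1 | ((k + s) %% p < tau)%N) v k <= tau%:R * h.
  under eq_bigr do rewrite big_mkcond.
  rewrite exchange_big/= /h mulr_sumr; apply: ler_sum => k _.
  rewrite -big_mkcond/= sumr_const -[leLHS]mulr_natl ler_wpM2r// ler_nat.
  rewrite -sum1_card; apply: leq_trans (_ : \sum_(x <- [seq x <- map (fun s : 'I_p =>
    (k + s) %% p)%N (enum 'I_p) | (x < tau)%N]) 1 <= _)%N.
    by rewrite big_filter big_map big_enum_cond /= leq_eqVlt eqxx.
  rewrite sum1_size -[leqRHS](size_iota 0 tau); apply: uniq_leq_size => [|x].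
    apply: filter_uniq; rewrite map_inj_uniq ?enum_uniq// => i j ij.
    apply/val_inj => /=; apply/eqP.
    by rewrite -(modn_small (ltn_ord i)) -(modn_small (ltn_ord j)) -(eqn_modDl k) ij.
  by rewrite mem_filter mem_iota add0n => /andP[].
have : \sum_(s < p) (tau%:R / p%:R * h) <
    \sum_(s < p) \sum_(1 <= k < N.+1 | ((k + s) %% p < tau)%N) v k.
  apply: ltr_sum => [|s _].
    by apply/hasP; exists (Ordinal p0); rewrite ?mem_index_enum.
  by rewrite ltNge; apply/negP => hs; apply: no; exists s.
rewrite sumr_const card_ord -[X in X < _]mulr_natl mulrA mulrCA divff ?gt_eqF// mulr1.
by move=> h1 h2; have := lt_le_trans h1 h2; rewrite ltxx.
Qed.

Lemma cos_lipschitz (a b : R) : `|cos a - cos b| <= `|a - b|.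
Proof.
have -> : cos a - cos b = - 2 * (sin ((a + b) / 2) * sin ((a - b) / 2)).
  rewrite [in LHS](_ : a = (a + b) / 2 + (a - b) / 2); last by field.
  rewrite [X in _ - cos X](_ : b = (a + b) / 2 - (a - b) / 2); last by field.
  by rewrite cosD cosB; ring.
rewrite !normrM normrN [`|2|]ger0_norm//.
have := norm_sin_le ((a - b) / 2); rewrite [X in _ <= X]normrM [`|2^-1|]ger0_norm//.
have := sin_max ((a + b) / 2); have := normr_ge0 (sin ((a + b) / 2)).
have := normr_ge0 (sin ((a - b) / 2)); nra.
Qed.

Context d (T : measurableType d) (P : probability T R).

(** Both sides move: the cosine is Lipschitz and the first moment of |Z - m| is at most 2 eta, while
    the variance of m differs from 1 by at most 3 eta, which changes the Gaussian factor by at most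
    3/2 t^2 eta. *)
Lemma charfun_approx (Z m : T -> R) (t phi eta : R) :
  sqintg P Z -> sqintg P m -> \int[P]_x (Z x ^+ 2) = 1 ->
  0 < eta <= 1 -> \int[P]_x ((Z x - m x) ^+ 2) <= eta ^+ 2 ->
  `|\int[P]_x cos (phi + t * Z x) - expR (- (t ^+ 2 / 2)) * cos phi| <=
  `|\int[P]_x cos (phi + t * m x) -
    expR (- (\int[P]_x ((t * m x) ^+ 2) / 2)) * cos phi| +
  (2 * `|t| + 2 * t ^+ 2) * eta.
Proof.
move=> Zi mi Z1 /andP[eta0 eta1] Zm.
have di : sqintg P (fun x => Z x - m x) by exact: sqintgB.
have ci g : measurable_fun setT g -> intg P (fun x => cos (phi + t * g x)).
  move=> mg; apply: (@intg_bounded _ _ _ _ _ 1) => [|x]; last exact: cos_max.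
  apply: (measurableT_comp (f := cos)).
    exact: continuous_measurable_fun (@continuous_cos R).
  by apply: measurable_funD => //; exact: measurable_funM.
have h1 : `|\int[P]_x cos (phi + t * Z x) - \int[P]_x cos (phi + t * m x)| <=
    2 * `|t| * eta.
  have i1 := ci _ Zi.1; have i2 := ci _ mi.1.
  rewrite -RintegralB//.
  apply: le_trans (_ : \int[P]_x (`|t| * `|Z x - m x|) <= _).
    apply: Rintg_norm_le.
    - exact: intgB.
    - by apply: intgZ; apply: intg_abs; exact: sqintg_intg.
    - move=> x; apply: le_trans (cos_lipschitz _ _) _.
      by rewrite -normrM (_ : _ - _ = t * (Z x - m x))//; ring.
  rewrite RintegralZl//; last by apply: intg_abs; exact: sqintg_intg.
  have := Rintg_abs_le eta0 di.
  have : eta^-1 * \int[P]_x ((Z x - m x) ^+ 2) <= eta.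
    by rewrite ler_pdivrMl// -expr2.
  have := normr_ge0 t; nra.
have Em : `|\int[P]_x (m x ^+ 2) - 1| <= 3 * eta.
  rewrite -Z1 -RintegralB//; [|exact: mi.2|exact: Zi.2].
  (* Weighted mean inequality 2 |Z D| <= D^2 / eta + eta Z^2 for D = Z - m; the weights balance
     because D has second moment at most eta^2. *)
  apply: le_trans (_ : \int[P]_x ((1 + eta^-1) * (Z x - m x) ^+ 2 + eta * Z x ^+ 2) <= _).
    apply: Rintg_norm_le.
    - by apply: intgB; [exact: mi.2|exact: Zi.2].
    - by apply: intgD; apply: intgZ; [exact: di.2|exact: Zi.2].
    - move=> x; set D := Z x - m x.
      have -> : m x ^+ 2 - Z x ^+ 2 = D ^+ 2 - 2 * (Z x * D) by rewrite /D; ring.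
      apply: le_trans (ler_normB _ _) _; rewrite ger0_norm ?sqr_ge0//.
      have -> : (1 + eta^-1) * D ^+ 2 + eta * Z x ^+ 2 =
          D ^+ 2 + eta^-1 * (D ^+ 2 + (eta * Z x) ^+ 2) by field; rewrite gt_eqF.
      rewrite lerD2l ler_pdivlMl// -{1}(ger0_norm (ltW eta0)) -normrM ler_norml.
      have := sqr_ge0 (D - eta * Z x); have := sqr_ge0 (D + eta * Z x); nra.
  rewrite RintegralD//; [|apply: intgZ; exact: di.2|apply: intgZ; exact: Zi.2].
  rewrite !RintegralZl//; [|exact: di.2|exact: Zi.2].
  rewrite Z1 mulr1.
  have : (1 + eta^-1) * \int[P]_x ((Z x - m x) ^+ 2) <= (1 + eta^-1) * eta ^+ 2.
    by rewrite ler_wpM2l// addr_ge0// invr_ge0 ltW.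
  have -> : (1 + eta^-1) * eta ^+ 2 = eta ^+ 2 + eta by field; rewrite gt_eqF.
  nra.
have Etm : \int[P]_x ((t * m x) ^+ 2) = t ^+ 2 * \int[P]_x (m x ^+ 2).
  by rewrite -RintegralZl//; [apply: eq_Rintegral => x _; rewrite exprMn|exact: mi.2].
have h2 : `|expR (- (\int[P]_x ((t * m x) ^+ 2) / 2)) * cos phi -
    expR (- (t ^+ 2 / 2)) * cos phi| <= 2 * t ^+ 2 * eta.
  rewrite -mulrBl normrM.
  apply: le_trans (_ : `|expR (- (\int[P]_x ((t * m x) ^+ 2) / 2)) -
    expR (- (t ^+ 2 / 2))| * 1 <= _).
    by rewrite ler_wpM2l// cos_max.
  rewrite mulr1; apply: le_trans (expRN_lipschitz _ _) _.
  - by rewrite divr_ge0// Rintg_sqr_ge0.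
  - by rewrite divr_ge0// sqr_ge0.
  rewrite Etm -mulrBl -[X in _ - X]mulr1 -mulrBr normrM.
  rewrite [`|2^-1|]ger0_norm// normrM [`|t ^+ 2|]ger0_norm ?sqr_ge0//.
  have := sqr_ge0 t; nra.
have aux (i1 i2 e1 e2 c1 c2 : R) : `|i1 - i2| <= c1 -> `|e1 - e2| <= c2 ->
    `|i1 - e2| <= `|i2 - e1| + (c1 + c2).
  move=> c1h c2h; have -> : i1 - e2 = (i1 - i2) + ((i2 - e1) + (e1 - e2)) by ring.
  apply: le_trans (ler_normD _ _) _.
  have := ler_normD (i2 - e1) (e1 - e2); lra.
by rewrite mulrDl; exact: aux h1 h2.
Qed.

End approximation.
(** * Central limit theorem *)

Lemma lacunary_ratio_ge (R : realType) (q r : R) (n : nat -> nat) :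
  (forall k, (0 < k)%N -> (0 < n k)%N) -> r < q -> lacunary q n ->
  exists k0, (0 < k0)%N /\ forall k, (k0 <= k)%N -> r * (n k)%:R <= (n k.+1)%:R.
Proof.
move=> n0 rq; rewrite /lacunary limn_einf_lim.
rewrite (cvg_lim _ (@cvg_einfs_sup _ _))// => qle.
have : (r%:E < ereal_sup (range (einfs
    (fun k => ((n k.+1)%:R / (n k)%:R)%:E))))%E.
  by apply: lt_le_trans qle; rewrite lte_fin.
move=> /ereal_sup_gt[_ [m _ <-] rm]; exists m.+1; split => // k mk.
have nk : (0 : R) < (n k)%:R by rewrite ltr0n n0// (leq_trans _ mk).
rewrite -ler_pdivlMr// -lee_fin; apply: ltW; apply: lt_le_trans rm _.
by apply: ereal_inf_lbound; exists k => //=; exact: ltnW.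
Qed.

Lemma sumr1_le (R : realType) (l : seq nat) (G : pred nat) (m : nat) : uniq l ->
  (forall k, G k -> (k < m)%N) -> \sum_(k <- l | G k) 1 <= m%:R :> R.
Proof.
move=> ul Gm; rewrite -big_filter sumr1_size ler_nat -[leqRHS](size_iota 0 m).
apply: uniq_leq_size => [|k]; first exact: filter_uniq.
by rewrite mem_filter mem_iota add0n => /andP[/Gm].
Qed.

Lemma expr_unbounded (R : realType) (q x : R) : 1 < q -> exists k, x <= q ^+ k.
Proof.
move=> q1; have bern k : 1 + k%:R * (q - 1) <= q ^+ k.
  elim: k => [|k IH]; first by rewrite mul0r addr0 expr0.
  rewrite exprS -natr1; have k0 : (0 : R) <= k%:R by rewrite ler0n.
  have q0 : 0 <= q by rewrite ltW// (lt_trans ltr01).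
  have := ler_wpM2l q0 IH; have : 0 <= k%:R * (q - 1) ^+ 2 by rewrite mulr_ge0// sqr_ge0.
  lra.
exists (Num.truncn (x / (q - 1))).+1; apply: le_trans (bern _).
rewrite ler_wpDl// -ler_pdivrMr ?subr_gt0//.
exact/ltW/truncnS_gt.
Qed.

Section central_limit.
Context (R : realType).
Variables (n : nat -> nat) (q : R) (k0 : nat) (c : nat -> nat -> R) (f : R -> R).
Variables (M rho delta : R).
Local Notation int f := (Rintegral (@haar R) setT f).
Hypothesis n_gt0 : forall k, (0 < k)%N -> (0 < n k)%N.
Hypothesis q_gt1 : 1 < q.
Hypothesis k0_gt0 : (0 < k0)%N.
Hypothesis n_lac : forall k, (k0 <= k)%N -> q * (n k)%:R <= (n k.+1)%:R.
Hypothesis c_ge0 : forall k N, (0 < k <= N)%N -> 0 <= c k N.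
Hypothesis c_le1 : forall k N, (0 < k <= N)%N -> c k N <= 1.
Hypothesis h_cvg : sumsq c N @[N --> \oo] --> +oo.
Hypothesis f_per : periodic f 1.
Hypothesis f_L2 : sqintg haar f.
Hypothesis f_mean0 : int (fun x => f x) = 0.
Hypothesis M_gt0 : 0 < M.
Hypothesis rho_gt : 2^-1 < rho.
Hypothesis f_coef : forall j, (0 < j)%N ->
  `|fourier_cos f j| + `|fourier_sin f j| <= M * j%:R `^ (- rho).
Hypothesis L_small : forall D, (0 < D)%N ->
  (fun N => dioph_count c n N D) =o_\oo sumsq c.
Hypothesis delta_gt0 : 0 < delta.
Hypothesis norm_ge : forall N, (0 < N)%N ->
  delta * Num.sqrt (sumsq c N) <= norm2 (lacunary_sum c n f N).

Let a := fourier_cos f.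
Let b := fourier_sin f.
Let F := int (fun x => f x ^+ 2).
Let S N := lacunary_sum c n f N.
Let C := 2 / (1 - q `^ (- rho)).
Let n_gt0' k : (k0 <= k)%N -> (0 < n k)%N.
Proof. by move=> kk; apply: n_gt0; exact: leq_trans kk. Qed.
Let rho_gt0 : 0 < rho. Proof. by apply: lt_trans rho_gt; rewrite invr_gt0. Qed.
Let C_gt0 : 0 < C.
Proof.
by rewrite divr_gt0// subr_gt0; have /andP[] := powRN_itv01 q_gt1 rho_gt0.
Qed.
Let h_ge0 N : 0 <= sumsq c N. Proof. by apply: sumr_ge0 => k _; exact: sqr_ge0. Qed.

Let main D p tau s N x := \sum_(1 <= k < N.+1 | in_block k0 p tau s k)
  c k N * fourier_sum a b 0 D ((n k)%:R * x).

Let S_sqintg N : sqintg haar (S N).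
Proof.
rewrite /S /lacunary_sum.
rewrite (_ : (fun x => _) = fun x => \sum_(1 <= k < N.+1 | (0 < k)%N) c k N * f ((n k)%:R * x)).
  by apply: sqintg_sum => k k_gt0; apply: sqintgZ; apply: sqintg_dilation => //; exact: n_gt0.
apply/funext => x; rewrite big_nat_cond [RHS]big_nat_cond; apply: eq_bigl => k.
by case: k.
Qed.

Let main_sqintg D p tau s N : sqintg haar (main D p tau s N).
Proof.
apply: sqintg_sum => k _; apply: sqintgZ.
exact: trig_sqintg (trig_dil (n k) (trig_fourier_sum a b 0 D)).
Qed.

(** The difference has three parts: [e1], the indices below k0, where no growth is known and the
    crude bound is used; [e2], the Fourier tail; [e3], the gaps. Only the first bound is not
    proportional to h N, and it does not depend on N. *)
Lemma main_approx (D tau p N : nat) (T T0 : R) : (0 < p)%N ->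
  (forall E, tail_coef M rho D E <= T) -> (forall E, tail_coef M rho 0 E <= T0) ->
  exists s, int (fun x => (S N x - main D p tau s N x) ^+ 2) <=
    2 * (k0%:R ^+ 2 * F) + (8 * (C * T) + 4 * (C * T0 * (tau%:R / p%:R))) * sumsq c N.
Proof.
move=> p_gt0 TD T0D.
have [s hs] := @gap_shift R p tau N (fun k => c k N ^+ 2) p_gt0 (fun k => sqr_ge0 _).
exists s; set h := sumsq c N; have h0 : 0 <= h := h_ge0 N.
pose u k := c k N.
pose e1 x := \sum_(1 <= k < N.+1 | (0 < k < k0)%N) u k * f ((n k)%:R * x).
pose e2 x := \sum_(1 <= k < N.+1 | (k0 <= k)%N)
  u k * (f ((n k)%:R * x) - fourier_sum a b 0 D ((n k)%:R * x)).
pose gap k := (k0 <= k)%N && ((k + s) %% p < tau)%N.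
pose e3 x := \sum_(1 <= k < N.+1 | gap k) u k * fourier_sum a b 0 D ((n k)%:R * x).
have fd k : (0 < k)%N -> sqintg haar (fun x => f ((n k)%:R * x)).
  by move=> kg; apply: sqintg_dilation => //; exact: n_gt0.
have Sd k : sqintg haar (fun x => fourier_sum a b 0 D ((n k)%:R * x)).
  exact: trig_sqintg (trig_dil (n k) (trig_fourier_sum a b 0 D)).
have i1 : sqintg haar e1.
  by apply: sqintg_sum => k /andP[kg _]; apply: sqintgZ; exact: fd.
have i2 : sqintg haar e2.
  apply: sqintg_sum => k kg; apply: sqintgZ; apply: sqintgB => //.
  by apply: fd; exact: leq_trans kg.
have i3 : sqintg haar e3 by apply: sqintg_sum => k _; exact: sqintgZ.
have -> : int (fun x => (S N x - main D p tau s N x) ^+ 2) =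
    int (fun x => (e1 x + (e2 x + e3 x)) ^+ 2).
  apply: eq_Rintegral => x _; congr (_ ^+ 2).
  rewrite /S /lacunary_sum /main /e1 /e2 /e3.
  rewrite [X in _ - X]big_mkcond [X in _ = X + _]big_mkcond.
  rewrite [X in _ = _ + (X + _)]big_mkcond [X in _ = _ + (_ + X)]big_mkcond/=.
  rewrite -sumrB -!big_split/= big_nat_cond [RHS]big_nat_cond.
  apply: eq_bigr => k; rewrite andbT => /andP[kg _]; rewrite kg /gap /in_block /u.
  case: (ltnP k k0) => kk /=; first by rewrite subr0 !addr0.
  by case: ltnP => _; ring.
apply: le_trans (Rintg_sqrD_le i1 (sqintgD i2 i3)) _.
have b1 : int (fun x => e1 x ^+ 2) <= k0%:R ^+ 2 * F.
  apply: le_trans (@dilated_sum_variance_le _ n u f _ _ _ f_per f_L2) _.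
    by move=> k /andP[kg _]; exact: n_gt0.
  rewrite ler_wpM2r ?Rintg_sqr_ge0//.
  have cnt : \sum_(1 <= k < N.+1 | (0 < k < k0)%N) 1 <= k0%:R :> R.
    by apply: sumr1_le; [exact: iota_uniq|move=> k /andP[]].
  rewrite expr2; apply: ler_pM => //; [exact: sumr_ge0|by apply: sumr_ge0 => k _; exact: sqr_ge0|].
  apply: le_trans cnt; rewrite big_nat_cond [leRHS]big_nat_cond.
  apply: ler_sum => k /andP[kN _]; rewrite /u -[leRHS](expr1n _ 2).
  by rewrite ler_pXn2r ?nnegrE ?c_ge0 ?c_le1//; lia.
have b2 : int (fun x => e2 x ^+ 2) <= 2 * (C * T * h).
  apply: le_trans (@remainder_variance_le _ n q k0 f M rho q_gt1 n_gt0' n_lac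
    rho_gt0 M_gt0 f_coef f_per f_L2 f_mean0 D N (fun k => (k0 <= k)%N) u T (fun k => id) TD) _.
  rewrite ler_pM2l// ler_wpM2l//.
    rewrite mulr_ge0 ?(ltW C_gt0)//; apply: le_trans (TD 0%N).
    by rewrite mulr_ge0 ?sqr_ge0// sumr_ge0// => j _; exact: powR_ge0.
  rewrite /h /sumsq big_mkcond; apply: ler_sum => k _; case: ifP => // _; exact: sqr_ge0.
have b3 : int (fun x => e3 x ^+ 2) <= C * T0 * (tau%:R / p%:R * h).
  have T00 : 0 <= tail_coef M rho 0 D.
    by rewrite mulr_ge0 ?sqr_ge0// sumr_ge0// => j _; exact: powR_ge0.
  apply: le_trans (@lacunary_sum_variance_le _ n q k0 a b M rho q_gt1 n_gt0' n_lac
    rho_gt0 M_gt0 f_coef 0 D N gap u _) _; first by move=> k /andP[].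
  apply: ler_pM => //.
  - by rewrite mulr_ge0 ?(ltW C_gt0).
  - by apply: sumr_ge0 => k _; exact: sqr_ge0.
  - by rewrite ler_wpM2l ?(ltW C_gt0).
  - apply: le_trans hs; rewrite big_mkcond [leRHS]big_mkcond; apply: ler_sum => k _.
    by rewrite /gap /u; case: (k0 <= k)%N; case: ltnP => //= _; exact: sqr_ge0.
have := Rintg_sqrD_le i2 i3; rewrite -/h.
rewrite mulrDl; lra.
Qed.

Let sup_bound (N D m : nat) : (0 < m)%N ->
  \sum_(1 <= k < N.+1) \sum_(1 <= l < N.+1) \sum_(1 <= j < D.+1) \sum_(1 <= j' < D.+1)
    c k N * c l N * ((j * n k)%:Z - (j' * n l)%:Z == m%:Z)%:R <= dioph_count c n N D.
Proof.
move=> m0; apply: ub_le_sup; last by exists m%:Z.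
exists (\sum_(1 <= k < N.+1) \sum_(1 <= l < N.+1) \sum_(1 <= j < D.+1)
  \sum_(1 <= j' < D.+1) c k N * c l N) => _ [d _ <-].
rewrite big_nat_cond [leRHS]big_nat_cond; apply: ler_sum => k; rewrite andbT ltnS => kN.
rewrite big_nat_cond [leRHS]big_nat_cond; apply: ler_sum => l; rewrite andbT ltnS => lN.
apply: ler_sum => j _; apply: ler_sum => j' _.
by rewrite ler_piMr ?mulr_ge0 ?(c_ge0 kN) ?(c_ge0 lN)//; case: (_ == _).
Qed.

Lemma charfun_cvg (t phi : R) :
  int (fun x => cos (t * (S N x / norm2 (S N)) + phi)) @[N --> \oo] -->
  expR (- (t ^+ 2 / 2)) * cos phi.
Proof.
apply/cvgrPdist_le => e e0.
have t2 : 0 <= t ^+ 2 := sqr_ge0 t.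
have d2 : 0 < delta ^+ 2 by rewrite exprn_gt0.
have C0 := C_gt0.
(* Half of e pays for [charfun_approx]; the summand 1 keeps [B0] positive at t = 0. *)
pose B0 := 2 * `|t| + 2 * t ^+ 2 + 1.
have B00 : 0 < B0 by rewrite ltr_wpDl// addr_ge0// mulr_ge0.
pose eta := Num.min 1 (e / 2 / B0).
have eta0 : 0 < eta by rewrite lt_min ltr01/= !divr_gt0.
have eta1 : eta <= 1 by rewrite ge_min lexx.
have etaB : (2 * `|t| + 2 * t ^+ 2) * eta <= e / 2.
  apply: le_trans (_ : B0 * eta <= _); first by rewrite ler_pM2r// lerDl.
  by rewrite mulrC -ler_pdivlMr// ge_min lexx orbT.
have eta2 : 0 < eta ^+ 2 by rewrite exprn_gt0.
have M2 : 0 < M ^+ 2 by rewrite exprn_gt0.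
have rho2 : 1 < 2 * rho by rewrite mulrC -ltr_pdivrMr// mul1r.
(* The three summands of [main_approx] each receive a third of eta^2 delta^2 h N. Here 8 C T is that
   share for the Fourier tail; p settles the gaps, and large N the indices below k0. *)
pose T := eta ^+ 2 * delta ^+ 2 / (24 * C).
have T_gt0 : 0 < T by apply: divr_gt0; apply: mulr_gt0.
have [D D_gt0 TD] : exists2 D : nat, (0 < D)%N &
    forall E, tail_coef M rho D E <= T.
  have [D D_gt0 hD] := p_series_tail rho2 (divr_gt0 T_gt0 M2).
  by exists D => // E; rewrite /tail_coef mulrC -ler_pdivlMr//; exact: hD.
have [T0 T0_gt0 T0D] : exists2 T0 : R, 0 < T0 & forall E, tail_coef M rho 0 E <= T0.
  have [D1 D1_gt0 hD1] := p_series_tail rho2 (@ltr01 R).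
  have s0 (i j : nat) : 0 <= \sum_(i <= j < j) j%:R `^ (- (2 * rho)) :> R.
    by apply: sumr_ge0 => k _; exact: powR_ge0.
  exists (M ^+ 2 * (\sum_(1 <= j < D1.+1) j%:R `^ (- (2 * rho)) + 1)).
    by rewrite mulr_gt0// ltr_wpDl.
  move=> E; rewrite /tail_coef ler_pM2l//.
  have [ED|DE] := leqP E D1.
    rewrite (@big_cat_nat _ _ _ E.+1 1 D1.+1)//= -addrA lerDl addr_ge0//.
  by rewrite (@big_cat_nat _ _ _ D1.+1 1 E.+1)//= ?lerD2l ?hD1// ltnW.
(* A gap of this length multiplies frequencies by at least D + 1, as the separation of blocks
   requires. *)
have [tau htau] := expr_unbounded D.+1%:R q_gt1.
have [p p_gt0 hp] : exists2 p : nat, (0 < p)%N &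
    12 * C * T0 * tau%:R / (eta ^+ 2 * delta ^+ 2) < p%:R.
  by eexists; last exact: truncnS_gt.
have pR : (0 : R) < p%:R by rewrite ltr0n.
have n_sep k l : (k0 <= k)%N -> (k + tau <= l)%N -> (D.+1 * n k <= n l)%N.
  move=> kk kl; rewrite -(ler_nat R) natrM.
  have := lacunary_growth q_gt1 n_lac (l - k) kk.
  rewrite subnKC; last by apply: leq_trans kl; exact: leq_addr.
  apply: le_trans; rewrite ler_wpM2r// (le_trans htau)// ler_weXn2l ?(ltW q_gt1)//.
  by rewrite leq_subRL//; apply: leq_trans kl; exact: leq_addr.
pose A := coef_sum D a b.
have A0 : 0 <= A by apply: sumr_ge0 => j _; exact: addr_ge0.
(* A bound for Q free of N: the squares of the weights t c / sigma sum to t^2 h / sigma^2 <= t^2 /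
   delta^2. *)
pose Q0 := p%:R * A ^+ 2 * (t ^+ 2 / delta ^+ 2).
have A2 : 0 <= A ^+ 2 := sqr_ge0 A.
have Q00 : 0 <= Q0 by apply: mulr_ge0; [exact: mulr_ge0|rewrite divr_ge0 ?(ltW d2)].
pose K := expR (Q0 / 2); have K0 : 0 < K := expR_gt0 _.
(* The remaining half of e: K eta' uses e / 8, and everything else is at most xi B <= e / 4, where
   xi bounds both the block sums and the Diophantine term. *)
pose eta' := e / 8 / K; have eta'0 : 0 < eta' by rewrite !divr_gt0.
pose B := Q0 + K * (eta'^-1 * (Q0 * (1 + 2 * A ^+ 2))).
have B_ge0 : 0 <= B.
  rewrite addr_ge0// mulr_ge0 ?(ltW K0)// mulr_ge0 ?invr_ge0 ?(ltW eta'0)//.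
  by rewrite mulr_ge0// addr_ge0// mulr_ge0 ?sqr_ge0.
pose xi := Num.min 1 (e / 4 / (B + 1)).
have B1 : 0 < B + 1 by rewrite ltr_wpDl.
have xi0 : 0 < xi by rewrite lt_min ltr01/= !divr_gt0.
have xi1 : xi <= 1 by rewrite ge_min lexx.
have xiB : xi * B <= e / 4.
  apply: le_trans (_ : xi * (B + 1) <= _); first by rewrite ler_pM2l// lerDl.
  by rewrite -ler_pdivlMr// ge_min lexx orbT.
have h_ge (y : R) : \forall N \near \oo, y <= sumsq c N.
  by move/cvgryPge : h_cvg; exact.
(* Dividing by t^2 + 1 instead of t^2 covers t = 0. *)
have dio : \forall N \near \oo,
    dioph_count c n N D <= xi * delta ^+ 2 / (t ^+ 2 + 1) * sumsq c N.
  have e1 : 0 < xi * delta ^+ 2 / (t ^+ 2 + 1).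
    by rewrite divr_gt0 ?mulr_gt0// ltr_wpDl.
  have /eqoP/(_ _ e1) := L_small D_gt0; apply: filterS => N.
  by rewrite (ger0_norm (h_ge0 N)); apply: le_trans; exact: ler_norm.
near=> N.
have N_gt0 : (0 < N)%N by near: N; exists 1%N.
have h1 : 1 <= sumsq c N by near: N; exact: h_ge.
have hF : 6 * (k0%:R ^+ 2 * F) / (delta ^+ 2 * eta ^+ 2) <= sumsq c N by near: N; exact: h_ge.
(* With sigma >= delta sqrt h this makes the bound p |t| A / sigma on the block sums at most xi. *)
have hy : (p%:R * `|t| * A / (delta * xi)) ^+ 2 <= sumsq c N by near: N; exact: h_ge.
have hL : dioph_count c n N D <= xi * delta ^+ 2 / (t ^+ 2 + 1) * sumsq c N by near: N.
pose h := sumsq c N; rewrite -/h in h1 hF hy hL.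
have h0 : 0 < h by exact: lt_le_trans h1.
set sigma := norm2 (S N).
have sqh0 : 0 < Num.sqrt h by rewrite sqrtr_gt0.
have sig : delta * Num.sqrt h <= sigma by exact: norm_ge.
have sig0 : 0 < sigma by apply: lt_le_trans sig; rewrite mulr_gt0.
have sig2 : sigma ^+ 2 = int (fun x => S N x ^+ 2).
  by rewrite /sigma /norm2 sqr_sqrtr// Rintg_sqr_ge0.
have dh : delta ^+ 2 * h <= sigma ^+ 2.
  rewrite -[h](sqr_sqrtr (ltW h0)) -exprMn ler_pXn2r ?nnegrE ?(ltW sig0)//.
  by rewrite ltW// mulr_gt0.
have s20 : 0 < sigma ^+ 2 by rewrite exprn_gt0.
have [s hs] := main_approx tau N p_gt0 TD T0D.
pose Z x := sigma^-1 * S N x; pose m x := sigma^-1 * main D p tau s N x.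
have Zi : sqintg haar Z by exact: sqintgZ.
have mi : sqintg haar m by exact: sqintgZ.
have Z1 : int (fun x => Z x ^+ 2) = 1.
  transitivity (int (fun x => (sigma ^+ 2)^-1 * S N x ^+ 2)).
    by apply: eq_Rintegral => x _; rewrite exprMn exprVn.
  by rewrite RintegralZl//; [rewrite -sig2 mulVf ?gt_eqF|exact: (S_sqintg N).2].
have Zm : int (fun x => (Z x - m x) ^+ 2) <= eta ^+ 2.
  have di := sqintgB (S_sqintg N) (main_sqintg D p tau s N).
  rewrite (_ : int _ = int (fun x =>
      (sigma ^+ 2)^-1 * (S N x - main D p tau s N x) ^+ 2)); last first.
    by apply: eq_Rintegral => x _; rewrite -mulrBr exprMn exprVn.
  rewrite RintegralZl//; last exact: di.2.
  rewrite ler_pdivrMl//; apply: le_trans hs _; rewrite -/h.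
  apply: le_trans (_ : delta ^+ 2 * h * eta ^+ 2 <= _); last by rewrite ler_pM2r.
  rewrite ler_pdivrMr ?mulr_gt0// in hF.
  have E1 : 8 * (C * T) = eta ^+ 2 * delta ^+ 2 / 3.
    by rewrite /T; field; rewrite gt_eqF.
  have E2 : 4 * (C * T0 * (tau%:R / p%:R)) <= eta ^+ 2 * delta ^+ 2 / 3.
    move: hp; rewrite ltr_pdivrMr ?mulr_gt0// => hp.
    rewrite (_ : 4 * _ = (12 * C * T0 * tau%:R) / 3 / p%:R); last by field; rewrite gt_eqF.
    by rewrite ler_pdivrMr//; lra.
  have := ler_wpM2r (ltW h0) E2; rewrite E1; lra.
have eta01 : 0 < eta <= 1 by rewrite eta0.
have := charfun_approx t phi Zi mi Z1 eta01 Zm.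
pose u k := t / sigma * c k N.
have tm x : t * m x = \sum_(1 <= k < N.+1 | in_block k0 p tau s k)
    u k * fourier_sum a b 0 D ((n k)%:R * x).
  by rewrite /m mulrA /main mulr_sumr; apply: eq_bigr => k _; rewrite /u !mulrA.
pose um := `|t| / sigma.
have um0 : 0 <= um by rewrite divr_ge0// ltW.
have uE k : (0 < k <= N)%N -> `|u k| = um * c k N.
  by move=> kN; rewrite /u !normrM (ger0_norm (c_ge0 kN)) normfV (gtr0_norm sig0).
have u_le k : (0 < k <= N)%N -> `|u k| <= um.
  by move=> kN; rewrite uE// ler_piMr// c_le1.
have um2 : um ^+ 2 = t ^+ 2 / sigma ^+ 2.
  by rewrite /um exprMn exprVn real_normK ?num_real.
pose L := um ^+ 2 * dioph_count c n N D.
have L_le mm : (0 < mm)%N ->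
  \sum_(1 <= k < N.+1) \sum_(1 <= l < N.+1) \sum_(1 <= j < D.+1) \sum_(1 <= j' < D.+1)
    `|u k| * `|u l| * ((j * n k)%:Z - (j' * n l)%:Z == mm%:Z)%:R <= L.
  move=> mm0; apply: le_trans (ler_wpM2l (sqr_ge0 um) (sup_bound N D mm0)).
  rewrite mulr_sumr big_nat_cond [leRHS]big_nat_cond; apply: ler_sum => k; rewrite andbT ltnS => kN.
  rewrite mulr_sumr big_nat_cond [leRHS]big_nat_cond; apply: ler_sum => l; rewrite andbT ltnS => lN.
  rewrite mulr_sumr; apply: ler_sum => j _; rewrite mulr_sumr; apply: ler_sum => j' _.
  by rewrite !uE// le_eqVlt; apply/orP; left; apply/eqP; ring.
have y_le : p%:R * um * A <= xi.
  have pA0 : 0 <= p%:R * `|t| * A / (delta * xi).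
    by rewrite divr_ge0 ?mulr_ge0 ?(ltW delta_gt0) ?(ltW xi0).
  have : p%:R * `|t| * A / (delta * xi) <= Num.sqrt h.
    by rewrite -[leLHS](ger0_norm pA0) -sqrtr_sqr ler_wsqrtr.
  rewrite ler_pdivrMr ?mulr_gt0// => hh.
  rewrite /um (_ : _ * _ * A = (p%:R * `|t| * A) / sigma); last by ring.
  rewrite ler_pdivrMr//; apply: le_trans hh _.
  by rewrite mulrA [leRHS]mulrC ler_pM2r// mulrC.
have L_xi : L <= xi.
  rewrite /L um2 mulrAC ler_pdivrMr//.
  apply: le_trans (ler_wpM2l t2 hL) _.
  apply: le_trans (_ : xi * (delta ^+ 2 * h) <= _); last by rewrite ler_pM2l.
  have t21 : 0 < t ^+ 2 + 1 by rewrite ltr_wpDl.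
  rewrite [leLHS](_ : _ = t ^+ 2 / (t ^+ 2 + 1) * (xi * (delta ^+ 2 * h))); last first.
    by field; rewrite gt_eqF.
  rewrite ler_piMl//.
    by apply: mulr_ge0; [exact: ltW|apply: mulr_ge0; exact: ltW].
  by rewrite ler_pdivrMr// mul1r lerDl.
have L0 : 0 <= L.
  apply: le_trans (L_le 1%N isT); (do 4 apply: sumr_ge0 => ? _).
  by apply: mulr_ge0 => //; exact: mulr_ge0.
have y1 : p%:R * um * A <= 1 by exact: le_trans y_le xi1.
pose y := p%:R * um * A; have y0 : 0 <= y by apply: mulr_ge0 => //; exact: mulr_ge0.
pose Q := p%:R * A ^+ 2 * \sum_(1 <= k < N.+1) u k ^+ 2.
have Q0' : 0 <= Q by rewrite !mulr_ge0 ?sqr_ge0// sumr_ge0// => k _; exact: sqr_ge0.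
have QQ : Q <= Q0.
  rewrite /Q /Q0 ler_wpM2l ?mulr_ge0 ?sqr_ge0//.
  rewrite (eq_bigr (fun k => um ^+ 2 * c k N ^+ 2)); last first.
    by move=> k _; rewrite /u um2 !exprMn exprVn.
  rewrite -mulr_sumr -/(sumsq c N) -/h um2.
  rewrite mulrAC ler_pdivrMr// [leRHS]mulrAC ler_pdivlMr// -[leLHS]mulrA.
  by apply: ler_wpM2l => //; rewrite mulrC.
have := @gapped_charfun R n k0 D p tau s N a b u n_gt0' n_sep p_gt0 um L um0 u_le L_le y1
  phi eta' y Q eta'0 erefl erefl.
rewrite -/A => gc.
have gcb : y * Q + expR (Q / 2) * (eta' + eta'^-1 * (Q * (y ^+ 2 + 2 * A ^+ 2 * L))) <= e / 2.
  have X1 : y * Q <= xi * Q0 by apply: ler_pM.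
  have y2 : y ^+ 2 <= xi.
    by apply: le_trans (_ : xi * 1 <= _); [rewrite expr2; exact: ler_pM|rewrite mulr1].
  have yAL : 0 <= y ^+ 2 + 2 * A ^+ 2 * L.
    by apply: addr_ge0; [exact: sqr_ge0|apply: mulr_ge0 => //; exact: mulr_ge0].
  have X2 : Q * (y ^+ 2 + 2 * A ^+ 2 * L) <= Q0 * (xi * (1 + 2 * A ^+ 2)).
    apply: ler_pM => //; rewrite mulrDr mulr1 lerD// mulrC ler_wpM2r//.
    exact: mulr_ge0.
  have X3 : expR (Q / 2) * (eta' + eta'^-1 * (Q * (y ^+ 2 + 2 * A ^+ 2 * L))) <=
      K * (eta' + eta'^-1 * (Q0 * (xi * (1 + 2 * A ^+ 2)))).
    apply: ler_pM; first exact: expR_ge0.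
    - rewrite addr_ge0 ?(ltW eta'0)//; apply: mulr_ge0; last exact: mulr_ge0.
      by rewrite invr_ge0 (ltW eta'0).
    - by rewrite ler_expR ler_pM2r.
    - by rewrite lerD2l ler_wpM2l// invr_ge0 ltW.
  have X4 : K * (eta' + eta'^-1 * (Q0 * (xi * (1 + 2 * A ^+ 2)))) + xi * Q0 =
      e / 8 + xi * B.
    rewrite mulrDr /B [K * eta'](_ : _ = e / 8); last by rewrite /eta' mulrC divfK ?gt_eqF.
    by ring.
  lra.
under [X in _ <= `|X - _| + _]eq_Rintegral do rewrite tm.
under [X in _ <= `|_ - expR (- (X / 2)) * _| + _]eq_Rintegral do rewrite tm.
rewrite distrC (_ : (fun x => cos (phi + t * Z x)) =
    (fun x => cos (t * (S N x / sigma) + phi))); last first.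
  by apply/funext => x; rewrite /Z addrC; congr cos; ring.
move=> ca; apply: le_trans ca _.
by have := le_trans gc gcb; lra.
Unshelve. all: by end_near. Qed.

Let normalized_sqintg N : sqintg haar (fun x => S N x / norm2 (S N)).
Proof.
rewrite (_ : (fun x => _) = fun x => (norm2 (S N))^-1 * S N x); first exact: sqintgZ.
by apply/funext => x; rewrite mulrC.
Qed.

Let normalized_variance_le N : int (fun x => (S N x / norm2 (S N)) ^+ 2) <= 1.
Proof.
rewrite (_ : int _ = int (fun x => (norm2 (S N) ^+ 2)^-1 * S N x ^+ 2)); last first.
  by apply: eq_Rintegral => x _; rewrite exprMn exprVn mulrC.
rewrite RintegralZl//; last exact: (S_sqintg N).2.
rewrite /norm2 sqr_sqrtr ?Rintg_sqr_ge0//.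
(* The norm can vanish, as for the empty sum at N = 0; the variance of the quotient is then 0, hence
   an inequality and not an equality. *)
have [->|nz] := eqVneq (int (fun x => S N x ^+ 2)) 0; first by rewrite mulr0.
by rewrite mulVf.
Qed.

Lemma lacunary_clt :
  cvg_in_distribution haar (fun N x => S N x / norm2 (S N)) (normal_prob 0 1).
Proof.
split=> [N|g gc gb]; first exact: (normalized_sqintg N).1.
apply: (@cvg_Rintg_bounded_continuous _ _ _ _ _ _ 1) => // t phi.
by rewrite std_normal_charfun; exact: charfun_cvg.
Qed.

End central_limit.
Theorem theorem1 (R : realType)
    (n : nat -> nat) (q : R)
    (n_gt0 : forall k, (0 < k)%N -> (0 < n k)%N)
    (q_gt1 : 1 < q) (n_lac : lacunary q n)
    (c : nat -> nat -> R)
    (c_ge0 : forall k N, (0 < k <= N)%N -> 0 <= c k N)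
    (c_le1 : forall k N, (0 < k <= N)%N -> c k N <= 1)
    (h_cvg : sumsq c N @[N --> \oo] --> +oo)
    (f : R -> R)
    (f_per : periodic f 1)
    (f_L2 : f \in Lfun haar 2%:E)
    (f_mean0 : \int[haar]_x f x = 0)
    (f_var : (0 < \int[haar]_x (f x ^+ 2)%:E < +oo)%E)
    (M rho : R) (M_gt0 : 0 < M) (rho_gt : 2^-1 < rho)
    (f_coef : forall j, (0 < j)%N ->
       `|fourier_cos f j| + `|fourier_sin f j| <= M * j%:R `^ (- rho))
    (L_small : forall D, (0 < D)%N ->
       (fun N => dioph_count c n N D) =o_\oo sumsq c)
    (delta : R) (delta_gt0 : 0 < delta)
    (norm_ge : forall N, (0 < N)%N ->
       delta * Num.sqrt (sumsq c N) <= norm2 (lacunary_sum c n f N)) :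
  cvg_in_distribution haar
    (fun N x => lacunary_sum c n f N x / norm2 (lacunary_sum c n f N))
    (normal_prob 0 1).
Proof.
(* A lower limit of at least q bounds the ratios eventually only by numbers below q; the midpoint of
   1 and q still exceeds 1. *)
have r1 : 1 < (1 + q) / 2 by lra.
have rq : (1 + q) / 2 < q by lra.
have [k0 [k0_gt0 n_ge]] := lacunary_ratio_ge n_gt0 rq n_lac.
have f_sq : sqintg haar f.
  split; last exact: Lfun2_integrable_sqr.
  by have := sub_Lfun_mfun f_L2; rewrite inE.
exact: (@lacunary_clt R n ((1 + q) / 2) k0 c f M rho delta).
Qed.
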